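(* There exists a constant $C>0$ such that the following is true. Let $B$ be a finite set and let $V$ be a linear subspace (over $\mathbb{Q}$) of functions $f:B\to\mathbb{Q}$. Assume that the following conditions hold for some integers $c_1,c_2,c_3\ge1$: (1) Divisibility: $c_1$ is the divisibility constant of $V$. (2) Boundedness of $V$: $V$ has a $c_2$-bounded integer basis in $\ell_\infty$. (3) Boundedness of $V^\perp$: $V^\perp$ has a $c_3$-bounded integer basis in $\ell_1$. (4) Symmetry: for any $b_1,b_2\in B$ there exists a symmetry $\pi$ of $V$ satisfying $\pi(b_1)=b_2$. (5) Constant functions: the constant functions belong to $V$. Let $N$ be an integer multiple of $c_1$ satisfying $$\min(N,|B|-N)\ge C\cdot c_2c_3^2\dim(V)^6\log(2c_3\dim(V))^6.$$ Then the number of subsets $T\subset B$ of size $N$ which satisfy $$\frac{1}{|T|}\sum_{t\in T}f(t)=\frac{1}{|B|}\sum_{b\in B}f(b)\quad\text{for all } f\in V$$ equals $$\frac{\rho(V)}{(2\pi p(1-p))^{\frac{\dim(V)}{2}}\,p^N(1-p)^{|B|-N}}(1+\delta),$$ where $p:=\frac{N}{|B|}$ and $$|\delta|\le\frac{C\dim(V)^3(\log(2c_2\dim(V)))^{3/2}}{\sqrt{\min(N,|B|-N)}}.$$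
   Context: Divisibility constant: the set of all integers $N$ for which there exists $\gamma\in\mathbb{Z}^B$ with $\sum_{b\in B}\gamma_bf(b)=\frac{N}{|B|}\sum_{b\in B}f(b)$ for all $f\in V$ consists of all integer multiples of some minimal positive integer; this integer is the divisibility constant of $V$. Bounded integer basis: for a subspace $W\subset\mathbb{Q}^B$ and $1\le p\le\infty$, $W$ has a $c$-bounded integer basis in $\ell_p$ if $W$ is spanned (over $\mathbb{Q}$) by integer vectors of $\ell_p$ norm at most $c$, i.e. $\mathrm{Span}(\{\gamma\in W\cap\mathbb{Z}^B:\ \|\gamma\|_p\le c\})=W$. Here $\|\gamma\|_1=\sum_{b}|\gamma_b|$ and $\|\gamma\|_\infty=\max_b|\gamma_b|$. Orthogonal complement: $V^\perp:=\{g\in\mathbb{Q}^B:\ \sum_{b\in B}f(b)g(b)=0\ \ \forall f\in V\}$. Symmetry: a symmetry of $V$ is a permutation $\pi$ of $B$ satisfying $f\circ\pi\in V$ for all $f\in V$. The parameter $\rho(V)$: choose a basis $(\phi_a)_{a\in A}$ of $V$, define $\phi:B\to\mathbb{Q}^A$ by $\phi(b)_a=\phi_a(b)$ (also regarded as a $B\times A$ matrix), and let $\mathcal{L}(\phi):=\{\sum_{b\in B}n_b\phi(b):\ n_b\in\mathbb{Z}\}\subset\mathbb{Q}^A$ be the lattice spanned by the vectors $\phi(b)$. Then $$\rho(V):=\frac{\det(\mathcal{L}(\phi))}{\sqrt{\det(\phi^t\phi)}},$$ where $\det(\mathcal{L}(\phi))$ is the determinant (covolume in $\mathbb{R}^A$)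 of the lattice, and $\phi^t\phi$ is the $A\times A$ matrix with entries $\sum_{b\in B}\phi(b)_a\phi(b)_{a'}$. The value of $\rho(V)$ is independent of the choice of basis. *)

(* Defs.v *)
From HB Require Import structures.
From mathcomp Require Import all_boot all_order all_algebra all_fingroup.
From mathcomp Require Import all_classical all_reals all_analysis.

Set Implicit Arguments.
Unset Strict Implicit.
Unset Printing Implicit Defensive.

Import Order.TTheory GRing.Theory Num.Theory.
Local Open Scope ring_scope.

(* The regular module [rat^o] is what makes this type a Q-vector space. *)
Notation ratfun B := {ffun B -> rat^o}.

Definition dotf (B : finType) (f g : ratfun B) : rat :=
  \sum_(b : B) (f b : rat) * (g b : rat).

Definition ratfun_of_int (B : finType) (g : {ffun B -> int}) : ratfun B :=
  [ffun b => (g b)%:~R].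

Definition divisible_by (B : finType) (V : {vspace ratfun B}) (N : int) : Prop :=
  exists g : {ffun B -> int}, forall f : ratfun B, f \in V ->
    \sum_(b : B) (g b)%:~R * (f b : rat)
      = N%:~R / #|B|%:R * \sum_(b : B) (f b : rat).

Definition is_divisibility_constant (B : finType) (V : {vspace ratfun B})
    (c : nat) : Prop :=
  (0 < c)%N /\ forall N : int, divisible_by V N <-> (c%:Z %| N)%Z.

Definition l1_norm (B : finType) (g : {ffun B -> int}) : nat :=
  (\sum_(b : B) `|g b|)%N.

Definition linf_norm (B : finType) (g : {ffun B -> int}) : nat :=
  (\max_(b : B) `|g b|)%N.

Definition bounded_integer_basis (B : finType) (nrm : {ffun B -> int} -> nat)
    (c : nat) (W : {vspace ratfun B}) : Prop :=
  exists s : seq {ffun B -> int},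
    (forall g, g \in s -> ratfun_of_int g \in W /\ (nrm g <= c)%N) /\
    <<[seq ratfun_of_int g | g <- s]>>%VS = W.

(* [V^\perp] as the kernel of the pairing with a basis of [V]; see
   [mem_orthv]. *)
Definition orthv (B : finType) (V : {vspace ratfun B}) : {vspace ratfun B} :=
  lker (linfun (fun g : ratfun B =>
    ([ffun i : 'I_(\dim V) => dotf (vbasis V)`_i g]
       : {ffun 'I_(\dim V) -> rat^o}))).

Definition is_symmetry (B : finType) (V : {vspace ratfun B}) (s : {perm B}) :
    Prop :=
  forall f : ratfun B, f \in V -> [ffun b => f (s b)] \in V.

Definition int_span (I : finType) (d : nat) (v : I -> 'rV[rat]_d) :
    set 'rV[rat]_d :=
  [set x | exists n : I -> int, x = \sum_(i : I) v i *~ n i]%classic.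

(* A matrix is read as the family of its rows. *)
Definition is_lattice_basis (d : nat) (L : set 'rV[rat]_d) (M : 'M[rat]_d) :
    Prop :=
  M \in unitmx /\ L = int_span (fun i => row i M).

(* The junk value [0] is only taken when [L] is not a full-rank lattice. *)
Definition lattice_det (d : nat) (L : set 'rV[rat]_d) : rat :=
  xget 0 [set r | exists M : 'M[rat]_d, is_lattice_basis L M /\ r = `|\det M|]%classic.

Definition basis_eval (B : finType) (d : nat) (X : d.-tuple (ratfun B)) (b : B) :
    'rV[rat]_d :=
  \row_(a < d) (tnth X a b : rat).

Definition gram (B : finType) (d : nat) (X : d.-tuple (ratfun B)) : 'M[rat]_d :=
  \matrix_(a, a')
    \sum_(b : B) basis_eval X b 0 a * basis_eval X b 0 a'.

Definition rho_of (R : realType) (B : finType) (d : nat)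
    (X : d.-tuple (ratfun B)) : R :=
  ratr (lattice_det (int_span (basis_eval X))) / Num.sqrt (ratr (\det (gram X))).

(* [rho_of_basis] shows that any other basis of [V] gives the same value. *)
Definition rho (R : realType) (B : finType) (V : {vspace ratfun B}) : R :=
  rho_of R (vbasis V).

Definition same_average (B : finType) (V : {vspace ratfun B}) (T : {set B}) :
    Prop :=
  forall f : ratfun B, f \in V ->
    (#|T|%:R)^-1 * \sum_(t in T) (f t : rat)
      = (#|B|%:R)^-1 * \sum_(b : B) (f b : rat).

Definition design_count (B : finType) (V : {vspace ratfun B}) (N : nat) : nat :=
  #|[set T : {set B} | (#|T| == N) && `[< same_average V T >]]|.

Lemma dotfC (B : finType) (f g : ratfun B) : dotf f g = dotf g f.
Proof. by apply: eq_bigr => b _; rewrite mulrC. Qed.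

Lemma dotf_linear (B : finType) (f : ratfun B) (a : rat) (g h : ratfun B) :
  dotf f (a *: g + h) = a * dotf f g + dotf f h.
Proof.
rewrite /dotf mulr_sumr -big_split; apply: eq_bigr => b _ /=.
by rewrite !ffunE mulrDr mulrCA.
Qed.

Lemma mem_orthv (B : finType) (V : {vspace ratfun B}) (g : ratfun B) :
  g \in orthv V <-> (forall f : ratfun B, f \in V -> dotf f g = 0).
Proof.
pose F (h : ratfun B) : {ffun 'I_(\dim V) -> rat^o} := [ffun i : 'I_(\dim V) => dotf (vbasis V)`_i h].
have linF : linear F.
  by move=> a x y; apply/ffunP => i; rewrite !ffunE dotf_linear.
pose FL := GRing.isLinear.Build rat _ _ _ F linF.
pose FM : {linear _ -> _} := HB.pack F FL.
have memF : (g \in orthv V) = (F g == 0) by rewrite memv_ker (lfunE FM).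
rewrite memF; split=> [/eqP/ffunP F0 f fV | H].
  rewrite (coord_vbasis fV) dotfC.
  have dotg0 : dotf g 0 = 0 by apply: big1 => b _; rewrite ffunE mulr0.
  apply: (big_ind (fun h => dotf g h = 0)) => //.
    by move=> x y hx hy; rewrite -[x]scale1r dotf_linear hx hy mulr0 addr0.
  move=> i _; rewrite -[_ *: _]addr0 dotf_linear dotg0 addr0 dotfC.
  by have := F0 i; rewrite !ffunE => ->; rewrite mulr0.
by apply/eqP/ffunP => i; rewrite !ffunE H // vbasis_mem // mem_nth ?size_tuple.
Qed.

Lemma int_span_rowE (d m : nat) (M : 'M[rat]_(m, d)) (x : 'rV[rat]_d) :
  int_span (fun i => row i M) x
    <-> exists n : 'rV[int]_m, x = map_mx intr n *m M.
Proof.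
split=> [[n ->]|[n ->]].
  exists (\row_i n i); rewrite mulmx_sum_row; apply: eq_bigr => i _.
  by rewrite !mxE scaler_int.
exists (n 0); rewrite mulmx_sum_row; apply: eq_bigr => i _.
by rewrite !mxE scaler_int.
Qed.

Lemma lattice_basis_le (d : nat) (M N : 'M[rat]_d) :
  (int_span (fun i => row i M) `<=` int_span (fun i => row i N))%classic ->
  exists Q : 'M[int]_d, M = map_mx intr Q *m N.
Proof.
move=> sMN.
have rowP i : exists n : 'rV[int]_d, row i M = map_mx intr n *m N.
  apply/int_span_rowE/sMN/int_span_rowE; exists (delta_mx 0 i).
  by rewrite map_delta_mx rowE.
have [n nE] := boolp.choice rowP.
exists (\matrix_i n i); apply/row_matrixP => i.
by rewrite nE row_mul -map_row rowK.
Qed.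

Lemma lattice_det_basis (d : nat) (L : set 'rV[rat]_d) (M : 'M[rat]_d) :
  is_lattice_basis L M -> lattice_det L = `|\det M|.
Proof.
move=> LM; rewrite /lattice_det.
case: xgetP => [_ _ [N [[uN LN] ->]] | /(_ `|\det M|)[]]; last by exists M.
case: LM => uM LM.
have [Q QE] : exists Q : 'M[int]_d, M = map_mx intr Q *m N.
  by apply: lattice_basis_le; rewrite -LM -LN.
have [P PE] : exists P : 'M[int]_d, N = map_mx intr P *m M.
  by apply: lattice_basis_le; rewrite -LM -LN.
have PQ1 : P *m Q = 1%:M.
  have : map_mx intr (P *m Q) = 1%:M :> 'M[rat]_d.
    rewrite map_mxM; have := congr1 (mulmxr (invmx N)) PE => /=.
    by rewrite QE mulmxA mulmxK // mulmxV // => ->.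
  move/matrixP => H; apply/matrixP => i j; have := H i j.
  by rewrite !mxE -(@mulrz_nat rat) natz => /intr_inj.
have dQ : absz (\det Q) = 1%N.
  have := congr1 (fun X => absz (\det X)) PQ1.
  by rewrite det_mulmx det1 abszM => /eqP; rewrite muln_eq1 => /andP[_ /eqP].
by rewrite QE det_mulmx det_map_mx normrM -intr_norm -abszE dQ mul1r.
Qed.

Lemma common_denominator (m d : nat) (M : 'M[rat]_(m, d)) :
  exists (k : int) (A : 'M[int]_(m, d)), k != 0 /\ M = k%:~R^-1 *: map_mx intr A.
Proof.
pose k : int := \prod_i \prod_j denq (M i j).
have k0 : k != 0.
  by apply/prodf_neq0 => i _; apply/prodf_neq0 => j _; apply: denq_neq0.
pose r i j := \prod_(j' | j' != j) denq (M i j')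
               * \prod_(i' | i' != i) \prod_j' denq (M i' j').
exists k, (\matrix_(i, j) (numq (M i j) * r i j)); split=> //.
apply/matrixP => i j; rewrite !mxE.
have -> : k = denq (M i j) * r i j.
  by rewrite /k (bigD1 i) //= (bigD1 j) //= /r mulrA.
have r0 : r i j != 0.
  rewrite mulf_neq0 //; apply/prodf_neq0 => ? _; rewrite ?denq_neq0 //.
  by apply/prodf_neq0 => ? _; apply: denq_neq0.
rewrite (intrM _ (numq _)) (intrM _ (denq _)) invfM mulrACA mulVf ?intr_eq0 //.
by rewrite mulr1 mulrC divq_num_den.
Qed.

Lemma lattice_basis_exists (d m : nat) (M : 'M[rat]_(m, d)) :
  row_full M -> exists N, is_lattice_basis (int_span (fun i => row i M)) N.
Proof.
move=> fM.
have [k [A [k0 ME]]] := common_denominator M.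
have [P uP [Q uQ [s _ AE]]] := int_Smith_normal_form A.
pose D : 'M[int]_(m, d) := \matrix_(i, j) (s`_i *+ (i == j :> nat)).
pose E : 'M[int]_d := \matrix_(i, j) (s`_i *+ (i == j :> nat)).
have kQ0 : (k%:~R : rat) != 0 by rewrite intr_eq0.
have uPq : map_mx intr P \in @unitmx rat m.
  by rewrite unitmxE det_map_mx rmorph_unit // -unitmxE.
have uQq : map_mx intr Q \in @unitmx rat d.
  by rewrite unitmxE det_map_mx rmorph_unit // -unitmxE.
have rM : \rank (map_mx intr D : 'M[rat]_(m, d)) = d.
  suff <- : \rank M = \rank (map_mx intr D : 'M[rat]_(m, d)) by exact/eqP.
  rewrite ME AE -/D !map_mxM mxrank_scale_nz ?invr_eq0 //.
  rewrite mxrankMfree ?row_free_unit //.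
  by rewrite (eqmxMfull _ (_ : row_full _)) ?row_full_unit.
have ledm : (d <= m)%N.
  by have := rank_leq_row (map_mx intr D : 'M[rat]_(m, d)); rewrite rM.
have DE : D = (pid_mx d : 'M[int]_(m, d)) *m E.
  apply/matrixP => i j; rewrite !mxE.
  have [ltid|leid] := ltnP i d; last first.
    rewrite big1 => [|l _]; last first.
      by rewrite !mxE ltnNge leid andbF mul0r.
    by rewrite (gtn_eqF (leq_trans (ltn_ord j) leid)).
  rewrite (bigD1 (Ordinal ltid)) //= !mxE eqxx ltid mul1r big1 ?addr0 // => l.
  by rewrite !mxE -val_eqE eq_sym => /negPf /= ->; rewrite mul0r.
have ED : E = (pid_mx d : 'M[int]_(d, m)) *m D.
  apply/matrixP => i j; rewrite !mxE.
  have ltim := leq_trans (ltn_ord i) ledm.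
  rewrite (bigD1 (Ordinal ltim)) //= !mxE eqxx ltn_ord mul1r big1 ?addr0 // => l.
  by rewrite !mxE -val_eqE eq_sym => /negPf /= ->; rewrite mul0r.
pose N : 'M[rat]_d := k%:~R^-1 *: map_mx intr (E *m Q).
have rE : map_mx intr E \in @unitmx rat d.
  rewrite -row_full_unit -col_leq_rank -{1}rM DE map_mxM.
  exact: mxrankM_maxr.
exists N; split.
  by rewrite unitmxZ ?unitfE ?invr_eq0 // map_mxM unitmx_mul rE.
have MN : M = map_mx intr (P *m pid_mx d) *m N.
  by rewrite ME AE -/D DE -scalemxAr -map_mxM !mulmxA.
have NM : N = map_mx intr (pid_mx d *m invmx P) *m M.
  rewrite ME AE -/D -scalemxAr -map_mxM /N ED; congr (_ *: map_mx _ _).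
  by rewrite !mulmxA mulmxKV.
by apply/seteqP; split=> x /int_span_rowE[n ->]; apply/int_span_rowE;
  [exists (n *m (P *m pid_mx d)); rewrite {1}MN
  |exists (n *m (pid_mx d *m invmx P)); rewrite {1}NM];
  rewrite mulmxA -map_mxM.
Qed.

Lemma int_span_enum (I : finType) (d : nat) (v : I -> 'rV[rat]_d) :
  int_span v = int_span (fun i => row i (\matrix_(j < #|I|) v (enum_val j))).
Proof.
apply/seteqP; split=> x [n ->].
  exists (fun j => n (enum_val j)); rewrite (reindex _ (onW_bij _ (enum_val_bij I))).
  by apply: eq_bigr => i _; rewrite rowK.
exists (fun i => n (enum_rank i)); rewrite [RHS](reindex _ (onW_bij _ (enum_val_bij I))).
by apply: eq_bigr => i _; rewrite rowK enum_valK.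
Qed.

Lemma basis_eval_lattice (B : finType) (d : nat) (X : d.-tuple (ratfun B)) :
  free X -> exists M, is_lattice_basis (int_span (basis_eval X)) M.
Proof.
move=> /freeP fX; rewrite int_span_enum; apply: lattice_basis_exists.
set Phi := \matrix_j _.
rewrite /row_full -mxrank_tr -/(row_free _) -kermx_eq0; apply/rowV0P => u.
move/sub_kermxP => uP.
have /fX u0 : \sum_(i < d) u 0 i *: X`_i = 0.
  apply/ffunP => b; rewrite sum_ffunE ffunE.
  have /matrixP/(_ 0 (enum_rank b)) := uP; rewrite !mxE => uPb.
  by rewrite -[RHS]uPb; apply: eq_bigr => i _; rewrite ffunE !mxE enum_rankK (tnth_nth 0).
by apply/rowP => i; rewrite u0 mxE.
Qed.

Lemma rho_of_basis (R : realType) (B : finType) (V : {vspace ratfun B})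
    (X : (\dim V).-tuple (ratfun B)) :
  basis_of V X -> rho_of R X = rho R V.
Proof.
move=> /[dup] bX /basis_free fX; pose Y := vbasis V.
have fY : free Y by apply/basis_free/vbasisP.
pose P : 'M[rat]_(\dim V) := \matrix_(i, j) coord Y j X`_i.
have evalE b : basis_eval X b = basis_eval Y b *m P^T.
  apply/rowP => i; rewrite !mxE (tnth_nth 0).
  have /coord_vbasis {1}-> : X`_i \in V.
    by rewrite (basis_mem bX) // mem_nth // size_tuple.
  rewrite sum_ffunE; apply: eq_bigr => j _.
  by rewrite !mxE ffunE (tnth_nth 0) mulrC.
have gramE : gram X = P *m gram Y *m P^T.
  have gE (Z : (\dim V).-tuple (ratfun B)) :
      gram Z = \sum_b (basis_eval Z b)^T *m basis_eval Z b.
    apply/matrixP => i j; rewrite summxE !mxE; apply: eq_bigr => b _.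
    by rewrite !mxE big_ord1 !mxE.
  rewrite !gE mulmx_sumr mulmx_suml; apply: eq_bigr => b _.
  by rewrite !evalE trmx_mul trmxK !mulmxA.
have [M LM] := basis_eval_lattice fY.
have [M' LM'] := basis_eval_lattice fX.
have spanE : int_span (basis_eval X) = int_span (fun i => row i (M *m P^T)).
  case: LM => _ LM; apply/seteqP; split=> x.
    case=> n ->.
    have /int_span_rowE[n' n'E] : int_span (fun i => row i M)
        (\sum_b basis_eval Y b *~ n b) by rewrite -LM; exists n.
    apply/int_span_rowE; exists n'; rewrite mulmxA -n'E mulmx_suml.
    by apply: eq_bigr => b _; rewrite evalE -!scaler_int scalemxAl.
  case/int_span_rowE => n' ->.
  have : int_span (basis_eval Y) (map_mx intr n' *m M).
    by rewrite LM; apply/int_span_rowE; exists n'.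
  case=> n nE; exists n; rewrite mulmxA nE mulmx_suml.
  by apply: eq_bigr => b _; rewrite evalE -!scaler_int scalemxAl.
have uP : P \in unitmx.
  have [Q QE] : exists Q : 'M[int]_(\dim V), M' = map_mx intr Q *m (M *m P^T).
    by apply: lattice_basis_le; case: LM' => _ <-; rewrite spanE.
  case: LM' => + _; rewrite QE !unitmx_mul unitmx_tr.
  by case/andP=> _ /andP[].
have uMP : is_lattice_basis (int_span (basis_eval X)) (M *m P^T).
  by split=> //; rewrite unitmx_mul unitmx_tr uP; case: LM => ->.
rewrite /rho /rho_of (lattice_det_basis LM) (lattice_det_basis uMP) gramE.
rewrite !det_mulmx det_tr normrM (mulrAC (\det P)) !rmorphM -expr2 /= !ratr_norm.
rewrite sqrtrM ?sqr_ge0 // sqrtr_sqr invfM -mulrA mulVKf //.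
by rewrite normr_eq0 fmorph_eq0 -unitfE -unitmxE.
Qed.

(* Main.v *)
Require Import Defs.
From HB Require Import structures.
From mathcomp Require Import all_boot all_order all_algebra all_fingroup.
From mathcomp Require Import all_classical all_reals all_analysis.
From mathcomp Require Import ring lra zify.
From mathcomp Require Import complex.

(** The designs are counted by the local limit theorem for a random subset.
Put each point of [B] into [T] independently with probability [p = N / #|B|],
choose a basis [psi] of [V] made of integer functions whose value vectors
[psi(b)] generate the whole of [Z^d], and let [X] be the sum of [psi(b)] over
[T].  As the constants lie in [V], the event [X = E X] says exactly that [T] is
a design of size [N]; every such set has the same probability, so the count is
[P (X = E X) / (p ^ N (1 - p) ^ (#|B| - N))], and [E X] is an integer vector by
divisibility.  With this basis [rho V] is the inverse square root of the
determinant of the Gram matrix of [psi], and the main term of the theorem is the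
Gaussian density at the mean.

[P (X = E X)] is the average over the torus of the characteristic function
[char_fun], a product over [b] of the one-point factors [bernoulli_cf] at the
phase [2 pi <t, psi(b)>].  Instead of integrating over the torus, the average is
taken over its [q]-torsion points for a large [q]: this is still exact
([fourier_count]), only finite sums occur, and what replaces the Gaussian
integral is the Riemann sum of a Gaussian over the grid [(1/q) Z^d].  Completing
squares one coordinate at a time reduces the latter to dimension one
([gauss_sum_approx]).

Let [w = p (1 - p)] and [M = w #|B|], which is within a factor two of
[min (N, #|B| - N)], and let [Q t] be the variance of the phase.

Near a lattice point, where [Q t] is at most a cutoff [T] of order
[d log (c2 M)], the factors are compared with Gaussian ones.  By transitivity all
leverage scores of [psi] equal [d / #|B|], so every phase is at most
[sqrt (d Q / M)] ([comb_sup]); the relative error is thus of order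
[Q ^ (3/2) sqrt (d / M)], and trading [Q ^ (3/2)] for a slightly wider Gaussian
bounds the total error by [O (d ^ 2 / sqrt M)] ([char_fun_near_expR]).

Away from the lattice, [char_fun t] is at most the exponential of
[- c w sum_b (dist (f b, Z)) ^ 2], where [f b = <t, psi(b)>].  If all distances
are below [1 / c3], the relations of length [c3] that define [V] hold for the
residues of [f] exactly, not only modulo one; so [f] minus its residues is an
integer function in [V], and [t] is close to the lattice
([comb_near_lattice]).  If some distance is at least [1 / c3], then the average
distance is not small either ([small_average_small_everywhere]): translate [f] by
[k] symmetries in general position, with [2 ^ k] larger than the number of cells
needed to cover the torus of [V] modulo integer functions; by pigeonhole, two of
the [2 ^ k] sums of translates agree up to [1 / (2 c3)] modulo one, whereas at
the point where one of the translates is large all the others are small.  The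
cells are counted with the [c2]-bounded basis, so [k] is of order
[d log (c2 c3 d)].

[local_limit] adds up these estimates.  Hadamard's inequality for the
[c2]-bounded basis gives the lower bound for the main term that makes the far
part negligible, and the hypothesis on [min (N, #|B| - N)] makes all the
requirements on [M] hold ([parameters_ok], [log_split]). *)

Set Implicit Arguments.
Unset Strict Implicit.
Unset Printing Implicit Defensive.

Import Order.TTheory GRing.Theory Num.Theory.
Import numFieldNormedType.Exports.
Import Normc.
Local Open Scope ring_scope.

(** * The Gaussian integral and its Riemann sums *)

(** The primitive is only used through its increments, so its value at
infinity is recorded as a bound on all increments together with long increments
attaining it up to [eta]. *)
Lemma gauss_primitive (R : realType) :
  exists Phi : R -> R,
    [/\ forall x : R, is_derive x (1 : R) Phi (gauss_fun x),
        forall x y, Phi y - Phi x <= Num.sqrt pi &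
        forall eta, 0 < eta -> exists2 K, 0 < K &
          forall x y, x <= - K -> K <= y -> Num.sqrt pi - eta <= Phi y - Phi x].
Proof.
pose mu := @lebesgue_measure R.
pose Phi x : R := (\int[mu]_(t in [set` `]-oo, x]]) (gauss_fun t))%R.
have dPhi (x : R) : is_derive x (1 : R) Phi (gauss_fun x).
  have [||||dx ex] := @continuous_FTC1 R (@gauss_fun R) -oo%O x (x + 1).
  - by rewrite ltrDl.
  - apply: integrableS (@integrableT_gauss R) => //.
  - by rewrite ltNyr.
  - exact: continuous_gauss_fun.
  rewrite derive1E in ex; exact: (@DeriveDef _ _ _ x 1 Phi _ dx ex).
have cPhi x : {for x, continuous Phi}.
  by apply: differentiable_continuous; apply/derivable1_diffP; have [] := dPhi x.
(* The integrand is even, so [E] is constant, and an increment over a symmetric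
   interval is twice the increment over its positive half. *)
pose E x := Phi x + Phi (- x).
have dE (x : R) : is_derive x (1 : R) E 0.
  have dN : is_derive x (1 : R) (fun y : R => - y) (-1) by apply: is_deriveN.
  have d2 := is_derive1_comp (dPhi (- x)) dN.
  have := is_deriveD (dPhi x) d2.
  rewrite /gauss_fun sqrrN => d3; apply: is_derive_eq d3 _.
  by rewrite mulrN1 subrr.
have EE x : Phi x + Phi (- x) = 2 * Phi 0.
  have := is_derive_0_is_cst x 0 dE; rewrite /E oppr0 => ->; ring.
pose I0 := @gauss_integral_proof.integral0_gauss R.
have PhiI x : 0 < x -> Phi x - Phi 0 = I0 x.
  move=> x0.
  have i y : mu.-integrable `]-oo, y] (EFin \o @gauss_fun R).
    by apply: integrableS (@integrableT_gauss R).
  have := @Rintegral_itvB R (@gauss_fun R) -oo%O (BRight x) 0 (i x) isT.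
  rewrite bnd_simp ltW // => /(_ isT); rewrite -/mu -/(Phi x) -/(Phi 0) => ->.
  rewrite Rintegral_itv_obnd_cbnd //.
  by apply: integrableS (@integrableT_gauss R).
have mono x y : x <= y -> Phi x <= Phi y.
  move=> xy; have [|c _ e] := @MVT_segment R Phi (@gauss_fun R) x y xy.
  - by apply: continuous_subspaceT => z; apply: cPhi.
  by rewrite -subr_ge0 e mulr_ge0 ?gauss_fun_ge0 // subr_ge0.
have D x : 0 < x -> Phi x - Phi (- x) = 2 * I0 x.
  move=> x0; rewrite -PhiI // mulrBr -(EE x); ring.
have c2 : (2 * I0 x @[x --> +oo] --> Num.sqrt pi)%classic.
  have : (Num.sqrt (4 * I0 x ^+ 2) @[x --> +oo] --> Num.sqrt (4 * (pi / 4)))%classic.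
    apply: continuous_cvg; first exact: sqrt_continuous.
    apply: cvgM; first exact: cvg_cst.
    exact: gauss_integral_proof.cvg_integral0_gauss_sqr.
  rewrite (_ : 4 * (pi / 4) = pi); last by field.
  apply: cvg_trans; apply: near_eq_cvg; near=> x.
  rewrite (_ : 4 * I0 x ^+ 2 = (2 * I0 x) ^+ 2); last by ring.
  rewrite sqrtr_sqr ger0_norm // mulr_ge0 //.
  exact: gauss_integral_proof.integral0_gauss_ge0.
have lim eta : 0 < eta -> exists2 K, 0 < K & `|Num.sqrt pi - 2 * I0 K| < eta /\
     forall x, K <= x -> `|Num.sqrt pi - 2 * I0 x| < eta.
  move=> eta0.
  have /cvgrPdist_lt/(_ _ eta0)[K [_ HK]] := c2.
  exists (Num.max K 0 + 1); first by rewrite ltr_wpDl // le_max lexx orbT.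
  have KK : K < Num.max K 0 + 1 by rewrite ltr_pwDr // le_max lexx.
  split; first exact: HK.
  by move=> x Kx; apply: HK; apply: lt_le_trans Kx.
exists Phi; split => //.
- move=> x y; apply/ler_addgt0Pr => e e0.
  have [K K0 [_ HK]] := lim _ e0.
  pose L := Num.max K (Num.max `|x| `|y|).
  have L0 : 0 < L by rewrite /L lt_max K0.
  have := HK L; rewrite /L le_max lexx => /(_ isT); rewrite -/L -D //.
  rewrite ltr_norml => /andP[h _].
  have xL : - L <= x.
    by rewrite lerNl (le_trans (ler_norm _)) // normrN /L !le_max lexx !orbT.
  have yL : y <= L.
    by rewrite (le_trans (ler_norm _)) // /L !le_max lexx !orbT.
  have := mono _ _ xL; have := mono _ _ yL; lra.
- move=> eta eta0; have [K K0 [HK _]] := lim _ eta0; exists K => // x y xK Ky.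
  have := mono _ _ xK; have := mono _ _ Ky.
  by move: HK; rewrite -D // ltr_norml => /andP[_]; lra.
Unshelve. all: by end_near. Qed.

Section GaussRiemann.
Variable R : realType.
Implicit Types x y h s : R.

Lemma gauss_fun_le x y : `|x| <= `|y| -> gauss_fun y <= gauss_fun x.
Proof.
move=> xy; rewrite /gauss_fun ler_expR lerN2 -[x ^+ 2]real_normK ?num_real //.
by rewrite -[y ^+ 2]real_normK ?num_real // ler_pXn2r ?nnegrE.
Qed.

(** Total variation of [gauss_fun] on [(-oo, x]]; it turns the errors of a
Riemann sum into a telescoping sum. *)
Definition gauss_variation x : R :=
  if x <= 0 then gauss_fun x else 2 - gauss_fun x.

Lemma gauss_variation_bound x : 0 <= gauss_variation x <= 2.
Proof.
have := gauss_fun_ge0 x; have := gauss_fun_le1 x; rewrite /gauss_variation.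
by case: ifP => _; lra.
Qed.

Lemma gauss_fun_dist x y : x <= y ->
  `|gauss_fun x - gauss_fun y| <= gauss_variation y - gauss_variation x.
Proof.
move=> xy; have := gauss_fun_ge0 x; have := gauss_fun_le1 x.
have := gauss_fun_ge0 y; have := gauss_fun_le1 y.
rewrite /gauss_variation; case: (leP x 0) => x0; case: (leP y 0) => y0 *.
- have : gauss_fun x <= gauss_fun y.
    by apply: gauss_fun_le; rewrite !ler0_norm // lerN2.
  by rewrite ler_norml; lra.
- by rewrite ler_norml; lra.
- by have := lt_le_trans x0 (le_trans xy y0); rewrite ltxx.
have : gauss_fun y <= gauss_fun x by apply: gauss_fun_le; rewrite !gtr0_norm.
by rewrite ler_norml; lra.
Qed.

Lemma gauss_variation_le x y : x <= y -> gauss_variation x <= gauss_variation y.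
Proof. by move=> /gauss_fun_dist /(le_trans (normr_ge0 _)); rewrite subr_ge0. Qed.

Variable Phi : R -> R.
Hypothesis dPhi : forall x, is_derive x (1 : R) Phi (gauss_fun x).

(** On one cell the integral is [h] times an intermediate value, which differs
from the left value by at most the variation over the cell. *)
Lemma gauss_step x h : 0 < h ->
  `|h * gauss_fun x - (Phi (x + h) - Phi x)|
     <= h * (gauss_variation (x + h) - gauss_variation x).
Proof.
move=> h0.
have xh : x <= x + h by rewrite lerDl ltW.
have [|c] := @MVT_segment R Phi (@gauss_fun R) x (x + h) xh (fun z _ => dPhi z).
  apply: continuous_subspaceT => z; apply: differentiable_continuous.
  by apply/derivable1_diffP; have [] := dPhi z.
rewrite in_itv /= => /andP[xc ch] ->.
rewrite addrAC subrr add0r [_ * h]mulrC -mulrBr normrM gtr0_norm // ler_pM2l //.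
by apply: le_trans (gauss_fun_dist xc) _; rewrite lerD2r gauss_variation_le.
Qed.

(** The error is [2 * h] whatever the number of cells, because the total
variation of the bell curve is two.  This uniformity in the shift [s] is what
allows summing out one coordinate after the other. *)
Lemma gauss_range h s (n : nat) : 0 < h ->
  `|h * (\sum_(i < n) gauss_fun (i%:R * h + s)) - (Phi (n%:R * h + s) - Phi s)|
     <= 2 * h.
Proof.
move=> h0.
suff H : `|h * (\sum_(i < n) gauss_fun (i%:R * h + s)) - (Phi (n%:R * h + s) - Phi s)|
     <= h * (gauss_variation (n%:R * h + s) - gauss_variation s).
  apply: le_trans H _; rewrite mulrC ler_pM2r //.
  have := gauss_variation_bound (n%:R * h + s); have := gauss_variation_bound s; lra.
elim: n => [|n IH].
  by rewrite big_ord0 !mul0r !add0r !subrr !mulr0 subrr normr0.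
rewrite big_ord_recr /=.
have := gauss_step (n%:R * h + s) h0.
rewrite (_ : n%:R * h + s + h = n.+1%:R * h + s); last by rewrite -natr1; ring.
move: IH; rewrite !ler_norml mulrDr; lra.
Qed.

End GaussRiemann.

Lemma ler_sum_sub (R : numDomainType) (T : eqType) (s s' : seq T) (F : T -> R) :
  uniq s -> uniq s' -> {subset s <= s'} -> (forall x, 0 <= F x) ->
  \sum_(x <- s) F x <= \sum_(x <- s') F x.
Proof.
move=> us us' ss' F0.
have e : perm_eq s [seq i <- s' | i \in s].
  apply: uniq_perm => // [|x]; first exact: filter_uniq.
  by rewrite mem_filter; case xs: (x \in s) => //=; rewrite ss'.
rewrite [leRHS](bigID (mem s)) /= -[leLHS]addr0 (perm_big _ e) big_filter.
by rewrite lerD ?sumr_ge0.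
Qed.

Definition int_range (K : nat) : seq int := [seq (i%:Z - K%:Z) | i <- iota 0 (2 * K)].

Lemma int_range_uniq K : uniq (int_range K).
Proof. by rewrite map_inj_uniq ?iota_uniq // => i j /addIr []. Qed.

Lemma big_int_range (R : realType) K (F : int -> R) :
  \sum_(j <- int_range K) F j = \sum_(i < (2 * K)%N) F (i%:Z - K%:Z).
Proof. by rewrite big_map -[X in iota 0 X]subn0 -/(index_iota 0 _) big_mkord. Qed.

Lemma mem_int_range (j : int) K : (absz j < K)%N -> j \in int_range K.
Proof.
move=> jK; apply/mapP; exists (absz (j + K%:Z)%R); last by lia.
by rewrite mem_iota /=; lia.
Qed.

Lemma int_range_cover (J : seq int) : exists K, {subset J <= int_range K}.
Proof.
exists (\max_(j <- J) absz j).+1 => j jJ; apply: mem_int_range.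
by rewrite ltnS; apply: (@leq_bigmax_seq _ J xpredT (fun j : int => absz j)).
Qed.

Lemma gauss_sum1_ub (R : realType) (h s : R) (J : seq int) : 0 < h -> uniq J ->
  h * (\sum_(j <- J) gauss_fun (j%:~R * h + s)) <= Num.sqrt pi + 2 * h.
Proof.
move=> h0 uJ; have [Phi [dPhi ubPhi _]] := gauss_primitive R.
have [K JK] := int_range_cover J.
apply: (@le_trans _ _ (h * \sum_(j <- int_range K) gauss_fun (j%:~R * h + s))).
  rewrite ler_pM2l // ler_sum_sub // ?int_range_uniq // => j.
  exact: gauss_fun_ge0.
rewrite big_int_range.
under eq_bigr => i _.
  rewrite (_ : (i%:Z - K%:Z)%:~R * h + s = i%:R * h + (s - K%:R * h)); last first.
    by rewrite intrD rmorphN /= !pmulrn; ring.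
  over.
have := gauss_range dPhi (s - K%:R * h) (2 * K) h0.
have := ubPhi (s - K%:R * h) ((2 * K)%:R * h + (s - K%:R * h)).
by rewrite ler_norml; lra.
Qed.

(** One finite window serves all shifts up to [S]: in the inductive step the
shift depends on the remaining coordinates, which range over a finite set. *)
Lemma gauss_sum1_lb (R : realType) (h S eta : R) : 0 < h -> 0 < eta ->
  exists2 J : seq int, uniq J & forall s, `|s| <= S ->
  Num.sqrt pi - 2 * h - eta <= h * (\sum_(j <- J) gauss_fun (j%:~R * h + s)).
Proof.
move=> h0 eta0; have [Phi [dPhi _ /(_ _ eta0)[K0 K00 lbPhi]]] := gauss_primitive R.
have [K HK] : exists K : nat, (K0 + `|S|) / h <= K%:R.
  by exists (Num.truncn ((K0 + `|S|) / h)).+1; apply/ltW/truncnS_gt.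
exists (int_range K); first exact: int_range_uniq.
move=> s sS; rewrite big_int_range.
under eq_bigr => i _.
  rewrite (_ : (i%:Z - K%:Z)%:~R * h + s = i%:R * h + (s - K%:R * h)); last first.
    by rewrite intrD rmorphN /= !pmulrn; ring.
  over.
have := gauss_range dPhi (s - K%:R * h) (2 * K) h0.
move: HK; rewrite ler_pdivrMr // => HK.
have le1 : s - K%:R * h <= - K0.
  by move: sS; rewrite ler_norml; have := ler_norm S; lra.
have le2 : K0 <= (2 * K)%:R * h + (s - K%:R * h).
  by move: sS; rewrite ler_norml natrM; have := ler_norm S; lra.
have := lbPhi _ _ le1 le2.
by rewrite ler_norml; lra.
Qed.

(** * Gaussian sums over grids *)

Lemma gauss_scaled_ub (R : realType) (a h s : R) (J : seq int) :
  0 < a -> 0 < h -> uniq J ->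
  h * (\sum_(j <- J) expR (- (a * (j%:~R * h + s) ^+ 2) / 2))
    <= Num.sqrt (2 * pi / a) + 2 * h.
Proof.
move=> a0 h0 uJ; pose g := Num.sqrt (a / 2).
have a20 : 0 < a / 2 by rewrite divr_gt0.
have g0 : 0 < g by rewrite sqrtr_gt0.
have g2 : g ^+ 2 = a / 2 by rewrite sqr_sqrtr // ltW.
have := @gauss_sum1_ub R (g * h) (g * s) J (mulr_gt0 g0 h0) uJ.
have E j : gauss_fun (j%:~R * (g * h) + g * s) =
     expR (- (a * (j%:~R * h + s) ^+ 2) / 2).
  rewrite /gauss_fun; congr expR.
  rewrite (_ : j%:~R * (g * h) + g * s = g * (j%:~R * h + s)); last by ring.
  by rewrite exprMn g2; field.
under eq_bigr do rewrite E.
move=> H.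
have -> : Num.sqrt (2 * pi / a) = Num.sqrt pi / g.
  rewrite /g -sqrtrV ?ltW // -sqrtrM ?pi_ge0 //; congr Num.sqrt.
  by field; rewrite gt_eqF.
rewrite -(ler_pM2l g0) mulrDr [g * (_ / _)]mulrC divfK ?gt_eqF //.
by move: H; lra.
Qed.

Lemma gauss_scaled_lb (R : realType) (a h S eta : R) :
  0 < a -> 0 < h -> 0 < eta ->
  exists2 J : seq int, uniq J & forall s, `|s| <= S ->
  Num.sqrt (2 * pi / a) - 2 * h - eta <=
  h * (\sum_(j <- J) expR (- (a * (j%:~R * h + s) ^+ 2) / 2)).
Proof.
move=> a0 h0 e0; pose g := Num.sqrt (a / 2).
have a20 : 0 < a / 2 by rewrite divr_gt0.
have g0 : 0 < g by rewrite sqrtr_gt0.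
have g2 : g ^+ 2 = a / 2 by rewrite sqr_sqrtr // ltW.
have [J uJ HJ] := @gauss_sum1_lb R (g * h) (g * S) (g * eta) (mulr_gt0 g0 h0) (mulr_gt0 g0 e0).
exists J => // s sS.
have gS : `|g * s| <= g * S by rewrite normrM gtr0_norm // ler_pM2l.
have := HJ _ gS.
have E j : gauss_fun (j%:~R * (g * h) + g * s) =
     expR (- (a * (j%:~R * h + s) ^+ 2) / 2).
  rewrite /gauss_fun; congr expR.
  rewrite (_ : j%:~R * (g * h) + g * s = g * (j%:~R * h + s)); last by ring.
  by rewrite exprMn g2; field.
under eq_bigr do rewrite E.
move=> H.
have -> : Num.sqrt (2 * pi / a) = Num.sqrt pi / g.
  rewrite /g -sqrtrV ?ltW // -sqrtrM ?pi_ge0 //; congr Num.sqrt.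
  by field; rewrite gt_eqF.
rewrite -(ler_pM2l g0) !mulrBr [g * (_ / _)]mulrC divfK ?gt_eqF //.
by move: H; lra.
Qed.

Definition qform (R : realType) d (Q : 'M[R]_d) (x : 'rV[R]_d) : R :=
  (x *m Q *m x^T) 0 0.

Definition posdef (R : realType) d (Q : 'M[R]_d) : Prop :=
  Q^T = Q /\ forall x, x != 0 -> 0 < qform Q x.

Definition grid (R : realType) d (h : R) (j : 'rV[int]_d) : 'rV[R]_d :=
  \row_i ((j 0 i)%:~R * h).

Section Schur.
Variables (R : realType) (d : nat) (Q : 'M[R]_(1 + d)).
Hypothesis Qpos : posdef Q.

Definition pivot : R := ulsubmx Q 0 0.
Definition shift (y : 'rV[R]_d) : R := pivot^-1 * (y *m (ursubmx Q)^T) 0 0.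
Definition schur_complement : 'M[R]_d := drsubmx Q - pivot^-1 *: ((ursubmx Q)^T *m ursubmx Q).

Lemma pivot_gt0 : 0 < pivot.
Proof.
have [_ /(_ (row_mx 1 0))] := Qpos.
have -> : qform Q (row_mx 1 0) = pivot.
  rewrite /qform -{1}[Q]submxK mul_row_block !mul0mx !mul1mx !addr0.
  by rewrite tr_row_mx mul_row_col trmx0 mulmx0 addr0 trmx1 mulmx1.
apply; apply/eqP => /(congr1 lsubmx); rewrite row_mxKl => /matrixP/(_ 0 0).
by rewrite !mxE eqxx => /eqP; rewrite oner_eq0.
Qed.

Lemma schurE : Q = block_mx pivot%:M (ursubmx Q) (ursubmx Q)^T (drsubmx Q).
Proof.
have [Qs _] := Qpos.
rewrite -{1}[Q]submxK; congr block_mx; first by rewrite [LHS]mx11_scalar.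
by rewrite -{1}Qs trmx_ursub.
Qed.

(** Completing the square in the first coordinate. *)
Lemma qform_schur (x : R) (y : 'rV[R]_d) :
  qform Q (row_mx x%:M y) = pivot * (x + shift y) ^+ 2 + qform schur_complement y.
Proof.
rewrite /qform {1}schurE mul_row_block tr_row_mx mul_row_col tr_scalar_mx.
rewrite mul_mx_scalar !mul_scalar_mx [(_ *: ursubmx Q + _) *m _]mulmxDl -scalemxAl.
rewrite /schur_complement mulmxBr mulmxBl -scalemxAr -scalemxAl.
set u := y *m (ursubmx Q)^T.
have -> : y *m ((ursubmx Q)^T *m ursubmx Q) *m y^T = u *m u^T.
  by rewrite /u trmx_mul trmxK !mulmxA.
have e1 : (ursubmx Q *m y^T) 0 0 = u 0 0.
  by rewrite -[ursubmx Q *m y^T]trmxK [in LHS]mxE trmx_mul trmxK.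
have e2 : (u *m u^T) 0 0 = u 0 0 ^+ 2 by rewrite mxE big_ord1 !mxE expr2.
set w := ursubmx Q *m y^T in e1 *; set v := y *m drsubmx Q *m y^T.
set t := u *m u^T in e2 *.
have p0 := pivot_gt0; have pn : pivot != 0 by rewrite gt_eqF.
rewrite /shift -/u; clearbody t w v u; clear p0; move: pivot pn => c pn.
by rewrite !mxE eqxx mulr1n e1 e2; field.
Qed.

Lemma det_schur : \det Q = pivot * \det schur_complement.
Proof.
have p0 := pivot_gt0; have pn : pivot != 0 by rewrite gt_eqF.
pose M : 'M[R]_(1 + d) := block_mx 1%:M (- pivot^-1 *: ursubmx Q) 0 1%:M.
have dM : \det M = 1 by rewrite det_ublock !det1 mulr1.
rewrite -[LHS]mulr1 -dM -det_mulmx {1}schurE mulmx_block.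
rewrite !mulmx0 !mulmx1 !addr0 mul_scalar_mx scalerA mulrN divff // scaleN1r.
rewrite addNr det_lblock det_scalar1 -scalemxAr scaleNr addrC.
by [].
Qed.

Lemma posdef_schur : posdef schur_complement.
Proof.
have [Qs Qp] := Qpos; split.
  rewrite /schur_complement linearB /= linearZ /= trmx_mul trmxK; congr (_ - _).
  by rewrite -{2}Qs trmx_drsub.
move=> y y0.
have := Qp (row_mx (- shift y)%:M y); rewrite qform_schur addNr expr0n mulr0 add0r.
apply; apply: contra_neq y0 => /(congr1 rsubmx).
by rewrite row_mxKr => ->; apply/matrixP => i j; rewrite !mxE.
Qed.

End Schur.

Lemma grid_row (R : realType) d (h : R) (x : int) (y : 'rV[int]_d) :
  grid h (row_mx (x%:M : 'M[int]_1) y) = row_mx (x%:~R * h)%:M (grid h y).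
Proof.
apply/rowP => i; rewrite !mxE; case: splitP => j _; rewrite !mxE //.
by rewrite (ord1 j) !mulr1n.
Qed.

Lemma posdef_det_gt0 (R : realType) d (Q : 'M[R]_d) : posdef Q -> 0 < \det Q.
Proof.
elim: d Q => [|d IH] Q Qp; first by rewrite det_mx00.
by rewrite (det_schur Qp) mulr_gt0 ?(pivot_gt0 Qp) ?IH //; apply: posdef_schur.
Qed.

(** The integral of [expR (- qform Q x / 2)] over the space. *)
Definition gauss_mass (R : realType) d (Q : 'M[R]_d) : R :=
  Num.sqrt ((2 * pi) ^+ d / \det Q).

Lemma gauss_mass_schur (R : realType) d (Q : 'M[R]_(1 + d)) : posdef Q ->
  gauss_mass Q = Num.sqrt (2 * pi / pivot Q) * gauss_mass (schur_complement Q).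
Proof.
move=> Qp; have p0 := pivot_gt0 Qp; have s0 := posdef_det_gt0 (posdef_schur Qp).
rewrite /gauss_mass -sqrtrM; last by rewrite divr_ge0 ?mulr_ge0 ?pi_ge0 ?ltW.
rewrite (det_schur Qp) exprS; congr Num.sqrt.
by field; rewrite !gt_eqF.
Qed.

(** Riemann sum of the same integral.  Only finitely many grid points are used,
so that no summability is involved. *)
Definition gauss_sum (R : realType) d (Q : 'M[R]_d) (h : R)
    (F : seq 'rV[int]_d) : R :=
  h ^+ d * \sum_(j <- F) expR (- qform Q (grid h j) / 2).

Definition prod_seq d (J : seq int) (Y : seq 'rV[int]_d) : seq 'rV[int]_(1 + d) :=
  [seq row_mx (x%:M : 'M[int]_1) y | y <- Y, x <- J].

Lemma prod_seq_uniq d (J : seq int) (Y : seq 'rV[int]_d) :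
  uniq J -> uniq Y -> uniq (prod_seq J Y).
Proof.
move=> uJ uY; apply: allpairs_uniq => // -[y x] [y' x'] _ _ /=.
move=> /eq_row_mx[/matrixP/(_ 0 0)]; rewrite !mxE !mulr1n => -> ->.
by [].
Qed.

Lemma gauss_sum_prod (R : realType) d (Q : 'M[R]_(1 + d)) h J Y : posdef Q ->
  gauss_sum Q h (prod_seq J Y) =
  h ^+ d * \sum_(y <- Y) (expR (- qform (schur_complement Q) (grid h y) / 2) *
     (h * \sum_(x <- J)
       expR (- (pivot Q * (x%:~R * h + shift Q (grid h y)) ^+ 2) / 2))).
Proof.
move=> Qp; rewrite /gauss_sum /prod_seq big_allpairs_dep /= exprSr -mulrA; congr (_ * _).
rewrite mulr_sumr; apply: eq_bigr => y _; rewrite mulrCA; congr (_ * _).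
rewrite mulr_sumr; apply: eq_bigr => x _.
by rewrite grid_row qform_schur // -expRD; congr expR; lra.
Qed.

Lemma gauss_sum_sub (R : realType) d (Q : 'M[R]_d) h F F' : 0 < h ->
  uniq F -> uniq F' -> {subset F <= F'} -> gauss_sum Q h F <= gauss_sum Q h F'.
Proof.
move=> h0 uF uF' FF; rewrite /gauss_sum ler_pM2l ?exprn_gt0 //.
by apply: ler_sum_sub => // *; apply: expR_ge0.
Qed.

Lemma prod_seq_cover d (F : seq 'rV[int]_(1 + d)) :
  {subset F <= prod_seq (undup [seq lsubmx f 0 0 | f : 'rV_(1 + d) <- F])
                        (undup [seq rsubmx f | f : 'rV_(1 + d) <- F])}.
Proof.
move=> f fF; apply/allpairsP; exists (rsubmx f, lsubmx f 0 0) => /=; split.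
- by rewrite mem_undup; apply: map_f.
- by rewrite mem_undup; apply/mapP; exists f.
by rewrite -mx11_scalar hsubmxK.
Qed.

(** Completing the square splits off a one-dimensional Gaussian sum whose
value hardly depends on the shift, and leaves the Gaussian sum of the Schur
complement.  The lower bound is stated as the existence of one good finite set,
which avoids infinite sums. *)
Theorem gauss_sum_approx (R : realType) d (Q : 'M[R]_d) : posdef Q ->
  forall eta : R, 0 < eta -> exists2 h0, 0 < h0 & forall h, 0 < h -> h <= h0 ->
    (forall F, uniq F -> gauss_sum Q h F <= gauss_mass Q + eta) /\
    (exists2 F, uniq F & gauss_mass Q - eta <= gauss_sum Q h F).
Proof.
elim: d Q => [|d IH] Q Qp eta eta0.
  have G1 : gauss_mass Q = 1 by rewrite /gauss_mass expr0 det_mx00 divr1 sqrtr1.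
  have q0 x : qform Q x = 0 by rewrite /qform mxE big_ord0.
  have gs F : gauss_sum Q 1 F = (size F)%:R.
    rewrite /gauss_sum expr0 mul1r.
    under eq_bigr do rewrite q0 oppr0 mul0r expR0.
    by rewrite big_const_seq count_predT iter_addr_0.
  have gsh h F : gauss_sum Q h F = (size F)%:R.
    rewrite -gs /gauss_sum !expr0; congr (_ * _); apply: eq_bigr => j _.
    by rewrite !q0.
  exists 1 => // h h0 _; split=> [F uF|].
    rewrite gsh G1; apply: le_trans (_ : 1 <= _); last by rewrite lerDl ltW.
    rewrite (ler_nat _ _ 1); case: F uF => // f [|f' F] //=.
    by rewrite inE (_ : f = f') ?eqxx //; apply/rowP => -[].
  by exists [:: 0] => //; rewrite gsh G1 lerBlDr lerDl ltW.
set c := Num.sqrt (2 * pi / pivot Q); set G := gauss_mass (schur_complement Q).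
have c0 : 0 < c by rewrite sqrtr_gt0 divr_gt0 ?(pivot_gt0 Qp) // mulr_gt0 ?pi_gt0.
have G0 : 0 <= G by rewrite sqrtr_ge0.
(* [e] keeps the product of the two approximations within [eta] and the factor
   [c - 2 * h - e] positive. *)
pose D := 4 * (c + G + 2).
have D0 : 0 < D by rewrite /D; lra.
pose e := Num.min (eta / D) (Num.min 1 (c / 4)).
have c40 : 0 < c / 4 by rewrite divr_gt0.
have e0 : 0 < e by rewrite /e !lt_min c40 ltr01 divr_gt0.
have [e1 e2 e3] : [/\ e * D <= eta, e <= 1 & 4 * e <= c].
  split; rewrite /e.
  - by rewrite -ler_pdivlMr // ge_min lexx.
  - by rewrite !ge_min lexx orbT.
  by rewrite -(ler_pM2r (_ : 0 < 4^-1)) // [4 * _]mulrC mulfK // !ge_min lexx !orbT.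
have [h1 h10 Hh] := IH _ (posdef_schur Qp) _ e0.
exists (Num.min h1 e); first by rewrite lt_min h10 e0.
move=> h h0; rewrite le_min => /andP[hh1 he].
have [ub [Y uY lb]] := Hh h h0 hh1.
rewrite gauss_mass_schur // -/c -/G; split=> [F uF|].
  set J := undup [seq lsubmx f 0 0 | f : 'rV_(1 + d) <- F].
  set Y' := undup [seq rsubmx f | f : 'rV_(1 + d) <- F].
  apply: (@le_trans _ _ (gauss_sum Q h (prod_seq J Y'))).
    by apply: gauss_sum_sub => //; [apply: prod_seq_uniq; apply: undup_uniq|apply: prod_seq_cover].
  rewrite gauss_sum_prod //.
  apply: (@le_trans _ _ (gauss_sum (schur_complement Q) h Y' * (c + 2 * h))).
    rewrite /gauss_sum -mulrA ler_pM2l ?exprn_gt0 // mulr_suml; apply: ler_sum => y _.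
    rewrite ler_pM2l ?expR_gt0 //; apply: gauss_scaled_ub => //; first exact: pivot_gt0.
    exact: undup_uniq.
  have u := ub _ (undup_uniq _ : uniq Y').
  apply: (@le_trans _ _ ((G + e) * (c + 2 * h))); first by rewrite ler_pM2r //; lra.
  move: e1; rewrite /D; nra.
pose S := \sum_(y <- Y) `|shift Q (grid h y)|.
have [J uJ HJ] := @gauss_scaled_lb R (pivot Q) h S e (pivot_gt0 Qp) h0 e0.
exists (prod_seq J Y); first exact: prod_seq_uniq.
rewrite gauss_sum_prod //.
apply: (@le_trans _ _ (gauss_sum (schur_complement Q) h Y * (c - 2 * h - e))); last first.
  rewrite /gauss_sum -mulrA ler_pM2l ?exprn_gt0 // mulr_suml big_seq [leRHS]big_seq.
  apply: ler_sum => y yY; rewrite ler_pM2l ?expR_gt0 //; apply: HJ.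
  by rewrite /S (big_rem y) //= lerDl sumr_ge0.
apply: (@le_trans _ _ ((G - e) * (c - 2 * h - e))); last by rewrite ler_pM2r //; lra.
move: e1; rewrite /D; nra.
Qed.

(** * Trigonometric bounds and the Bernoulli characteristic function *)

(** Taylor bounds for [sin], [cos] and [expR] are obtained by applying this
repeatedly to the successive remainders. *)
Lemma nondecreasing_from0 (R : realType) (f df : R -> R) (x : R) :
  f 0 = 0 -> (forall y, is_derive y (1 : R) f (df y)) ->
  (forall y, 0 <= y -> 0 <= df y) -> 0 <= x -> 0 <= f x.
Proof.
move=> f0 fd df0 x0.
have [|c] := @MVT_segment R f df 0 x x0 (fun z _ => fd z).
  apply: continuous_subspaceT => z; apply: differentiable_continuous.
  by apply/derivable1_diffP; have [] := fd z.
rewrite in_itv /= f0 !subr0 => /andP[c0 _] ->.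
by rewrite mulr_ge0 ?df0.
Qed.

Section TrigBounds.
Variable R : realType.
Implicit Types x y : R.

Lemma sin_le_id x : 0 <= x -> sin x <= x.
Proof.
move=> x0; rewrite -subr_ge0.
apply: (@nondecreasing_from0 R (fun y => y - sin y) (fun y => 1 - cos y)) => //.
by rewrite sin0 subr0.
Qed.

Lemma cos_ge_quadratic x : 1 - x ^+ 2 / 2 <= cos x.
Proof.
wlog x0 : x / 0 <= x.
  move=> H; have [/H//|x0] := leP 0 x.
  by have := H (- x); rewrite cosN sqrrN; apply; lra.
rewrite -subr_ge0.
apply: (@nondecreasing_from0 R (fun y => cos y - (1 - y ^+ 2 / 2))
   (fun y => y - sin y)) => //.
- by rewrite cos0 expr0n /= mul0r subr0 subrr.
- by move=> y; apply: is_derive_eq; rewrite /GRing.scale /=; field.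
- by move=> y /sin_le_id; lra.
Qed.

Lemma sin_ge_cubic x : 0 <= x -> x - x ^+ 3 / 6 <= sin x.
Proof.
move=> x0; rewrite -subr_ge0.
apply: (@nondecreasing_from0 R (fun y => sin y - (y - y ^+ 3 / 6))
   (fun y => cos y - (1 - y ^+ 2 / 2))) => //.
- by rewrite sin0 expr0n /= mul0r !subr0.
- by move=> y; apply: is_derive_eq; rewrite /GRing.scale /=; field.
- by move=> y _; have := cos_ge_quadratic y; lra.
Qed.

Lemma cos_le_quartic x : cos x <= 1 - x ^+ 2 / 2 + x ^+ 4 / 24.
Proof.
wlog x0 : x / 0 <= x.
  move=> H; have [/H//|x0] := leP 0 x.
  have := H (- x); rewrite cosN (_ : (- x) ^+ 4 = x ^+ 4); last by ring.
  by rewrite sqrrN; apply; lra.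
rewrite -subr_ge0.
apply: (@nondecreasing_from0 R (fun y => 1 - y ^+ 2 / 2 + y ^+ 4 / 24 - cos y)
   (fun y => sin y - (y - y ^+ 3 / 6))) => //.
- by rewrite cos0 !expr0n /= !mul0r subr0 addr0 subrr.
- by move=> y; apply: is_derive_eq; rewrite /GRing.scale /=; field.
- by move=> y /sin_ge_cubic; lra.
Qed.

Lemma sin_dist_id x : `|sin x - x| <= `|x| ^+ 3 / 6.
Proof.
wlog x0 : x / 0 <= x.
  move=> H; have [/H//|x0] := leP 0 x.
  have := H (- x); rewrite sinN -opprD !normrN; apply; lra.
rewrite (ger0_norm x0) ler_norml; have := sin_ge_cubic x0; have := sin_le_id x0.
have : 0 <= x ^+ 3 by apply: exprn_ge0.
lra.
Qed.

(** Writing [1 - cos x] as twice the square of [sin (x / 2)], the cubic lower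
bound for the sine already gives a constant that only needs [pi <= 4]. *)
Lemma one_sub_cos_ge x : `|x| <= pi -> x ^+ 2 / 18 <= 1 - cos x.
Proof.
wlog x0 : x / 0 <= x.
  move=> H; have [/H//|x0] := leP 0 x.
  by have := H (- x); rewrite cosN normrN sqrrN; apply; lra.
rewrite ger0_norm // => xpi.
have p2 := @pihalf_lt2 R.
have := @sin_ge_cubic (x / 2); rewrite divr_ge0 // => /(_ isT) s.
have ->: cos x = 1 - 2 * sin (x / 2) ^+ 2.
  rewrite {1}(_ : x = (x / 2) *+ 2); last by rewrite mulr2n; field.
  by rewrite cos_mulr2n cos2sin2; ring.
have x4 : 0 <= x <= 4 by rewrite x0; lra.
have h : x / 6 <= sin (x / 2).
  by apply: le_trans s; nra.
have : (x / 6) ^+ 2 <= sin (x / 2) ^+ 2 by rewrite ler_pXn2r ?nnegrE //; lra.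
lra.
Qed.

Lemma expR_neg_le_quadratic x : 0 <= x -> expR (- x) <= 1 - x + x ^+ 2 / 2.
Proof.
move=> x0; rewrite -subr_ge0.
apply: (@nondecreasing_from0 R (fun y => 1 - y + y ^+ 2 / 2 - expR (- y))
   (fun y => - 1 + y + expR (- y))) => //.
- by rewrite oppr0 expR0 expr0n /= mul0r; lra.
- by move=> y; apply: is_derive_eq; rewrite /GRing.scale /=; field.
- by move=> y _; have := expR_ge1Dx (- y); lra.
Qed.

End TrigBounds.

Local Open Scope complex_scope.


Definition cis (R : realType) (x : R) : R[i] := cos x +i* sin x.

Section Cis.
Variable R : realType.
Implicit Types x y : R.

Lemma cis0 : cis (0 : R) = 1.
Proof. by rewrite /cis cos0 sin0. Qed.

Lemma cisD x y : cis (x + y) = cis x * cis y.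
Proof. by rewrite /cis cosD sinD; simpc; congr (_ +i* _); ring. Qed.

Lemma cis_sum (I : Type) (s : seq I) (P : pred I) (F : I -> R) :
  cis (\sum_(i <- s | P i) F i) = \prod_(i <- s | P i) cis (F i).
Proof. exact: (big_morph _ cisD cis0). Qed.

Lemma cis_mulrn x n : cis (x *+ n) = cis x ^+ n.
Proof. by elim: n => [|n IH]; rewrite ?mulr0n ?cis0 // mulrS exprS cisD IH. Qed.

Lemma cis2pi_int (z : int) : cis (2 * pi * z%:~R : R) = 1.
Proof.
have nat_case (n : nat) : cis (2 * pi * n%:R : R) = 1.
  rewrite mulr_natr cis_mulrn (_ : 2 * pi = pi *+ 2); last by rewrite mulr2n; ring.
  by rewrite /cis cos2pi sin2pi expr1n.
case: z => n; first exact: nat_case.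
have := cisD (2 * pi * (Negz n)%:~R) (2 * pi * n.+1%:R).
by rewrite NegzE rmorphN /= mulrN addNr cis0 nat_case mulr1.
Qed.

Lemma cis_neq1 x : 0 < x < 2 * pi -> cis x != 1.
Proof.
move=> x0; apply/eqP => -[cx _].
have : 0 < sin (x / 2) by apply: sin_gt0_pi; lra.
have := cx; rewrite {1}(_ : x = (x / 2) *+ 2); last by rewrite mulr2n; field.
rewrite cos_mulr2n cos2sin2 => h h2.
have : 0 < sin (x / 2) ^+ 2 by rewrite exprn_gt0.
lra.
Qed.

Lemma normc_le_coords x y : normc (x +i* y) <= `|x| + `|y|.
Proof.
rewrite /= -(ger0_norm (addr_ge0 (normr_ge0 x) (normr_ge0 y))) -sqrtr_sqr.
rewrite ler_sqrt ?sqr_ge0 // sqrrD !real_normK ?num_real // -addrA lerD2l.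
by rewrite lerDr mulrn_wge0 // mulr_ge0.
Qed.

Lemma normc_real x : normc x%:C = `|x|.
Proof. by rewrite /= expr0n addr0 sqrtr_sqr. Qed.

End Cis.

(** The expectation of [cis ((xi - p) * x)] for a Bernoulli variable [xi] of
parameter [p]. *)
Definition bernoulli_cf (R : realType) (p x : R) : R[i] :=
  (1 - p)%:C * cis (- (p * x)) + p%:C * cis ((1 - p) * x).

Section BernoulliCf.
Variables (R : realType) (p : R).
Hypothesis p01 : 0 <= p <= 1.
Implicit Types x : R.
Let p0 : 0 <= p. Proof. by case/andP: p01. Qed.
Let p1 : p <= 1. Proof. by case/andP: p01. Qed.
Let w := p * (1 - p).

Lemma bernoulli_cfE x : bernoulli_cf p x =
  ((1 - p) * cos (p * x) + p * cos ((1 - p) * x)) +i*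
  (- ((1 - p) * sin (p * x)) + p * sin ((1 - p) * x)).
Proof.
rewrite /bernoulli_cf /cis cosN sinN.
by apply/eqP; rewrite eq_complex /=; apply/andP; split; apply/eqP; ring.
Qed.

(** The squared modulus is exactly [1 - 2 p (1 - p) (1 - cos x)]. *)
Lemma normc_bernoulli_cf x : normc (bernoulli_cf p x) <= expR (- (w * (1 - cos x))).
Proof.
rewrite bernoulli_cfE /= -(ger0_norm (expR_ge0 (- (w * (1 - cos x))))) -sqrtr_sqr.
rewrite ler_sqrt ?sqr_ge0 //.
have -> : expR (- (w * (1 - cos x))) ^+ 2 = expR (- (2 * w * (1 - cos x))).
  by rewrite -expRM_natl; congr expR; ring.
apply: le_trans (expR_ge1Dx _).
have -> : cos x = cos (p * x + (1 - p) * x) by congr cos; ring.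
rewrite cosD.
have := cos2Dsin2 (p * x); have := cos2Dsin2 ((1 - p) * x).
set c1 := cos _; set s1 := sin _; set c2 := cos _; set s2 := sin _ => e1 e2.
rewrite le_eqVlt; apply/orP; left; apply/eqP.
transitivity ((1 - p) ^+ 2 * (c2 ^+ 2 + s2 ^+ 2) + p ^+ 2 * (c1 ^+ 2 + s1 ^+ 2)
  + 2 * w * (c2 * c1 - s2 * s1)); first by rewrite /w; ring.
by rewrite e1 e2 /w; ring.
Qed.

Lemma bernoulli_variance_ge0 : 0 <= w.
Proof. by rewrite /w mulr_ge0 // subr_ge0. Qed.

Lemma bernoulli_variance_le : w <= 4^-1.
Proof. by have := sqr_ge0 (p - 2^-1); rewrite /w; lra. Qed.

Lemma normc_bernoulli_cf_near x :
  normc (bernoulli_cf p x) <= expR (- (w * (x ^+ 2 / 2 - x ^+ 4 / 24))).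
Proof.
apply: le_trans (normc_bernoulli_cf x) _.
rewrite ler_expR lerN2 ler_wpM2l ?bernoulli_variance_ge0 //; have := cos_le_quartic x; lra.
Qed.

(** The linear term vanishes because the variable is centred and the
quadratic one agrees with that of the Gaussian; the leading cubic error has the
factor [p * (1 - p)], which keeps the total error proportional to the variance. *)
Lemma bernoulli_cf_taylor x : `|x| <= 1 ->
  normc (bernoulli_cf p x - (expR (- (w * x ^+ 2 / 2)))%:C) <= w * `|x| ^+ 3 / 4.
Proof.
move=> x1; rewrite bernoulli_cfE.
set Z := _ +i* _.
have -> : Z - (expR (- (w * x ^+ 2 / 2)))%:C =
  ((1 - p) * cos (p * x) + p * cos ((1 - p) * x) - expR (- (w * x ^+ 2 / 2))) +i*
  (- ((1 - p) * sin (p * x)) + p * sin ((1 - p) * x)).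
  by apply/eqP; rewrite eq_complex /= subr0 !eqxx.
apply: le_trans (normc_le_coords _ _) _.
set y := `|x|; have y0 : 0 <= y by apply: normr_ge0.
have w0 := bernoulli_variance_ge0; have w4 := bernoulli_variance_le.
have x2 : x ^+ 2 = y ^+ 2 by rewrite real_normK ?num_real.
have y3 : 0 <= y ^+ 3 by apply: exprn_ge0.
have y43 : y ^+ 4 <= y ^+ 3 by rewrite [y ^+ 4]exprS ler_piMl.
have hpq : p ^+ 3 + (1 - p) ^+ 3 <= 1.
  by have := w0; rewrite /w; nra.
have hpq2 : p ^+ 2 + (1 - p) ^+ 2 <= 1.
  by have := w0; rewrite /w; nra.
have wy3 : 0 <= w * y ^+ 3 by apply: mulr_ge0.
have im : `|- ((1 - p) * sin (p * x)) + p * sin ((1 - p) * x)| <= w * y ^+ 3 / 6.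
  have -> : - ((1 - p) * sin (p * x)) + p * sin ((1 - p) * x) =
     p * (sin ((1 - p) * x) - (1 - p) * x) - (1 - p) * (sin (p * x) - p * x) by ring.
  apply: le_trans (ler_normB _ _) _; rewrite !normrM.
  have := sin_dist_id ((1 - p) * x); have := sin_dist_id (p * x).
  rewrite !normrM !exprMn -/y.
  have -> : `|p| = p by apply/ger0_norm.
  have -> : `|1 - p| = 1 - p by apply/ger0_norm; rewrite subr_ge0.
  set A := `|_ - _|; set B := `|_ - _| => hA hB.
  apply: (@le_trans _ _ (p * ((1 - p) ^+ 3 * y ^+ 3 / 6) + (1 - p) * (p ^+ 3 * y ^+ 3 / 6))).
    by apply: lerD; apply: ler_wpM2l => //; rewrite ?subr_ge0 //; lra.
  have -> : p * ((1 - p) ^+ 3 * y ^+ 3 / 6) + (1 - p) * (p ^+ 3 * y ^+ 3 / 6) =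
    (w * y ^+ 3 / 6) * (p ^+ 2 + (1 - p) ^+ 2) by rewrite /w; field.
  by rewrite ler_piMr // divr_ge0.
have re : `|(1 - p) * cos (p * x) + p * cos ((1 - p) * x) - expR (- (w * x ^+ 2 / 2))|
    <= w * y ^+ 3 / 12.
  have c1l := cos_ge_quadratic (p * x); have c1u := cos_le_quartic (p * x).
  have c2l := cos_ge_quadratic ((1 - p) * x); have c2u := cos_le_quartic ((1 - p) * x).
  have el := expR_ge1Dx (- (w * x ^+ 2 / 2)).
  have eu : expR (- (w * x ^+ 2 / 2)) <= 1 - w * x ^+ 2 / 2 + (w * x ^+ 2 / 2) ^+ 2 / 2.
    by apply: expR_neg_le_quadratic; rewrite divr_ge0 // mulr_ge0 // sqr_ge0.
  set E := expR _ in el eu *.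
  have ml : 1 - w * x ^+ 2 / 2 <= (1 - p) * cos (p * x) + p * cos ((1 - p) * x).
    apply: (@le_trans _ _ ((1 - p) * (1 - (p * x) ^+ 2 / 2) + p * (1 - ((1 - p) * x) ^+ 2 / 2))).
      by rewrite le_eqVlt; apply/orP; left; apply/eqP; rewrite /w; field.
    by apply: lerD; apply: ler_wpM2l => //; rewrite ?subr_ge0 //; lra.
  have mu : (1 - p) * cos (p * x) + p * cos ((1 - p) * x) <=
      1 - w * x ^+ 2 / 2 + w * y ^+ 3 / 24.
    apply: (@le_trans _ _ ((1 - p) * (1 - (p * x) ^+ 2 / 2 + (p * x) ^+ 4 / 24)
        + p * (1 - ((1 - p) * x) ^+ 2 / 2 + ((1 - p) * x) ^+ 4 / 24))).
      by apply: lerD; apply: ler_wpM2l => //; rewrite ?subr_ge0 //; lra.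
    have -> : (1 - p) * (1 - (p * x) ^+ 2 / 2 + (p * x) ^+ 4 / 24)
        + p * (1 - ((1 - p) * x) ^+ 2 / 2 + ((1 - p) * x) ^+ 4 / 24) =
       1 - w * x ^+ 2 / 2 + (w * x ^+ 4 / 24) * (p ^+ 3 + (1 - p) ^+ 3).
      by rewrite /w; field.
    have -> : x ^+ 4 = y ^+ 4 by rewrite (exprM x 2 2) (exprM y 2 2) x2.
    have y4 : 0 <= y ^+ 4 by apply: exprn_ge0.
    rewrite lerD2l; apply: (@le_trans _ _ (w * y ^+ 4 / 24)).
      by rewrite ler_piMr // divr_ge0 // mulr_ge0.
    by rewrite ler_pM2r ?invr_gt0 // ler_wpM2l.
  have ww : (w * x ^+ 2 / 2) ^+ 2 / 2 <= w * y ^+ 3 / 32.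
    have -> : (w * x ^+ 2 / 2) ^+ 2 / 2 = (w / 8) * (w * y ^+ 4).
      by rewrite x2; field.
    have : w * y ^+ 4 <= w * y ^+ 3 by rewrite ler_wpM2l.
    have : 0 <= w * y ^+ 4 by rewrite mulr_ge0 // exprn_ge0.
    nra.
  by rewrite ler_norml; lra.
by have := re; have := im; lra.
Qed.

End BernoulliCf.

Lemma normc_prod (R : realType) (I : Type) (s : seq I) (F : I -> R[i]) :
  normc (\prod_(i <- s) F i) = \prod_(i <- s) normc (F i).
Proof. exact: (big_morph _ (@normcM R) (@normc1 R)). Qed.

Lemma normc_sum (R : realType) (I : Type) (s : seq I) (P : pred I) (F : I -> R[i]) :
  normc (\sum_(i <- s | P i) F i) <= \sum_(i <- s | P i) normc (F i).
Proof.
elim/big_ind2: _ => //; first by rewrite normc0.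
by move=> x u y v xu yv; apply: le_trans (le_normcD _ _) _; apply: lerD.
Qed.

(** Telescoping: replacing one factor at a time costs its error times the
majorants of all the other factors, and the missing majorant costs a factor at
most two. *)
Lemma prod_compare (R : realType) (I : Type) (s : seq I) (Z W : I -> R[i])
    (m delta : I -> R) :
  (forall i, normc (Z i) <= expR (m i)) -> (forall i, normc (W i) <= expR (m i)) ->
  (forall i, expR (- m i) <= 2) -> (forall i, normc (Z i - W i) <= delta i) ->
  normc (\prod_(i <- s) Z i - \prod_(i <- s) W i)
    <= expR (\sum_(i <- s) m i) * (2 * \sum_(i <- s) delta i).
Proof.
move=> Zm Wm m2 ZW; elim: s => [|i s IH].
  by rewrite !big_nil subrr normc0 !mulr0.
rewrite !big_cons.
have -> : Z i * \prod_(j <- s) Z j - W i * \prod_(j <- s) W j =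
   Z i * (\prod_(j <- s) Z j - \prod_(j <- s) W j) + (Z i - W i) * \prod_(j <- s) W j.
  by ring.
apply: le_trans (le_normcD _ _) _; rewrite !normcM expRD.
have nz (z : R[i]) : 0 <= normc z by case: z => a b; apply: sqrtr_ge0.
have Ws : normc (\prod_(j <- s) W j) <= expR (\sum_(j <- s) m j).
  rewrite normc_prod expR_sum; apply: ler_prod => j _.
  by rewrite nz Wm.
have E0 := expR_gt0 (\sum_(j <- s) m j); have e0 := expR_gt0 (m i).
have e2 : 1 <= 2 * expR (m i).
  by rewrite -ler_pdivrMr // div1r -expRN.
set E := expR (\sum_(j <- s) m j) in IH Ws E0 *; set e := expR (m i) in e0 e2 *.
have d0 : 0 <= delta i := le_trans (nz _) (ZW i).
apply: (@le_trans _ _ (e * (E * (2 * \sum_(j <- s) delta j)) + delta i * E)).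
  by apply: lerD; apply: ler_pM => //; apply: Zm.
have -> : e * E * (2 * (delta i + \sum_(j <- s) delta j)) =
  e * (E * (2 * \sum_(j <- s) delta j)) + delta i * E * (2 * e) by ring.
by rewrite lerD2l ler_peMr // mulr_ge0 // ltW.
Qed.

(** Common majorants of both kinds of factors are the Gaussian ones corrected
by the quartic term of the cosine; the corrections multiply to at most
[expR 1]. *)
Lemma prod_bernoulli_cf_near (R : realType) (B : finType) (p : R) (x : B -> R) :
  0 <= p <= 1 -> (forall b, `|x b| <= 1) ->
  p * (1 - p) * (\sum_b x b ^+ 4) <= 24 ->
  normc (\prod_b bernoulli_cf p (x b)
          - (expR (- (p * (1 - p) * (\sum_b x b ^+ 2)) / 2))%:C)
    <= 2 * expR (- (p * (1 - p) * (\sum_b x b ^+ 2)) / 2)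
       * (p * (1 - p) * \sum_b `|x b| ^+ 3).
Proof.
move=> p01 x1; set w := p * (1 - p) => x4.
have w0 : 0 <= w by apply: bernoulli_variance_ge0.
have w14 : w <= 4^-1 by apply: bernoulli_variance_le.
have EW : (expR (- (w * (\sum_b x b ^+ 2)) / 2))%:C =
   \prod_b (expR (- (w * x b ^+ 2 / 2)))%:C :> R[i].
  rewrite -rmorph_prod /= -expR_sum; congr (_%:C); congr expR.
  by rewrite sumrN -mulr_suml -mulr_sumr mulNr.
rewrite EW.
have := @prod_compare R B (index_enum B) (fun b => bernoulli_cf p (x b))
  (fun b => (expR (- (w * x b ^+ 2 / 2)))%:C)
  (fun b => - (w * (x b ^+ 2 / 2 - x b ^+ 4 / 24))) (fun b => w * `|x b| ^+ 3 / 4).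
move=> H; apply: le_trans (H _ _ _ _) _ => {H}.
- by move=> b; apply: normc_bernoulli_cf_near.
- move=> b; rewrite normc_real ger0_norm ?expR_ge0 // ler_expR lerN2 -mulrA ler_wpM2l //.
  by rewrite gerBl divr_ge0 // (exprM _ 2 2) sqr_ge0.
- move=> b; rewrite opprK.
  have xb2 : 0 <= x b ^+ 2 <= 1.
    rewrite sqr_ge0 /= -[x b ^+ 2]real_normK ?num_real // exprn_ile1 //.
  have xb4 : 0 <= x b ^+ 4 by rewrite (exprM _ 2 2) sqr_ge0.
  have le8 : w * (x b ^+ 2 / 2 - x b ^+ 4 / 24) <= 2^-1 by nra.
  apply: (@le_trans _ _ (expR 2^-1)); first by rewrite ler_expR.
  have := expR_ge1Dx (- 2^-1 : R); rewrite expRN => h.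
  rewrite -(invrK (expR _)) -[X in _ <= X]invrK lef_pV2 ?posrE ?invr_gt0 ?expR_gt0 //.
  lra.
- by move=> b; apply: bernoulli_cf_taylor.
rewrite -mulr_suml -mulr_sumr sumrN -mulr_sumr sumrB -!mulr_suml.
set S2 := \sum_b x b ^+ 2; set S3 := \sum_b _ ^+ 3; set S4 := \sum_b _ ^+ 4 in x4 *.
have S30 : 0 <= S3 by apply: sumr_ge0 => b _; apply: exprn_ge0.
have e3 : expR 1 <= 4 :> R.
  have := expR_ge1Dx (- 2^-1 : R); rewrite expRN => h.
  have -> : expR 1 = expR 2^-1 ^+ 2 :> R by rewrite -expRM_natl mulfV.
  have h2 : expR 2^-1 <= 2 :> R.
    rewrite -(invrK (expR _)) -[X in _ <= X]invrK lef_pV2 ?posrE ?invr_gt0 ?expR_gt0 //.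
    lra.
  have := expR_gt0 (2^-1 : R); nra.
have -> : - (w * (S2 / 2 - S4 / 24)) = - (w * S2) / 2 + w * S4 / 24 by ring.
rewrite expRD.
have : expR (w * S4 / 24) <= 4 by apply: le_trans e3; rewrite ler_expR; lra.
have := expR_gt0 (- (w * S2) / 2); set E := expR _; set F := expR _ => E0 F4.
have wS : 0 <= w * S3 by apply: mulr_ge0.
have -> : E * F * (2 * (w * S3 / 4)) = E * (w * S3) * (F / 2) by field.
have -> : 2 * E * (w * S3) = E * (w * S3) * 2 by ring.
by apply: ler_wpM2l; [rewrite mulr_ge0 // ltW|lra].
Qed.

Local Close Scope complex_scope.

(** * Distance to the integers and symmetries *)

Section DistInt.
Variable R : realType.
Implicit Types x y : R.

Definition nearest_int x : int := Num.floor (x + 2^-1).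
Definition dist_int x : R := `|x - (nearest_int x)%:~R|.

Lemma nearest_int_itv x : - 2^-1 <= x - (nearest_int x)%:~R < 2^-1.
Proof.
have := Num.Theory.floor_le (x + 2^-1); have := Num.Theory.floorD1_gt (x + 2^-1).
by rewrite /nearest_int intrD; lra.
Qed.

Lemma dist_int_ge0 x : 0 <= dist_int x.
Proof. exact: normr_ge0. Qed.

Lemma dist_int_le x (z : int) : dist_int x <= `|x - z%:~R|.
Proof.
have := nearest_int_itv x; rewrite /dist_int; set n := nearest_int x => hn.
have [->//|nz] := eqVneq n z.
have h1 : 1 <= `|(n - z)%:~R : R|.
  by rewrite -intr_norm -[1]/(1%:~R) ler_int -gtz0_ge1 normr_gt0 subr_eq0.
have h2 : `|(n - z)%:~R : R| <= `|x - z%:~R| + `|x - n%:~R|.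
  rewrite (_ : (n - z)%:~R = (x - z%:~R) - (x - n%:~R)); first exact: ler_normB.
  by rewrite rmorphB /=; ring.
have h3 : `|x - n%:~R| <= 2^-1 by rewrite ler_norml; lra.
lra.
Qed.

Lemma dist_int_le_norm x : dist_int x <= `|x|.
Proof. by have := dist_int_le x 0; rewrite subr0. Qed.

Lemma dist_intD x y : dist_int (x + y) <= dist_int x + dist_int y.
Proof.
apply: le_trans (dist_int_le _ (nearest_int x + nearest_int y)) _.
by rewrite rmorphD /= opprD addrACA ler_normD.
Qed.

Lemma dist_intN x : dist_int (- x) <= dist_int x.
Proof.
apply: le_trans (dist_int_le _ (- nearest_int x)) _.
by rewrite rmorphN /= -opprD normrN.
Qed.

Lemma dist_intB x y : dist_int (x - y) <= dist_int x + dist_int y.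
Proof. by apply: le_trans (dist_intD _ _) _; rewrite lerD2l dist_intN. Qed.

Lemma dist_int_sum (I : finType) (P : pred I) (F : I -> R) :
  dist_int (\sum_(i | P i) F i) <= \sum_(i | P i) dist_int (F i).
Proof.
elim/big_ind2: _ => [|x u y v xu yv|//].
  by apply: le_trans (dist_int_le_norm 0) _; rewrite normr0.
by apply: le_trans (dist_intD _ _) _; apply: lerD.
Qed.

End DistInt.

Lemma exists_average (R : realType) (T : finType) (A : {set T}) (h : T -> R) (c : R) :
  (exists x, x \in A) -> \sum_(x in A) h x <= #|A|%:R * c ->
  exists2 x, x \in A & h x <= c.
Proof.
move=> [x0 x0A] H; apply: contrapT => N; move: H; apply/negP; rewrite -ltNge.
have gt x : x \in A -> c < h x.
  by move=> xA; rewrite ltNge; apply/negP => hx; apply: N; exists x.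
rewrite mulr_natl -sumr_const (bigD1 x0) //= [ltRHS](bigD1 x0) //=.
by apply: ltr_leD; [exact: gt|apply: ler_sum => x /andP[xA _]; apply/ltW/gt].
Qed.

Section Symmetries.
Variables (B : finType) (V : {vspace ratfun B}).

Definition symmetries : {set {perm B}} := [set s | `[< is_symmetry V s >]].

Lemma symmetriesP s : reflect (is_symmetry V s) (s \in symmetries).
Proof. by rewrite inE; apply: asboolP. Qed.

Lemma symmetry1 : 1%g \in symmetries.
Proof.
apply/symmetriesP => f fV; rewrite (_ : [ffun b => _] = f) //.
by apply/ffunP => b; rewrite ffunE perm1.
Qed.

Lemma symmetryM s t : s \in symmetries -> t \in symmetries -> (s * t)%g \in symmetries.
Proof.
move=> /symmetriesP hs /symmetriesP ht; apply/symmetriesP => f fV.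
rewrite (_ : finfun _ = [ffun b => [ffun b => f (t b)] (s b)]); first exact/hs/ht.
by apply/ffunP => b; rewrite !ffunE permM.
Qed.

Lemma symmetryV s : s \in symmetries -> s^-1%g \in symmetries.
Proof.
move=> hs; rewrite invg_expg.
by elim: #[s]%g.-1 => [|n IH]; rewrite ?expg0 ?symmetry1 // expgS symmetryM.
Qed.

Hypothesis trans : forall b1 b2 : B, exists s : {perm B}, is_symmetry V s /\ s b1 = b2.

(** Averaging over the symmetries is averaging over the points, by
transitivity; no stabiliser needs to be counted. *)
Lemma sum_symmetries (R : realType) (h : B -> R) (b : B) :
  #|B|%:R * \sum_(s in symmetries) h (s b) = #|symmetries|%:R * \sum_b h b.
Proof.
have const b1 b2 : \sum_(s in symmetries) h (s b1) = \sum_(s in symmetries) h (s b2).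
  have [t [/symmetriesP tG <-]] := trans b1 b2.
  rewrite (reindex_inj (mulgI t)) /=; apply: eq_big => [s|s _]; last by rewrite permM.
  apply/idP/idP => [h1|]; last exact: (symmetryM tG).
  by rewrite -(mulKg t s) symmetryM // symmetryV.
transitivity (\sum_(b' : B) \sum_(s in symmetries) h (s b')).
  rewrite (eq_bigr _ (fun b' _ => const b' b)) sumr_const.
  by rewrite mulr_natl.
rewrite exchange_big /= mulr_natl -sumr_const; apply: eq_bigr => s _.
by rewrite [RHS](reindex_inj (@perm_inj _ s)).
Qed.

(** The interaction of two translates at the point where the first one takes
its value at [b0]; general position means that these are all small. *)
Definition cross_term (R : realType) (h : B -> R) (b0 : B) (s t : {perm B}) : R :=
  h (t ((s^-1)%g b0)).

(** Chosen one at a time: as a new symmetry varies, both kinds of new cross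
terms have the average of [h] as their mean. *)
Lemma spread_symmetries (R : realType) (h : B -> R) (b0 : B) (n : nat) :
  (forall b, 0 <= h b) ->
  exists pi_ : nat -> {perm B}, (forall i, pi_ i \in symmetries) /\
  #|B|%:R * (\sum_(j < n) \sum_(l < n | l != j) cross_term h b0 (pi_ j) (pi_ l))
     <= n%:R ^+ 2 * \sum_b h b.
Proof.
move=> h0; elim: n => [|n [q [qG IH]]].
  by exists (fun=> 1%g); split=> [i|]; rewrite ?symmetry1 // big_ord0 mulr0 expr0n mul0r.
have [p pG hp] : exists2 p, p \in symmetries &
    #|B|%:R * \sum_(l < n) (cross_term h b0 p (q l) + cross_term h b0 (q l) p)
       <= 2 * n%:R * \sum_b h b.
  have [||p pG hp] := @exists_average R _ symmetries (fun p =>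
     #|B|%:R * \sum_(l < n) (cross_term h b0 p (q l) + cross_term h b0 (q l) p))
     (2 * n%:R * \sum_b h b); last by exists p.
  - by exists 1%g; apply: symmetry1.
  rewrite -mulr_sumr exchange_big /= mulr_sumr.
  rewrite (eq_bigr (fun=> #|symmetries|%:R * (2 * \sum_b h b))).
    by rewrite sumr_const card_ord -mulr_natl; lra.
  move=> l _; rewrite big_split /= mulrDr /cross_term.
  rewrite (reindex_inj (@invg_inj _)) /= (eq_bigl (mem symmetries)); last first.
    by move=> s; apply/idP/idP => [/symmetryV|/symmetryV]; rewrite ?invgK.
  under eq_bigr do rewrite invgK.
  rewrite (sum_symmetries (fun b => h (q l b))) sum_symmetries.
  have -> : \sum_b h (q l b) = \sum_b h b.
    by rewrite [RHS](reindex_inj (@perm_inj _ (q l))).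
  lra.
pose r i := if i == n then p else q i.
have rE (i : nat) : (i < n)%N -> r i = q i by rewrite /r; case: eqP => // ->; rewrite ltnn.
have rn : r n = p by rewrite /r eqxx.
exists r; split=> [i|]; first by rewrite /r; case: eqP.
pose F i j : R := if j == i then 0 else cross_term h b0 (r i) (r j).
have sumF N : \sum_(j < N) \sum_(l < N | l != j) cross_term h b0 (r j) (r l)
     = \sum_(j < N) \sum_(l < N) F j l.
  apply: eq_bigr => j _; rewrite big_mkcond /=; apply: eq_bigr => l _.
  by rewrite /F -val_eqE /=; case: eqP.
rewrite sumF big_ord_recr /= big_ord_recr /= {3}/F eqxx addr0.
under eq_bigr do rewrite big_ord_recr /=.
rewrite big_split /= -addrA -big_split /=.
have -> : \sum_(j < n) \sum_(l < n) F j l =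
   \sum_(j < n) \sum_(l < n | l != j) cross_term h b0 (q j) (q l).
  rewrite -sumF; apply: eq_bigr => j _; apply: eq_bigr => l _.
  by rewrite !rE.
have -> : \sum_(i < n) (F i n + F n i) =
   \sum_(l < n) (cross_term h b0 p (q l) + cross_term h b0 (q l) p).
  apply: eq_bigr => l _; rewrite /F rn rE // (gtn_eqF (ltn_ord l)).
  by rewrite (ltn_eqF (ltn_ord l)) addrC.
rewrite mulrDr; apply: (le_trans (lerD IH hp)).
rewrite -mulrDl; apply: ler_wpM2r; first exact: sumr_ge0.
by rewrite -[n.+1]addn1 natrD; lra.
Qed.

End Symmetries.

(** * Real spans and bounded integer bases *)

Section RealSpan.
Variables (R : realType) (B : finType) (V : {vspace ratfun B}).

(** The real span of [V] is given by unrestricted real combinations of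
elements of [V], so that it does not refer to a basis. *)
Definition real_span (f : B -> R) : Prop :=
  exists2 s : seq (R * ratfun B), (forall tg, tg \in s -> tg.2 \in V) &
    forall b, f b = \sum_(tg <- s) tg.1 * ratr (tg.2 b : rat).

Lemma real_span0 : real_span (fun=> 0).
Proof. by exists [::] => // b; rewrite big_nil. Qed.

Lemma real_spanD f g : real_span f -> real_span g -> real_span (fun b => f b + g b).
Proof.
move=> [s sV fE] [s' s'V gE]; exists (s ++ s').
  by move=> tg; rewrite mem_cat => /orP[/sV|/s'V].
by move=> b; rewrite big_cat fE gE.
Qed.

Lemma real_span_ext f g : f =1 g -> real_span f -> real_span g.
Proof. by move=> fg [s sV fE]; exists s => // b; rewrite -fg. Qed.

Lemma real_span_sum (I : finType) (P : pred I) (F : I -> B -> R) :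
  (forall i, real_span (F i)) -> real_span (fun b => \sum_(i | P i) F i b).
Proof.
move=> FV; elim: (index_enum I) => [|i s IH].
  by apply: real_span_ext real_span0 => b; rewrite big_nil.
case Pi: (P i).
  by apply: real_span_ext (real_spanD (FV i) IH) => b; rewrite big_cons Pi.
by apply: real_span_ext IH => b; rewrite big_cons Pi.
Qed.

Lemma real_span_mem (t : R) (g : ratfun B) : g \in V ->
  real_span (fun b => t * ratr (g b : rat)).
Proof.
move=> gV; exists [:: (t, g)] => [tg|b]; first by rewrite inE => /eqP->.
by rewrite big_seq1.
Qed.

Lemma real_span_comp f (s : {perm B}) : is_symmetry V s -> real_span f ->
  real_span (f \o s).
Proof.
move=> hs [u uV fE]; exists (map (fun tg : R * ratfun B => (tg.1, [ffun b => tg.2 (s b)] : ratfun B)) u).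
  by move=> tg /mapP[tg' /uV tV ->] /=; apply: hs.
by move=> b; rewrite /= fE big_map; apply: eq_bigr => tg _; rewrite ffunE.
Qed.

Lemma real_span_coord d (X : d.-tuple (ratfun B)) f : basis_of V X -> real_span f ->
  exists t : 'I_d -> R, forall b, f b = \sum_a t a * ratr (tnth X a b : rat).
Proof.
move=> bX [s sV fE].
exists (fun a => \sum_(tg <- s) tg.1 * ratr (coord X a tg.2)) => b.
rewrite fE; under [RHS]eq_bigr do rewrite mulr_suml.
rewrite exchange_big /= big_seq [RHS]big_seq; apply: eq_bigr => tg /sV tV.
have e : tg.2 b = \sum_a coord X a tg.2 * (tnth X a b : rat) :> rat.
  rewrite {1}(coord_basis bX tV) sum_ffunE; apply: eq_bigr => a _.
  by rewrite ffunE (tnth_nth 0).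
rewrite e rmorph_sum /= mulr_sumr; apply: eq_bigr => a _.
by rewrite rmorphM mulrA.
Qed.

Lemma real_span_orth f (g : ratfun B) : real_span f -> g \in orthv V ->
  \sum_b f b * ratr (g b : rat) = 0.
Proof.
move=> [s sV fE] /mem_orthv gV.
under eq_bigr do rewrite fE mulr_suml.
rewrite exchange_big /= big_seq big1 // => tg /sV tV.
under eq_bigr do rewrite -mulrA -rmorphM /=.
by rewrite -mulr_sumr -rmorph_sum /= -[\sum_b _]/(dotf tg.2 g) gV // rmorph0 mulr0.
Qed.

End RealSpan.

Lemma dotf_eq0 (B : finType) (f : ratfun B) : dotf f f = 0 -> f = 0.
Proof.
move=> /eqP; rewrite psumr_eq0 => [/allP f0|b _]; last by rewrite -expr2 sqr_ge0.
apply/ffunP => b; rewrite ffunE; have := f0 b (mem_index_enum b).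
by rewrite mulf_eq0 orbb => /eqP.
Qed.

(** The dot product is positive definite over the rationals, so [V] and its
orthogonal meet trivially, and by dimension they span everything. *)
Lemma orthv_orthv_sub (B : finType) (V : {vspace ratfun B}) (n : ratfun B) :
  (forall g, g \in orthv V -> dotf n g = 0) -> n \in V.
Proof.
move=> nV.
have cap0 : (V :&: orthv V = 0)%VS.
  apply/eqP; rewrite -subv0; apply/subvP => f; rewrite memv_cap => /andP[fV].
  by move=> /mem_orthv/(_ f fV)/dotf_eq0->; rewrite mem0v.
have full : (V + orthv V = fullv)%VS.
  apply/eqP; rewrite eqEdim subvf /= dimv_disjoint_sum //.
  rewrite -(limg_ker_dim (linfun (fun g : ratfun B =>
    ([ffun i : 'I_(\dim V) => dotf (vbasis V)`_i g]
       : {ffun 'I_(\dim V) -> rat^o}))) fullv) capfv addnC leq_add2r.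
  apply: leq_trans (dimvS (subvf _)) _.
  by rewrite dimvf /dim /= card_ord muln1.
have : n \in (V + orthv V)%VS by rewrite full memvf.
move=> /memv_addP[v vV [w wW nE]].
have w0 : w = 0.
  apply: dotf_eq0; have := nV w wW; rewrite nE dotfC -[v]scale1r dotf_linear.
  by have /mem_orthv/(_ v vV) := wW; rewrite dotfC => ->; rewrite mulr0 add0r.
by rewrite nE w0 addr0.
Qed.

Lemma free_span_subseq (B : finType) (s : seq {ffun B -> int}) :
  exists s', [/\ {subset s' <= s}, free [seq ratfun_of_int g | g <- s'] &
    <<[seq ratfun_of_int g | g <- s']>>%VS = <<[seq ratfun_of_int g | g <- s]>>%VS].
Proof.
elim: s => [|x s [s' [sub fr sp]]]; first by exists [::]; split=> //=; rewrite nil_free.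
case xs: (ratfun_of_int x \in <<[seq ratfun_of_int g | g <- s']>>%VS).
  exists s'; split=> // [y /sub ys|]; first by rewrite inE ys orbT.
  rewrite /= span_cons -sp; apply/esym/addv_idPr.
  by rewrite -memvE.
exists (x :: s'); split => /=.
- by move=> y; rewrite !inE => /orP[->//|/sub->]; rewrite orbT.
- by rewrite free_cons xs.
- by rewrite !span_cons sp.
Qed.

Definition int_basis (B : finType) d (phi : 'I_d -> {ffun B -> int}) :
  d.-tuple (ratfun B) := [tuple ratfun_of_int (phi a) | a < d].

Lemma exists_int_basis (B : finType) (V : {vspace ratfun B}) c :
  bounded_integer_basis (@linf_norm B) c V ->
  exists phi : 'I_(\dim V) -> {ffun B -> int},
    (forall a b, (absz (phi a b) <= c)%N) /\ basis_of V (int_basis phi).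
Proof.
move=> [s [sP sV]]; have [s' [sub fr sp]] := free_span_subseq s.
have bV : basis_of V [seq ratfun_of_int g | g <- s'].
  by rewrite basisEfree fr sp sV subvv /= -sV -sp (eqP fr).
have sz : size s' == \dim V by rewrite -sV -sp (eqP fr) size_map.
exists (tnth (Tuple sz)); split.
  move=> a b; have [_] := sP _ (sub _ (mem_tnth a (Tuple sz))).
  by apply: leq_trans; apply: (@leq_bigmax_cond _ xpredT (fun b => absz (tnth (Tuple sz) a b))).
rewrite (_ : int_basis _ = [seq ratfun_of_int g | g <- s'] :> seq _) //.
by rewrite /int_basis /= map_comp map_tnth_enum.
Qed.

(** * Functions that are small modulo one on average *)

Lemma floor_cell (R : realType) (m : nat) (x : R) : (0 < m)%N ->
  exists c : 'I_m, (c%:R <= (x - (Num.floor x)%:~R) * m%:R < c%:R + 1).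
Proof.
move=> m0; have m0' : 0 < m%:R :> R by rewrite ltr0n.
set y := (x - _) * _.
have x0 : 0 <= x - (Num.floor x)%:~R < 1.
  by have := Num.Theory.floor_le x; have := Num.Theory.floorD1_gt x; rewrite intrD; lra.
have y0 : 0 <= y by rewrite /y mulr_ge0 ?ler0n //; case/andP: x0.
have ym : y < m%:R by rewrite /y gtr_pMl //; case/andP: x0.
have tm : (Num.truncn y < m)%N by rewrite Num.Theory.truncn_lt_nat.
exists (Ordinal tm) => /=.
by have := Num.Theory.truncn_itv y0; rewrite -natr1.
Qed.

(** The fractional parts of the coordinates are sorted into [m] cells each;
there are fewer cells than subsets. *)
Lemma pigeonhole_coords (R : realType) d k m (t : {set 'I_k} -> 'I_d -> R) :
  (0 < m)%N -> (m ^ d < 2 ^ k)%N ->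
  exists S S' : {set 'I_k}, S != S' /\
    exists z : 'I_d -> int, forall a, `|t S a - t S' a - (z a)%:~R| <= m%:R^-1.
Proof.
move=> m0 mk; have m0' : 0 < m%:R :> R by rewrite ltr0n.
have cell (x : R) : {c : 'I_m | c%:R <= (x - (Num.floor x)%:~R) * m%:R < c%:R + 1}.
  by apply: cid; apply: floor_cell.
pose F (S : {set 'I_k}) : {ffun 'I_d -> 'I_m} := [ffun a => sval (cell (t S a))].
have /injectivePn[S [S' SS' FE]] : ~~ injectiveb F.
  apply/injectiveP => /leq_card; rewrite card_ffun !card_ord -cardsT -powersetT card_powerset cardsT card_ord.
  by rewrite leqNgt mk.
exists S, S'; split=> //.
exists (fun a => Num.floor (t S a) - Num.floor (t S' a)) => a.
have := congr1 (fun g : {ffun 'I_d -> 'I_m} => g a) FE; rewrite !ffunE => e.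
have := svalP (cell (t S a)); have := svalP (cell (t S' a)); rewrite e.
set c := sval _; move=> h1 h2.
rewrite rmorphB /= -(ler_pM2r m0') mulVf ?gt_eqF //.
rewrite -[m%:R in leLHS](gtr0_norm m0') -normrM ler_norml.
move: h1 h2; lra.
Qed.

Lemma dist_int_signed (R : realType) (x : R) (b c : bool) :
  dist_int (b%:R * x - c%:R * x) <= dist_int x.
Proof.
case: b; case: c; rewrite ?mul1r ?mul0r ?subrr ?subr0 ?sub0r ?dist_intN //.
all: by apply: le_trans (dist_int_le_norm 0) _; rewrite normr0 dist_int_ge0.
Qed.

(** Suppose that the average is smaller.  Take [k] symmetries with small
cross terms; by pigeonhole two different subset sums of the translates of [f]
agree up to [1 / (2 * c3)] modulo one.  Evaluate their difference at the point
that some translate in only one of the two subsets moves to [b0]: this translate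
contributes [f b0] up to sign and the others contribute less than
[1 / (2 * c3)] together. *)
Lemma small_average_small_everywhere (R : realType) (B : finType)
    (V : {vspace ratfun B}) (d : nat) (phi : 'I_d -> {ffun B -> int})
    (c2 c3 k : nat) (f : B -> R) (b0 : B) :
  (forall b1 b2 : B, exists s : {perm B}, is_symmetry V s /\ s b1 = b2) ->
  basis_of V (int_basis phi) -> (forall a b, (absz (phi a b) <= c2)%N) ->
  real_span V f -> (0 < c3)%N -> (0 < 2 * d * c2 * c3)%N ->
  ((2 * d * c2 * c3) ^ d < 2 ^ k)%N ->
  c3%:R^-1 <= dist_int (f b0) ->
  #|B|%:R <= 2 * c3%:R * k%:R ^+ 2 * \sum_b dist_int (f b).
Proof.
move=> trans bV phic fV c30 m0 mk fb0; set m := (2 * d * c2 * c3)%N in m0 mk.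
rewrite leNgt; apply/negP => small.
have [q [qG Hq]] := @spread_symmetries B V trans R (fun b => dist_int (f b)) b0 k
   (fun b => dist_int_ge0 (f b)).
set S0 := \sum_b dist_int (f b) in small Hq.
have B0 : 0 < #|B|%:R :> R by rewrite ltr0n; apply/card_gt0P; exists b0.
have c30' : 0 < c3%:R :> R by rewrite ltr0n.
set T := \sum_(j < k) _ in Hq.
have Tlt : T < (2 * c3%:R)^-1.
  rewrite -(ltr_pM2l B0); apply: le_lt_trans Hq _.
  by rewrite ltr_pdivlMr ?mulr_gt0 //; move: small; lra.
have cross0 j l : 0 <= cross_term (fun b => dist_int (f b)) b0 (q j) (q l).
  exact: dist_int_ge0.
have Tj (j : 'I_k) : \sum_(l < k | l != j)
     cross_term (fun b => dist_int (f b)) b0 (q j) (q l) < (2 * c3%:R)^-1.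
  apply: le_lt_trans Tlt; rewrite /T [leRHS](bigD1 j) //= lerDl.
  by apply: sumr_ge0 => i _; apply: sumr_ge0.
pose F (S : {set 'I_k}) b := \sum_(l in S) f (q l b).
have FV S : real_span V (F S).
  apply: (@real_span_sum R B V _ (mem S) (fun l b => f (q l b))) => l.
  by apply: real_span_comp => //; apply/symmetriesP.
have coordF S : {t : 'I_d -> R | forall b, F S b = \sum_a t a * (phi a b)%:~R}.
  apply: cid; have [t tE] := real_span_coord bV (FV S); exists t => b.
  rewrite tE; apply: eq_bigr => a _; rewrite tnth_mktuple ffunE.
  by rewrite ratr_int.
have [S [S' [SS' [z zP]]]] := @pigeonhole_coords R d k m (fun S => sval (coordF S)) m0 mk.
have close b : dist_int (F S b - F S' b) <= (2 * c3%:R)^-1.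
  have := dist_int_le (F S b - F S' b) (\sum_a z a * phi a b).
  move/le_trans; apply.
  rewrite (svalP (coordF S)) (svalP (coordF S')) -!sumrB rmorph_sum /= -sumrB.
  apply: le_trans (ler_norm_sum _ _ _) _.
  (* Each of the [d] coordinates contributes at most [c2 / m]. *)
  apply: (@le_trans _ _ (\sum_(a < d) m%:R^-1 * c2%:R)).
    apply: ler_sum => a _; rewrite rmorphM /= -!mulrBl normrM.
    apply: ler_pM => //; rewrite -intr_norm -abszE -pmulrn ler_nat //.
  rewrite sumr_const card_ord -mulr_natl /m !natrM.
  move: m0; rewrite /m !muln_gt0 => /andP[/andP[d0 c20] _].
  by rewrite le_eqVlt; apply/orP; left; apply/eqP; field; rewrite !pnatr_eq0 -!lt0n c30 c20 d0.
have [j jS] : exists j, (j \in S) != (j \in S').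
  apply/existsP; move: SS'; apply: contraR; rewrite negb_exists => /forallP H.
  by apply/eqP/setP => j; have := H j; rewrite negbK => /eqP.
set b := (q j)^-1%g b0.
have qb : q j b = b0 by rewrite /b permKV.
have Fdiff : F S b - F S' b = ((j \in S)%:R * f b0 - (j \in S')%:R * f b0) +
   \sum_(l < k | l != j) ((l \in S)%:R * f (q l b) - (l \in S')%:R * f (q l b)).
  have FE (U : {set 'I_k}) : F U b = \sum_l (l \in U)%:R * f (q l b).
    by rewrite /F big_mkcond; apply: eq_bigr => l _; case: (l \in U); rewrite ?mul1r ?mul0r.
  by rewrite !FE -sumrB (bigD1 j) //= qb.
have d1 : dist_int (f b0) <= dist_int ((j \in S)%:R * f b0 - (j \in S')%:R * f b0).
  move: jS; case: (j \in S); case: (j \in S') => // _; rewrite ?mul1r ?mul0r ?subr0 //.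
  by rewrite sub0r -{1}[f b0]opprK dist_intN.
have d2 : dist_int ((j \in S)%:R * f b0 - (j \in S')%:R * f b0) <=
   dist_int (F S b - F S' b) +
   \sum_(l < k | l != j) dist_int ((l \in S)%:R * f (q l b) - (l \in S')%:R * f (q l b)).
  move: Fdiff; set x := (_ * f b0 - _ * f b0); set y := \sum_(l < k | l != j) (_ - _).
  move=> Fdiff; have -> : x = (F S b - F S' b) - y by rewrite Fdiff addrK.
  by apply: le_trans (dist_intB _ _) _; rewrite lerD2l; apply: dist_int_sum.
have d3 : \sum_(l < k | l != j) dist_int ((l \in S)%:R * f (q l b) - (l \in S')%:R * f (q l b))
   <= \sum_(l < k | l != j) cross_term (fun b => dist_int (f b)) b0 (q j) (q l).
  by apply: ler_sum => l _; apply: dist_int_signed.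
have := Tj j; have := close b.
have -> : (2 * c3%:R)^-1 = c3%:R^-1 / 2 :> R by rewrite invfM mulrC.
by move: fb0 d1 d2 d3; lra.
Qed.

(** * Bases generating the integer lattice *)

Lemma int_norm_lt1 (y : int) : `|y| < 1 -> y = 0.
Proof. lia. Qed.

(** The values [psi(b)] generate [Z^d], expressed by producing the unit
vectors. *)
Definition primitive (B : finType) d (psi : 'I_d -> {ffun B -> int}) : Prop :=
  forall a, exists n : B -> int, forall a', \sum_b n b * psi a' b = (a == a')%:Z.

Definition comb (R : realType) (B : finType) d (psi : 'I_d -> {ffun B -> int})
  (t : 'rV[R]_d) (b : B) : R := \sum_a t 0 a * (psi a b)%:~R.

Definition int_gram (R : realType) (B : finType) d (psi : 'I_d -> {ffun B -> int}) :
  'M[R]_d := \matrix_(a, a') \sum_b (psi a b)%:~R * (psi a' b)%:~R.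

Lemma combD (R : realType) (B : finType) d (psi : 'I_d -> {ffun B -> int})
   (t u : 'rV[R]_d) b : comb psi (t + u) b = comb psi t b + comb psi u b.
Proof. by rewrite /comb -big_split; apply: eq_bigr => a _; rewrite mxE mulrDl. Qed.

Lemma combN (R : realType) (B : finType) d (psi : 'I_d -> {ffun B -> int})
   (t : 'rV[R]_d) b : comb psi (- t) b = - comb psi t b.
Proof. by rewrite /comb -sumrN; apply: eq_bigr => a _; rewrite mxE mulNr. Qed.

Lemma comb_int (R : realType) (B : finType) d (psi : 'I_d -> {ffun B -> int})
   (z : 'rV[int]_d) b : comb psi (map_mx intr z : 'rV[R]_d) b = (\sum_a z 0 a * psi a b)%:~R.
Proof.
by rewrite /comb rmorph_sum; apply: eq_bigr => a _; rewrite mxE rmorphM.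
Qed.

Lemma qform_int_gram (R : realType) (B : finType) d (psi : 'I_d -> {ffun B -> int})
   (t : 'rV[R]_d) : qform (int_gram R psi) t = \sum_b comb psi t b ^+ 2.
Proof.
rewrite /qform mxE.
under eq_bigr do rewrite mxE mulr_suml.
transitivity (\sum_a \sum_a' \sum_b
   (t 0 a' * (psi a' b)%:~R) * (t 0 a * (psi a b)%:~R)).
  apply: eq_bigr => a _; apply: eq_bigr => a' _.
  rewrite !mxE mulr_sumr mulr_suml; apply: eq_bigr => b _; ring.
under eq_bigr do rewrite exchange_big.
rewrite exchange_big; apply: eq_bigr => b _ /=.
rewrite expr2 {2}/comb mulr_sumr; apply: eq_bigr => a _.
by rewrite /comb mulr_suml.
Qed.

Lemma ratr_of_int (R : realType) (B : finType) (g : {ffun B -> int}) b :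
  ratr (ratfun_of_int g b : rat) = (g b)%:~R :> R.
Proof. by rewrite ffunE ratr_int. Qed.

Section Primitive.
Variables (R : realType) (B : finType) (d : nat) (psi : 'I_d -> {ffun B -> int}).
Hypothesis prim : primitive psi.

Lemma comb_primitive (t : 'rV[R]_d) a : exists n : B -> int,
  t 0 a = \sum_b comb psi t b * (n b)%:~R.
Proof.
have [n nP] := prim a; exists n.
under eq_bigr do rewrite /comb mulr_suml.
rewrite exchange_big /= (bigD1 a) //= [X in _ + X]big1 ?addr0 => [|a' a'a].
  have := nP a; rewrite eqxx => /(congr1 (fun z : int => z%:~R : R)).
  rewrite rmorph_sum /= => e; have {}e : \sum_b (n b * psi a b)%:~R = 1 :> R := e.
  transitivity (t 0 a * (\sum_b (n b * psi a b)%:~R)); first by rewrite e mulr1.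
  by rewrite mulr_sumr; apply: eq_bigr => b _; rewrite rmorphM /=; ring.
have := nP a'; rewrite eq_sym (negbTE a'a) => /(congr1 (fun z : int => z%:~R : R)).
rewrite rmorph_sum /= => e.
transitivity (t 0 a' * (\sum_b (n b * psi a' b)%:~R)); last by rewrite e mulr0.
by rewrite mulr_sumr; apply: eq_bigr => b _; rewrite rmorphM /=; ring.
Qed.

Lemma comb_inj0 (t : 'rV[R]_d) : (forall b, comb psi t b = 0) -> t = 0.
Proof.
move=> t0; apply/rowP => a; have [n ->] := comb_primitive t a.
by rewrite mxE big1 // => b _; rewrite t0 mul0r.
Qed.

Lemma posdef_int_gram : posdef (int_gram R psi).
Proof.
split=> [|t t0].
  apply/matrixP => a a'; rewrite !mxE; apply: eq_bigr => b _; exact: mulrC.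
rewrite qform_int_gram lt_neqAle eq_sym psumr_neq0 ?sumr_ge0 /=; last 2 first.
- by move=> b _; apply: sqr_ge0.
- by move=> b _; apply: sqr_ge0.
rewrite andbT; apply: contraR t0 => /hasPn H; apply/eqP/comb_inj0 => b.
have := H b (mem_index_enum b); rewrite /= -leNgt => h.
by apply/eqP; rewrite -sqrf_eq0 eq_le h sqr_ge0.
Qed.

(** Coordinates are integer combinations of values, since the value vectors
generate the lattice. *)
Lemma integral_comb (t : 'rV[R]_d) (n : B -> int) :
  (forall b, comb psi t b = (n b)%:~R) -> exists z : 'rV[int]_d, t = map_mx intr z.
Proof.
move=> tn.
have [m mP] := boolp.choice (comb_primitive t).
exists (\row_a \sum_b n b * m a b); apply/rowP => a; rewrite !mxE mP rmorph_sum.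
by apply: eq_bigr => b _; rewrite rmorphM tn.
Qed.

Variable V : {vspace ratfun B}.
Hypothesis bV : basis_of V (int_basis psi).

Lemma comb_real_span (t : 'rV[R]_d) : real_span V (comb psi t).
Proof.
apply: (@real_span_sum R B V 'I_d xpredT (fun a b => t 0 a * (psi a b)%:~R)) => a.
apply: (real_span_ext _ (@real_span_mem R B V (t 0 a) (ratfun_of_int (psi a)) _)).
  by move=> b; rewrite ffunE ratr_int.
apply: (basis_mem bV); apply/tnthP; exists a; by rewrite tnth_mktuple.
Qed.

Lemma real_span_comb f : real_span V f -> exists t : 'rV[R]_d, f =1 comb psi t.
Proof.
move=> /(real_span_coord bV)[t tE]; exists (\row_a t a) => b.
rewrite tE; apply: eq_bigr => a _; rewrite mxE tnth_mktuple ffunE.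
by rewrite ratr_int.
Qed.

(** A relation of l1-norm at most [c3] applied to the residues of [comb psi t]
modulo one gives an integer of absolute value below one, that is zero.  So the
nearest integers satisfy the relations defining [V], and they are the values at
a lattice point. *)
Lemma comb_near_lattice (c3 : nat) (t : 'rV[R]_d) :
  bounded_integer_basis (@l1_norm B) c3 (orthv V) -> (0 < c3)%N ->
  (forall b, dist_int (comb psi t b) < c3%:R^-1) ->
  exists z : 'rV[int]_d, forall b,
    `|comb psi (t - map_mx intr z) b| = dist_int (comb psi t b).
Proof.
move=> [s [sP sV]] c30 small; set f := comb psi t in small *.
have c30' : 0 < c3%:R :> R by rewrite ltr0n.
pose n : {ffun B -> int} := [ffun b => nearest_int (f b)].
have nV : ratfun_of_int n \in V.
  apply: orthv_orthv_sub => g; rewrite -sV => gs.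
  suff H h : h \in s -> dotf (ratfun_of_int n) (ratfun_of_int h) = 0.
    rewrite (coord_span (X := in_tuple _) gs).
    apply: (big_ind (fun g => dotf (ratfun_of_int n) g = 0)).
    - by rewrite /dotf big1 // => b _; rewrite [X in _ * X]ffunE mulr0.
    - by move=> x y hx hy; rewrite -[x]scale1r dotf_linear hx hy mulr0 addr0.
    move=> i _; rewrite -[_ *: _]addr0 dotf_linear.
    have -> : dotf (ratfun_of_int n) 0 = 0.
      by rewrite /dotf big1 // => b _; rewrite [X in _ * X]ffunE mulr0.
    have /mapP[h hs ->] : (in_tuple [seq ratfun_of_int g | g <- s])`_i \in
      [seq ratfun_of_int g | g <- s] by apply: mem_nth.
    by rewrite H // mulr0 addr0.
  move=> hs; have [hV hn] := sP h hs.
  have e0 := real_span_orth (comb_real_span t) hV.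
  have dE : dotf (ratfun_of_int n) (ratfun_of_int h) = (\sum_b n b * h b)%:~R.
    rewrite /dotf rmorph_sum; apply: eq_bigr => b _.
    by rewrite /ratfun_of_int !ffunE rmorphM.
  rewrite dE; suff -> : \sum_b n b * h b = 0 by [].
  have e1 : ((\sum_b n b * h b)%:~R : R) = - \sum_b (f b - (n b)%:~R) * (h b)%:~R.
    rewrite -sumrN rmorph_sum /=; apply/eqP; rewrite -subr_eq0 -sumrB.
    apply/eqP; rewrite -[RHS]e0; apply: eq_bigr => b _.
    by rewrite ratr_of_int rmorphM /= -/f; ring.
  have e2 : `|(\sum_b n b * h b)%:~R : R| < 1.
    rewrite e1 normrN; apply: le_lt_trans (ler_norm_sum _ _ _) _.
    have [/eqP h0|] := boolP (l1_norm h == 0%N).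
      rewrite big1 // => b _; move/eqP: h0; rewrite /l1_norm sum_nat_eq0.
      by move=> /forallP/(_ b); rewrite implyTb absz_eq0 => /eqP->; rewrite mulr0 normr0.
    rewrite -lt0n /l1_norm => l0.
    have [b0 hb0] : exists b0, h b0 != 0.
      apply/existsP; rewrite -negb_forall; apply: contraL l0 => /forallP hz.
      by rewrite lt0n negbK big1 // => b _; rewrite (eqP (hz b)).
    apply: (@lt_le_trans _ _ (\sum_b c3%:R^-1 * (absz (h b))%:R)).
      rewrite (bigD1 b0) //= [ltRHS](bigD1 b0) //=; apply: ltr_leD.
        rewrite normrM -intr_norm -abszE -pmulrn /n ffunE.
        by rewrite ltr_pM2r ?ltr0n ?absz_gt0 //; apply: small.
      apply: ler_sum => b _.
      rewrite normrM -intr_norm -abszE -pmulrn /n ffunE.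
      by rewrite ler_wpM2r ?ler0n //; apply: ltW; apply: small.
    rewrite -mulr_sumr -natr_sum mulrC ler_pdivrMr // mul1r ler_nat.
    exact: hn.
  move: e2; rewrite -intr_norm -[1]/(1%:~R) ltr_int.
  exact: int_norm_lt1.
have nspan : real_span V (fun b => (n b)%:~R : R).
  apply: (real_span_ext _ (@real_span_mem R B V 1 _ nV)) => b.
  by rewrite ratr_of_int mul1r.
have [u uE] := real_span_comb nspan.
have [z zE] : exists z : 'rV[int]_d, u = map_mx intr z.
  by apply: (@integral_comb u n) => b; rewrite -uE.
exists z => b; rewrite combD combN -zE -uE /n ffunE.
by [].
Qed.

End Primitive.

(** * The lattice normalisation, rho and Gram determinants *)

(** Express the values of any basis of [V] in a basis of the lattice that they
generate. *)
Lemma exists_primitive_basis (B : finType) (V : {vspace ratfun B}) :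
  exists psi : 'I_(\dim V) -> {ffun B -> int},
    primitive psi /\ basis_of V (int_basis psi).
Proof.
have bX := vbasisP V; have fX := basis_free bX.
have [M [uM LM]] := basis_eval_lattice fX.
set X := vbasis V in bX fX LM *.
have Nex b : exists n : 'rV[int]_(\dim V), basis_eval X b = map_mx intr n *m M.
  apply/int_span_rowE; rewrite -LM; exists (fun b' => (b' == b)%:Z).
  rewrite (bigD1 b) //= eqxx big1 ?addr0 // => b' /negbTE->.
  by rewrite mulr0z.
have [N NE] := boolp.choice Nex.
exists (fun a => [ffun b => N b 0 a]); split.
  move=> a; have : int_span (basis_eval X) (row a M).
    rewrite LM; apply/int_span_rowE; exists (delta_mx 0 a).
    by rewrite map_delta_mx rowE.
  move=> [m mE]; exists m => a'.
  have e : (delta_mx 0 a : 'rV[rat]_(\dim V)) = \sum_b map_mx intr (N b) *~ m b.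
    have := mE; rewrite rowE => /(congr1 (mulmxr (invmx M))) /=.
    rewrite mulmxK // => ->; rewrite mulmx_suml; apply: eq_bigr => b _.
    by rewrite NE -!scaler_int -scalemxAl mulmxK.
  have /rowP/(_ a') := e; rewrite summxE !mxE eqxx /= => e'.
  apply: (@intr_inj rat); rewrite rmorph_sum /= [RHS](_ : _ = (a' == a)%:R).
    rewrite e'; apply: eq_bigr => b _; rewrite ffunE rmorphM /=.
    by rewrite -scaler_int !mxE.
  by rewrite eq_sym; case: (a' == a).
rewrite basisEdim size_tuple leqnn andbT -{1}(span_basis bX).
apply/span_subvP => f /tnthP[a ->].
have -> : tnth X a = \sum_a' M a' a *: (ratfun_of_int [ffun b => N b 0 a']).
  apply/ffunP => b; have /rowP/(_ a) := NE b; rewrite !mxE => ->.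
  rewrite sum_ffunE; apply: eq_bigr => a' _.
  by rewrite !ffunE !mxE mulrC.
apply: memv_suml => a' _; apply/memvZ/memv_span/tnthP; exists a'.
by rewrite tnth_mktuple.
Qed.

Lemma map_gram (R : realType) (B : finType) d (psi : 'I_d -> {ffun B -> int}) :
  map_mx ratr (gram (int_basis psi)) = int_gram R psi.
Proof.
apply/matrixP => a a'; rewrite !mxE rmorph_sum; apply: eq_bigr => b _ /=.
by rewrite !mxE !tnth_mktuple rmorphM /= !ratr_of_int.
Qed.

(** The lattice generated by the values is [Z^d], of determinant one. *)
Lemma rho_primitive (R : realType) (B : finType) (V : {vspace ratfun B})
    (psi : 'I_(\dim V) -> {ffun B -> int}) :
  primitive psi -> basis_of V (int_basis psi) ->
  rho R V = (Num.sqrt (\det (int_gram R psi)))^-1.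
Proof.
move=> prim bV; rewrite -(rho_of_basis R bV) /rho_of -map_gram det_map_mx.
suff -> : lattice_det (int_span (basis_eval (int_basis psi))) = 1.
  by rewrite rmorph1 div1r.
have vE b : basis_eval (int_basis psi) b = map_mx intr (\row_a psi a b).
  by apply/rowP => a; rewrite !mxE tnth_mktuple ffunE.
rewrite (@lattice_det_basis _ _ 1%:M) ?det1 ?normr1 //; split; first exact: unitmx1.
apply/seteqP; split=> x.
  case=> n ->; apply/int_span_rowE; exists (\sum_b (\row_a psi a b) *~ n b).
  rewrite mulmx1; apply/rowP => a; rewrite summxE mxE summxE rmorph_sum /=.
  apply: eq_bigr => b _; rewrite vE -!scaler_int !mxE.
  by rewrite rmorphM /= intz.
case/int_span_rowE => z ->; rewrite mulmx1.
have [m mP] := boolp.choice prim.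
exists (fun b => \sum_a z 0 a * m a b).
apply/rowP => a; rewrite summxE !mxE.
transitivity ((\sum_b (\sum_a' z 0 a' * m a' b) * psi a b)%:~R : rat).
  congr (_%:~R); under eq_bigr do rewrite mulr_suml.
  rewrite exchange_big /= (bigD1 a) //= [X in _ + X]big1 ?addr0 => [|a' a'a].
    transitivity (z 0 a * \sum_b m a b * psi a b); first by rewrite mP eqxx mulr1.
    by rewrite mulr_sumr; apply: eq_bigr => b _; rewrite mulrA.
  transitivity (z 0 a' * \sum_b m a' b * psi a b).
    by rewrite mulr_sumr; apply: eq_bigr => b _; rewrite mulrA.
  by rewrite mP (negbTE a'a) mulr0.
rewrite rmorph_sum; apply: eq_bigr => b _ /=.
by rewrite vE -scaler_int !mxE rmorphM.
Qed.

Lemma posdef_diag (R : realType) d (Q : 'M[R]_d) i : posdef Q -> 0 < Q i i.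
Proof.
move=> [_ Qp]; have := Qp (delta_mx 0 i).
have -> : qform Q (delta_mx 0 i) = Q i i.
  by rewrite /qform trmx_delta -rowE -colE !mxE.
apply; apply/eqP => /matrixP/(_ 0 i); rewrite !mxE !eqxx => /eqP.
by rewrite oner_eq0.
Qed.

(** The determinant is the product of the successive pivots, and the diagonal
entries do not increase when passing to Schur complements. *)
Lemma hadamard (R : realType) d (Q : 'M[R]_d) : posdef Q -> \det Q <= \prod_i Q i i.
Proof.
elim: d Q => [|d IH]; first by move=> Q _; rewrite det_mx00 big_ord0.
change d.+1 with (1 + d)%N => Q Qp; rewrite big_split_ord /= big_ord1.
rewrite (@det_schur R d Q Qp).
have -> : Q (lshift d ord0) (lshift d ord0) = @pivot R d Q.
  by rewrite /pivot !mxE.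
rewrite ler_pM2l ?pivot_gt0 //; apply: le_trans (IH _ (posdef_schur Qp)) _.
apply: ler_prod => i _; rewrite (ltW (posdef_diag i (posdef_schur Qp))) /=.
rewrite /schur_complement !mxE big_ord1 !mxE gerBl mulr_ge0 ?invr_ge0 ?(ltW (pivot_gt0 Qp)) //.
by rewrite -expr2 sqr_ge0.
Qed.

(** The bounded basis [phi] is an integer, nonsingular combination of [psi],
so its Gram determinant is at least that of [psi]; Hadamard's inequality bounds
it from above. *)
Lemma det_int_gram_le (R : realType) (B : finType) (V : {vspace ratfun B}) d
    (psi phi : 'I_d -> {ffun B -> int}) (c : nat) :
  primitive psi -> basis_of V (int_basis psi) -> basis_of V (int_basis phi) ->
  (forall a b, (absz (phi a b) <= c)%N) ->
  \det (int_gram R psi) <= (#|B|%:R * c%:R ^+ 2) ^+ d.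
Proof.
move=> prim bpsi bphi phic.
have unitcomb (chi : 'I_d -> {ffun B -> int}) a b :
    comb chi (delta_mx 0 a : 'rV[R]_d) b = (chi a b)%:~R.
  rewrite /comb (bigD1 a) //= big1 ?addr0 ?mxE ?eqxx ?mul1r // => a' a'a.
  by rewrite mxE (negbTE a'a) andbF mul0r.
have Zex a : exists z : 'rV[int]_d, forall b,
    (phi a b)%:~R = comb psi (map_mx intr z : 'rV[R]_d) b.
  have := comb_real_span bphi (delta_mx 0 a : 'rV[R]_d).
  move=> /(real_span_comb bpsi)[t tE].
  have [z zE] := integral_comb prim (fun b => etrans (esym (tE b)) (unitcomb phi a b)).
  by exists z => b; rewrite -zE -tE unitcomb.
have [z zE] := boolp.choice Zex.
pose Z : 'M[int]_d := \matrix_(a, a') z a 0 a'.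
pose ZR : 'M[R]_d := map_mx intr Z.
have phipsi (t : 'rV[R]_d) b : comb phi t b = comb psi (t *m ZR) b.
  rewrite /comb; under [RHS]eq_bigr do rewrite mxE mulr_suml.
  rewrite exchange_big /=; apply: eq_bigr => a _.
  rewrite zE /comb mulr_sumr; apply: eq_bigr => a' _.
  by rewrite !mxE mulrA.
have Wex a : exists w : 'rV[R]_d, w *m ZR = delta_mx 0 a.
  have := comb_real_span bpsi (delta_mx 0 a : 'rV[R]_d).
  move=> /(real_span_comb bphi)[w wE]; exists w.
  apply/eqP; rewrite -subr_eq0; apply/eqP/(comb_inj0 prim) => b.
  by rewrite combD combN -phipsi -wE subrr.
have [w wE] := boolp.choice Wex.
(* The integer matrix [Z] that expresses [phi] in [psi] is invertible over the
   reals, so its determinant is a nonzero integer. *)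
have WZ : (\matrix_a w a) *m ZR = 1%:M.
  by apply/row_matrixP => a; rewrite row_mul rowK wE row1.
have uZ : ZR \in unitmx by have /mulmx1_unit[] := WZ.
have gramE : int_gram R phi = ZR *m int_gram R psi *m ZR^T.
  have ge (chi : 'I_d -> {ffun B -> int}) :
     int_gram R chi = \sum_b (\row_a (chi a b)%:~R)^T *m (\row_a (chi a b)%:~R).
    apply/matrixP => a a'; rewrite summxE !mxE; apply: eq_bigr => b _.
    by rewrite !mxE big_ord1 !mxE.
  rewrite !ge mulmx_sumr mulmx_suml; apply: eq_bigr => b _.
  have -> : \row_a (phi a b)%:~R = \row_a (psi a b)%:~R *m ZR^T :> 'rV[R]_d.
    apply/rowP => a; rewrite !mxE zE; apply: eq_bigr => a' _.
    by rewrite !mxE mulrC.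
  by rewrite trmx_mul trmxK !mulmxA.
have pphi : posdef (int_gram R phi).
  have [ps pp] := posdef_int_gram R prim; split.
    apply/matrixP => a a'; rewrite !mxE; apply: eq_bigr => b _; exact: mulrC.
  move=> t t0; rewrite qform_int_gram.
  under eq_bigr do rewrite phipsi.
  rewrite -qform_int_gram; apply: pp; apply: contra_neq t0 => tZ.
  by rewrite -[t](mulmxK uZ) tZ mul0mx.
have Z1 : 1 <= (\det ZR) ^+ 2.
  have dz : \det Z != 0.
    by move: uZ; rewrite unitmxE /ZR det_map_mx unitfE intr_eq0.
  rewrite /ZR det_map_mx -[_ ^+ 2]real_normK ?num_real //.
  rewrite exprn_ege1 // -intr_norm -[1]/(1%:~R) ler_int.
  by rewrite -gtz0_ge1 normr_gt0.
have psi0 := posdef_det_gt0 (posdef_int_gram R prim).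
apply: (@le_trans _ _ (\det (int_gram R phi))).
  rewrite gramE !det_mulmx det_tr mulrAC -expr2 -[leLHS]mul1r.
  by rewrite ler_pM2r.
apply: le_trans (hadamard pphi) _.
rewrite -[d in leRHS]card_ord -prodr_const; apply: ler_prod => a _.
rewrite (ltW (posdef_diag a pphi)) /= mxE.
apply: (@le_trans _ _ (\sum_(b : B) c%:R ^+ 2)); last by rewrite sumr_const mulr_natl.
apply: ler_sum => b _; rewrite -expr2 -[_ ^+ 2]real_normK ?num_real //.
by rewrite ler_pXn2r ?nnegrE // -intr_norm -abszE -pmulrn ler_nat.
Qed.

(** * Leverage scores *)

Lemma cauchy_schwarz (R : realType) (B : finType) (k f : B -> R) :
  (\sum_b k b * f b) ^+ 2 <= (\sum_b k b ^+ 2) * (\sum_b f b ^+ 2).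
Proof.
set K := \sum_b k b ^+ 2; set F := \sum_b f b ^+ 2; set s := \sum_b _.
have K0 : 0 <= K by apply: sumr_ge0 => b _; apply: sqr_ge0.
have E : \sum_b (K * f b - s * k b) ^+ 2 = K * (K * F - s ^+ 2).
  transitivity (\sum_b (K ^+ 2 * f b ^+ 2 - (2 * K * s) * (k b * f b) + s ^+ 2 * k b ^+ 2)).
    by apply: eq_bigr => b _; ring.
  by rewrite big_split sumrB /= -!mulr_sumr -/K -/F -/s; ring.
have [K1|] := ltP 0 K.
  rewrite -subr_ge0 -(pmulr_rge0 _ K1) -E.
  by apply: sumr_ge0 => b _; apply: sqr_ge0.
move=> K00; have KE : K = 0 by apply/eqP; rewrite eq_le K0 K00.
have k0 b : k b = 0.
  move/eqP: KE; rewrite psumr_eq0 => [/allP/(_ b (mem_index_enum b))|b' _]; last exact: sqr_ge0.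
  by rewrite sqrf_eq0 => /eqP.
by rewrite KE mul0r /s big1 ?expr0n // => b _; rewrite k0 mul0r.
Qed.

Section Sup.
Variables (R : realType) (B : finType) (V : {vspace ratfun B}) (d : nat).
Variable psi : 'I_d -> {ffun B -> int}.
Hypothesis prim : primitive psi.
Hypothesis bV : basis_of V (int_basis psi).
Hypothesis trans : forall b1 b2 : B, exists s : {perm B}, is_symmetry V s /\ s b1 = b2.

Let G := int_gram R psi.
Let ev (b : B) : 'rV[R]_d := \row_a (psi a b)%:~R.

Let GE : G = \sum_b (ev b)^T *m ev b.
Proof.
apply/matrixP => a a'; rewrite summxE !mxE; apply: eq_bigr => b _.
by rewrite !mxE big_ord1 !mxE.
Qed.

Let uG : G \in unitmx.
Proof. by rewrite unitmxE unitfE gt_eqF // posdef_det_gt0 //; apply: posdef_int_gram. Qed.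

Let Gs : G^T = G. Proof. by have [] := posdef_int_gram R prim. Qed.

Let combE (t : 'rV[R]_d) b : comb psi t b = (t *m (ev b)^T) 0 0.
Proof. by rewrite mxE; apply: eq_bigr => a _; rewrite !mxE. Qed.

Let combE' (t : 'rV[R]_d) b : comb psi t b = (ev b *m t^T) 0 0.
Proof. by rewrite mxE; apply: eq_bigr => a _; rewrite !mxE mulrC. Qed.

(** The squared norm of evaluation at [b] on the span, for the l2 norm on
functions. *)
Definition leverage (b : B) : R := (ev b *m invmx G *m (ev b)^T) 0 0.

Lemma comb_leverage (t : 'rV[R]_d) b :
  comb psi t b ^+ 2 <= leverage b * \sum_b' comb psi t b' ^+ 2.
Proof.
have e (u v : 'rV[R]_d) :
    \sum_b' comb psi u b' * comb psi v b' = (u *m G *m v^T) 0 0.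
  rewrite GE mulmx_sumr mulmx_suml summxE; apply: eq_bigr => b' _.
  rewrite mulmxA -mulmxA [RHS]mxE big_ord1.
  by rewrite combE combE'.
pose k := ev b *m invmx G.
have -> : comb psi t b = \sum_b' comb psi k b' * comb psi t b'.
  by rewrite e /k mulmxKV // combE'.
have -> : leverage b = \sum_b' comb psi k b' ^+ 2.
  transitivity (\sum_b' comb psi k b' * comb psi k b'); last by apply: eq_bigr => *; rewrite expr2.
  by rewrite e /k mulmxKV // /leverage trmx_mul trmx_inv Gs mulmxA.
exact: cauchy_schwarz.
Qed.

Lemma leverage_symmetry (s : {perm B}) b : is_symmetry V s -> leverage (s b) = leverage b.
Proof.
move=> hs.
have Pex a : exists u : 'rV[R]_d, forall b, (psi a (s b))%:~R = comb psi u b.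
  have /(real_span_comb bV)[u uE] := real_span_comp hs (comb_real_span bV (delta_mx 0 a : 'rV[R]_d)).
  exists u => b'; rewrite -uE /= /comb (bigD1 a) //= big1 ?addr0 ?mxE ?eqxx ?mul1r // => a' a'a.
  by rewrite mxE (negbTE a'a) andbF mul0r.
have [u uE] := boolp.choice Pex.
pose P : 'M[R]_d := \matrix_a u a.
have evs b' : ev (s b') = ev b' *m P^T.
  apply/rowP => a; rewrite !mxE uE; apply: eq_bigr => a' _.
  by rewrite !mxE mulrC.
have GP : G = P *m G *m P^T.
  rewrite {2}GE mulmx_sumr mulmx_suml GE [LHS](reindex_inj (@perm_inj _ s)) /=.
  by apply: eq_bigr => b' _; rewrite evs trmx_mul trmxK !mulmxA.
have uP : P \in unitmx.
  by move: uG; rewrite {1}GP !unitmx_mul => /andP[/andP[]].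
have uPT : P^T \in unitmx by rewrite unitmx_tr.
rewrite /leverage evs trmx_mul trmxK; congr (_ 0 0).
have PG : P *m G = G *m invmx P^T by rewrite {2}GP mulmxK.
rewrite -!mulmxA; congr (_ *m _); rewrite !mulmxA; congr (_ *m _).
rewrite -[LHS](mulmxK uG) -!(mulmxA P^T) -(mulmxA (invmx G)) PG. rewrite mulKmx // mulmxA.
by rewrite mulmxV // mul1mx.
Qed.

(** Symmetries preserve the l2 norm and move evaluations to each other, so by
transitivity all scores are equal; their sum is the trace of a projection. *)
Lemma leverage_const b : #|B|%:R * leverage b = d%:R.
Proof.
transitivity (\sum_b' leverage b').
  rewrite mulr_natl -sumr_const; apply: eq_bigr => b' _.
  by have [s [hs <-]] := trans b b'; rewrite leverage_symmetry.
have tr b' : leverage b' = \tr (invmx G *m ((ev b')^T *m ev b')).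
  by rewrite mulmxA mxtrace_mulC mulmxA /mxtrace big_ord1.
under eq_bigr do rewrite tr.
by rewrite -raddf_sum -mulmx_sumr -GE mulVmx //= mxtrace1.
Qed.

Lemma comb_sup (t : 'rV[R]_d) b :
  #|B|%:R * comb psi t b ^+ 2 <= d%:R * \sum_b' comb psi t b' ^+ 2.
Proof.
by rewrite -(leverage_const b) -mulrA ler_wpM2l ?ler0n // comb_leverage.
Qed.

End Sup.

(** * Fourier inversion on torsion points *)

Local Open Scope complex_scope.

Lemma sum_cis_roots (R : realType) (q : nat) (D : int) : (absz D < q)%N ->
  \sum_(i < q) cis (2 * pi * ((i%:R / q%:R) * D%:~R) : R) = (if D == 0 then q%:R else 0)%:C.
Proof.
move=> Dq; have q0 : 0 < q%:R :> R by rewrite ltr0n (leq_ltn_trans _ Dq).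
have [->|D0] := eqVneq D 0.
  under eq_bigr do rewrite !mulr0 cis0.
  by rewrite sumr_const card_ord rmorph_nat.
set om := cis (2 * pi * (D%:~R / q%:R) : R).
have omi (i : nat) : cis (2 * pi * ((i%:R / q%:R) * D%:~R) : R) = om ^+ i.
  rewrite /om -cis_mulrn; congr cis; rewrite -[RHS]mulr_natl.
  by field; rewrite gt_eqF.
under eq_bigr do rewrite omi.
have om1 : om != 1.
  have pos (E : int) : 0 < E -> (absz E < q)%N -> cis (2 * pi * (E%:~R / q%:R) : R) != 1.
    move=> E0 Eq; apply: cis_neq1; have pi0 := @pi_gt0 R.
    have y0 : 0 < E%:~R / q%:R :> R by rewrite divr_gt0 ?ltr0z.
    have y1 : E%:~R / q%:R < 1 :> R.
      by rewrite ltr_pdivrMr // mul1r pmulrn ltr_int; lia.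
    by apply/andP; split; nra.
  have [Dpos|Dneg] := ltP 0 D; first exact: pos.
  apply: contra_neq (pos (- D) _ _); [| by rewrite oppr_gt0; lia |by rewrite abszN].
  move=> omE; have := cisD (2 * pi * (D%:~R / q%:R)) (2 * pi * ((- D)%:~R / q%:R) : R).
  by rewrite -/om omE mul1r => <-; rewrite rmorphN /= mulNr mulrN addrN cis0.
have : (om - 1) * \sum_(i < q) om ^+ i = 0.
  rewrite -subrX1 -omi (_ : 2 * pi * _ = 2 * pi * D%:~R); last by field; rewrite gt_eqF.
  by rewrite cis2pi_int subrr.
by move/eqP; rewrite mulf_eq0 subr_eq0 (negbTE om1) => /eqP.
Qed.

Section Fourier.
Variables (R : realType) (B : finType) (V : {vspace ratfun B}) (d : nat).
Variable psi : 'I_d -> {ffun B -> int}.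
Hypothesis bV : basis_of V (int_basis psi).
Variables (N : nat) (g : {ffun B -> int}).
Hypothesis gP : forall f : ratfun B, f \in V ->
    \sum_(b : B) (g b)%:~R * (f b : rat)
      = N%:~R / #|B|%:R * \sum_(b : B) (f b : rat).
Hypothesis const : forall a : rat, [ffun=> a] \in V.
Hypothesis N0 : (0 < N)%N.
Hypothesis NB : (N < #|B|)%N.

Let p : R := N%:R / #|B|%:R.

(** The characteristic function of the sum of [psi(b)] over a random set,
centred at its mean, at the frequency [2 * pi * t]. *)
Definition char_fun (t : 'rV[R]_d) : R[i] := \prod_b bernoulli_cf p (2 * pi * comb psi t b).

(** Divisibility provides [g] that makes the mean an integer vector. *)
Definition target (a : 'I_d) : int := \sum_b g b * psi a b.
Definition deviation (T : {set B}) (a : 'I_d) : int := \sum_(b in T) psi a b - target a.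

Let psiV a : ratfun_of_int (psi a) \in V.
Proof. by apply: (basis_mem bV); apply/tnthP; exists a; rewrite tnth_mktuple. Qed.

Let nthE (a : 'I_d) : (int_basis psi)`_a = ratfun_of_int (psi a).
Proof. by rewrite -(tnth_nth 0 (int_basis psi) a) tnth_mktuple. Qed.

Let B0 : #|B|%:R != 0 :> R.
Proof. by rewrite pnatr_eq0 -lt0n (leq_ltn_trans _ NB). Qed.

Let B0q : #|B|%:R != 0 :> rat.
Proof. by rewrite pnatr_eq0 -lt0n (leq_ltn_trans _ NB). Qed.

Lemma target_mean a : (target a)%:~R = p * \sum_b (psi a b)%:~R.
Proof.
have := congr1 (ratr : rat -> R) (gP (psiV a)).
rewrite rmorph_sum /= rmorphM /= fmorph_div /= rmorph_sum /= !ratr_nat => e.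
transitivity (\sum_b ratr ((g b)%:~R * (ratfun_of_int (psi a) b : rat)) : R).
  rewrite /target rmorph_sum; apply: eq_bigr => b _ /=.
  by rewrite !rmorphM /= ratr_of_int ratr_int.
by rewrite e; congr (_ * _); apply: eq_bigr => b _; rewrite ratr_of_int.
Qed.

(** The constants belong to the span, so the equality of sums fixes the size
of [T]. *)
Lemma deviation0 (T : {set B}) :
  [forall a, deviation T a == 0] = (#|T| == N) && `[< same_average V T >].
Proof.
apply/forallP/andP.
  move=> D0; have TV f : f \in V -> \sum_(b in T) (f b : rat) =
      N%:R / #|B|%:R * \sum_b (f b : rat).
    move=> fV; rewrite -gP // (coord_basis bV fV).
    under eq_bigr do rewrite sum_ffunE.
    under [RHS]eq_bigr do rewrite sum_ffunE mulr_sumr.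
    rewrite exchange_big [RHS]exchange_big; apply: eq_bigr => a _ /=.
    have := D0 a; rewrite subr_eq0 => /eqP/(congr1 (fun z : int => z%:~R : rat)).
    rewrite /target !rmorph_sum /= => e.
    transitivity (coord (int_basis psi) a f * \sum_(b in T) (psi a b)%:~R).
      rewrite mulr_sumr; apply: eq_bigr => b _.
      by rewrite nthE !ffunE.
    rewrite e mulr_sumr; apply: eq_bigr => b _.
    by rewrite nthE !ffunE rmorphM /= mulrCA.
  have TN : #|T| = N.
    have := TV _ (const 1).
    under eq_bigr do rewrite ffunE.
    under [X in _ * X]eq_bigr do rewrite ffunE.
    rewrite !sumr_const divfK // => /eqP; rewrite eqr_nat => /eqP //.
  split; first exact/eqP.
  apply/asboolP => f fV; rewrite TV // TN mulrA mulrA mulVf ?mul1r //.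
  by rewrite pnatr_eq0 -lt0n.
move=> [/eqP TN /asboolP TV] a; rewrite subr_eq0; apply/eqP.
apply: (@intr_inj rat); rewrite /target !rmorph_sum /=.
have := gP (psiV a); have := TV _ (psiV a); rewrite TN => e1 e2.
have e3 : \sum_(b in T) (ratfun_of_int (psi a) b : rat) =
    N%:R / #|B|%:R * \sum_b (ratfun_of_int (psi a) b : rat).
  by rewrite -mulrA -e1 mulVKf // pnatr_eq0 -lt0n.
transitivity (\sum_(b in T) (ratfun_of_int (psi a) b : rat)).
  by apply: eq_bigr => b _; rewrite ffunE.
rewrite e3 -e2; apply: eq_bigr => b _.
by rewrite /ratfun_of_int ffunE rmorphM.
Qed.

Lemma char_fun_expand t : char_fun t = \sum_(T : {set B})
   (p ^+ #|T| * (1 - p) ^+ (#|B| - #|T|))%:C *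
   cis (2 * pi * \sum_a t 0 a * (deviation T a)%:~R).
Proof.
have cfE x : bernoulli_cf p x = cis (- (p * x)) * (p%:C * cis x + (1 - p)%:C).
  rewrite /bernoulli_cf (_ : (1 - p) * x = - (p * x) + x); last by ring.
  by rewrite cisD; ring.
rewrite /char_fun; under eq_bigr do rewrite cfE.
rewrite big_split -cis_sum bigA_distr /= mulr_sumr; apply: eq_bigr => T _.
have -> : \prod_b (if b \in T then p%:C * cis (2 * pi * comb psi t b) else (1 - p)%:C) =
   (p ^+ #|T| * (1 - p) ^+ (#|B| - #|T|))%:C * cis (\sum_(b in T) 2 * pi * comb psi t b).
  rewrite (bigID (mem T)) /= (eq_bigr (fun b => p%:C * cis (2 * pi * comb psi t b))); last first.
    by move=> b ->.
  rewrite (eq_bigr (F1 := fun b => if b \in T then _ else _) (fun b => (1 - p)%:C)); last first.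
    by move=> b /negbTE->.
  rewrite big_split /= -cis_sum !prodr_const.
  have -> : (p ^+ #|T| * (1 - p) ^+ (#|B| - #|T|))%:C =
     p%:C ^+ #|T| * (1 - p)%:C ^+ (#|B| - #|T|) by rewrite -!rmorphXn -rmorphM.
  have -> : #|[pred b | b \notin T]| = (#|B| - #|T|)%N.
    by rewrite -[#|B|](cardsC T) addKn; apply: eq_card => b; rewrite !inE.
  by ring.
rewrite mulrCA -cisD; congr (_ * cis _).
rewrite sumrN -!mulr_sumr.
have -> : \sum_a t 0 a * (deviation T a)%:~R =
  \sum_(b in T) comb psi t b - p * \sum_b comb psi t b :> R.
  rewrite /comb exchange_big [X in _ = _ - p * X]exchange_big /= mulr_sumr -sumrB.
  apply: eq_bigr => a _; rewrite -!mulr_sumr /deviation rmorphB /= rmorph_sum /= target_mean.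
  by ring.
by ring.
Qed.

(** On the [q]-torsion points the characters separate [0] from the other
deviations as soon as [q] exceeds all deviations. *)
Lemma fourier_count q : (forall T a, (absz (deviation T a) < q)%N) ->
  \sum_(j : {ffun 'I_d -> 'I_q}) char_fun (grid q%:R^-1 (\row_a (j a)%:Z)) =
   (q%:R ^+ d * ((design_count V N)%:R * (p ^+ N * (1 - p) ^+ (#|B| - N))))%:C.
Proof.
move=> Dq; under eq_bigr do rewrite char_fun_expand.
rewrite exchange_big /=.
have inner T : \sum_(j : {ffun 'I_d -> 'I_q})
    cis (2 * pi * \sum_a grid (q%:R^-1 : R) (\row_a (j a)%:Z) 0 a * (deviation T a)%:~R)
    = (if (#|T| == N) && `[< same_average V T >] then q%:R ^+ d else 0)%:C.
  rewrite -deviation0.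
  transitivity (\prod_(a < d) \sum_(i < q) cis (2 * pi * ((i%:R / q%:R) * (deviation T a)%:~R) : R)).
    rewrite bigA_distr_bigA /=; apply: eq_bigr => j _.
    rewrite mulr_sumr cis_sum; apply: eq_bigr => a _.
    by rewrite !mxE.
  under eq_bigr do rewrite sum_cis_roots //.
  rewrite -rmorph_prod /=; congr (_%:C).
  case: forallP => D0.
    rewrite (eq_bigr (fun=> q%:R)) ?prodr_const ?card_ord // => a _.
    by rewrite D0.
  have /existsP[a Da] : [exists a, deviation T a != 0].
    by rewrite -negb_forall; apply/forallP.
  by rewrite (bigD1 a) //= (negbTE Da) mul0r.
under eq_bigr do rewrite -mulr_sumr inner -rmorphM /=.
rewrite -rmorph_sum /=; congr (_%:C).
rewrite /design_count -[#|[set T : {set B} | _]|]sum1_card natr_sum mulr_suml mulr_sumr [RHS]big_mkcond /=.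
apply: eq_bigr => T _; rewrite inE.
by case: eqP => [->|_] /=; rewrite ?mulr0 //; case: asboolP => _; rewrite ?mulr0 // mul1r mulrC.
Qed.

(** The deviations are integers, thanks to divisibility. *)
Lemma char_fun_periodic t (z : 'rV[int]_d) : char_fun (t - map_mx intr z) = char_fun t.
Proof.
rewrite !char_fun_expand; apply: eq_bigr => T _; congr (_ * _).
have -> : 2 * pi * \sum_a (t - map_mx intr z) 0 a * (deviation T a)%:~R =
   2 * pi * (\sum_a t 0 a * (deviation T a)%:~R) +
   2 * pi * (- \sum_a z 0 a * deviation T a)%:~R.
  rewrite rmorphN rmorph_sum /= -mulrDr -sumrB; congr (_ * _).
  by apply: eq_bigr => a _; rewrite !mxE rmorphM /= mulrBl.
by rewrite cisD cis2pi_int mulr1.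
Qed.

End Fourier.

(** * The characteristic function near and far from the lattice *)

Lemma qformZ (R : realType) d (a : R) (Q : 'M[R]_d) t : qform (a *: Q) t = a * qform Q t.
Proof. by rewrite /qform -scalemxAr -scalemxAl mxE. Qed.

Lemma posdefZ (R : realType) d (a : R) (Q : 'M[R]_d) : 0 < a -> posdef Q -> posdef (a *: Q).
Proof.
move=> a0 [Qs Qp]; split; first by rewrite linearZ /= Qs.
by move=> x x0; rewrite qformZ mulr_gt0 // Qp.
Qed.

(** Stated as an inequality, so that [a] to the power [- d / 2] need only be
bounded. *)
Lemma gauss_massZ (R : realType) d (a c : R) (Q : 'M[R]_d) : 0 < a -> posdef Q ->
  0 <= c -> 1 <= c ^+ 2 * a ^+ d -> gauss_mass (a *: Q) <= c * gauss_mass Q.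
Proof.
move=> a0 Qp c0 ca; have D0 := posdef_det_gt0 Qp.
rewrite /gauss_mass detZ -{1}(ger0_norm c0) -sqrtr_sqr -sqrtrM ?sqr_ge0 //.
apply: ler_wsqrtr; have ad : 0 < a ^+ d by rewrite exprn_gt0.
rewrite ler_pdivrMr ?mulr_gt0 //.
have -> : c ^+ 2 * ((2 * pi) ^+ d / \det Q) * (a ^+ d * \det Q) =
   (2 * pi) ^+ d * (c ^+ 2 * a ^+ d) by field; rewrite gt_eqF.
by rewrite ler_peMr // exprn_ge0 // mulr_ge0 // pi_ge0.
Qed.

Lemma cos_2pi_shift (R : realType) (x : R) (z : int) :
  cos (2 * pi * x) = cos (2 * pi * (x - z%:~R)).
Proof.
have := cisD (2 * pi * (x - z%:~R)) (2 * pi * z%:~R).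
rewrite cis2pi_int mulr1 -mulrDr subrK.
by case.
Qed.

Lemma normc_bernoulli_cf_dist (R : realType) (p x : R) : 0 <= p <= 1 ->
  normc (bernoulli_cf p (2 * pi * x)) <=
    expR (- (p * (1 - p) * (2 * pi * dist_int x) ^+ 2 / 18)).
Proof.
move=> p01; apply: le_trans (normc_bernoulli_cf _ _) _.
rewrite ler_expR lerN2 (cos_2pi_shift x (nearest_int x)) -mulrA.
rewrite ler_wpM2l ?bernoulli_variance_ge0 //.
have -> : (2 * pi * dist_int x) ^+ 2 = (2 * pi * (x - (nearest_int x)%:~R)) ^+ 2.
  by rewrite !exprMn /dist_int real_normK ?num_real.
apply: one_sub_cos_ge; rewrite !normrM (ger0_norm (ler0n _ _)) (ger0_norm (pi_ge0 _)).
have : `|x - (nearest_int x)%:~R| <= 2^-1.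
  by have := nearest_int_itv x; rewrite ler_norml; lra.
have := @pi_gt0 R; nra.
Qed.

Section NearFar.
Variables (R : realType) (B : finType) (V : {vspace ratfun B}) (d : nat).
Variable psi : 'I_d -> {ffun B -> int}.
Hypothesis prim : primitive psi.
Hypothesis bV : basis_of V (int_basis psi).
Hypothesis trans : forall b1 b2 : B, exists s : {perm B}, is_symmetry V s /\ s b1 = b2.
Variable N : nat.
Let p : R := N%:R / #|B|%:R.
Hypothesis p01 : 0 < p < 1.

Definition size_variance : R := p * (1 - p) * #|B|%:R.
(** The quadratic form of the variance of the phase at frequency
[2 * pi * t]. *)
Definition phase_covariance : 'M[R]_d := (p * (1 - p) * (2 * pi) ^+ 2) *: int_gram R psi.

Let w0 : 0 < p * (1 - p). Proof. by case/andP: p01 => p0 p1; rewrite mulr_gt0 // subr_gt0. Qed.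

Let p01' : 0 <= p <= 1. Proof. by case/andP: p01 => p0 p1; rewrite !ltW. Qed.

Lemma posdef_phase_covariance : posdef phase_covariance.
Proof.
apply: posdefZ; last exact: posdef_int_gram.
by rewrite mulr_gt0 // exprn_gt0 // mulr_gt0 // pi_gt0.
Qed.

Lemma qform_phase_covariance t :
  qform phase_covariance t = p * (1 - p) * \sum_b (2 * pi * comb psi t b) ^+ 2.
Proof.
rewrite qformZ qform_int_gram -mulrA mulr_sumr; congr (_ * _).
by apply: eq_bigr => b _; rewrite [in RHS]exprMn.
Qed.

Lemma qform_phase_covariance_ge0 t : 0 <= qform phase_covariance t.
Proof.
rewrite qform_phase_covariance; apply: mulr_ge0; first exact: ltW.
by apply: sumr_ge0 => b _; apply: sqr_ge0.
Qed.

Lemma normc_char_fun_dist (t : 'rV[R]_d) :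
  normc (char_fun psi N t) <=
  expR (- (p * (1 - p) * (\sum_b (2 * pi * dist_int (comb psi t b)) ^+ 2) / 18)).
Proof.
have -> : - (p * (1 - p) * (\sum_b (2 * pi * dist_int (comb psi t b)) ^+ 2) / 18) =
   \sum_b - (p * (1 - p) * (2 * pi * dist_int (comb psi t b)) ^+ 2 / 18).
  by rewrite sumrN -mulr_suml -mulr_sumr.
rewrite expR_sum /char_fun normc_prod; apply: ler_prod => b _.
rewrite normc_bernoulli_cf_dist // andbT.
by case: (bernoulli_cf _ _) => x y; apply: sqrtr_ge0.
Qed.

(** The far alternative uses Cauchy-Schwarz to pass from the average distance
to the average squared distance. *)
Lemma char_fun_far (c2 c3 k : nat) (phi : 'I_d -> {ffun B -> int}) (T : R) t :
  basis_of V (int_basis phi) -> (forall a b, (absz (phi a b) <= c2)%N) ->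
  bounded_integer_basis (@l1_norm B) c3 (orthv V) ->
  (0 < c3)%N -> (0 < 2 * d * c2 * c3)%N -> ((2 * d * c2 * c3) ^ d < 2 ^ k)%N ->
  T * c3%:R ^+ 2 * k%:R ^+ 4 <= 4 * size_variance ->
  (exists z : 'rV[int]_d, qform phase_covariance (t - map_mx intr z) <= T) \/
  normc (char_fun psi N t) <= expR (- (T / 18)).
Proof.
move=> bphi phic c3b c30 m0 mk TM.
set S := \sum_b (2 * pi * dist_int (comb psi t b)) ^+ 2.
have far : T <= p * (1 - p) * S -> normc (char_fun psi N t) <= expR (- (T / 18)).
  move=> TS; apply: le_trans (normc_char_fun_dist t) _.
  by rewrite ler_expR lerN2 ler_pM2r ?invr_gt0.
have [|/existsP[b0]] := boolP [forall b, dist_int (comb psi t b) < c3%:R^-1].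
  move=> /forallP small.
  have [z zP] := comb_near_lattice prim bV c3b c30 small.
  have SE : qform phase_covariance (t - map_mx intr z) = p * (1 - p) * S.
    rewrite qform_phase_covariance; congr (_ * _); apply: eq_bigr => b _.
    by rewrite !exprMn -zP real_normK ?num_real.
  have [h|h] := leP (qform phase_covariance (t - map_mx intr z)) T; first by left; exists z.
  by right; apply: far; rewrite -SE ltW.
rewrite -leNgt => big; right; apply: far.
have := @small_average_small_everywhere R B V d phi c2 c3 k (comb psi t) b0 trans bphi
  phic (comb_real_span bV t) c30 m0 mk big.
set S1 := \sum_b _ => h1.
have h2 : S1 ^+ 2 <= #|B|%:R * \sum_b dist_int (comb psi t b) ^+ 2.
  have := @cauchy_schwarz R B (fun=> 1) (fun b => dist_int (comb psi t b)).
  rewrite (eq_bigr (fun b => dist_int (comb psi t b))) => [|b _]; last by rewrite mul1r.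
  by rewrite expr1n sumr_const.
set S2 := \sum_b _ ^+ 2 in h2.
have SE : S = (2 * pi) ^+ 2 * S2.
  by rewrite /S mulr_sumr; apply: eq_bigr => b _; rewrite exprMn.
have Bpos : 0 < #|B|%:R :> R by rewrite ltr0n; apply/card_gt0P; exists b0.
have S20 : 0 <= S2 by apply: sumr_ge0 => b _; apply: sqr_ge0.
have S10 : 0 <= S1 by apply: sumr_ge0 => b _; apply: dist_int_ge0.
have c30' : 0 < c3%:R :> R by rewrite ltr0n.
have k2 : 0 <= k%:R ^+ 2 :> R by apply: sqr_ge0.
have h3 : #|B|%:R <= 4 * c3%:R ^+ 2 * k%:R ^+ 4 * S2.
  have : #|B|%:R ^+ 2 <= (2 * c3%:R * k%:R ^+ 2 * S1) ^+ 2 :> R.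
    by rewrite ler_pXn2r ?nnegrE // !mulr_ge0.
  have -> : (2 * c3%:R * k%:R ^+ 2 * S1) ^+ 2 = 4 * c3%:R ^+ 2 * k%:R ^+ 4 * S1 ^+ 2 :> R by ring.
  move=> h; rewrite -(ler_pM2l Bpos) -expr2; apply: le_trans h _.
  by rewrite [leRHS]mulrCA ler_wpM2l // !mulr_ge0 ?exprn_ge0.
have kc0 : 0 < c3%:R ^+ 2 * k%:R ^+ 4 :> R.
  rewrite mulr_gt0 ?exprn_gt0 // ltr0n lt0n; apply: contraL mk => /eqP->.
  by rewrite -leqNgt expn0 expn_gt0 m0.
rewrite SE -(ler_pM2r kc0) [leLHS]mulrA; apply: (le_trans TM).
have pi2 : 4 <= pi ^+ 2 :> R.
  by have := @pi_ge2 R; have := @pi_gt0 R; nra.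
rewrite /size_variance exprMn.
have -> : p * (1 - p) * (2 ^+ 2 * pi ^+ 2 * S2) * (c3%:R ^+ 2 * k%:R ^+ 4) =
  (p * (1 - p)) * pi ^+ 2 * (4 * c3%:R ^+ 2 * k%:R ^+ 4 * S2) by ring.
set W := p * (1 - p); set Y := 4 * _ * _ * S2 in h3 *.
have W0 : 0 < W := w0.
have Y0 : 0 <= Y by apply: le_trans h3; rewrite ler0n.
apply: (@le_trans _ _ (4 * (W * Y))).
  by rewrite ler_pM2l // ler_pM2l.
rewrite -subr_ge0 (_ : _ - _ = (pi ^+ 2 - 4) * (W * Y)); last by ring.
by rewrite mulr_ge0 ?subr_ge0 // mulr_ge0 // ltW.
Qed.

Hypothesis Bpos : (0 < #|B|)%N.

Lemma size_variance_gt0 : 0 < size_variance.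
Proof. by rewrite mulr_gt0 // ltr0n. Qed.

Lemma angle_sup t b :
  (2 * pi * comb psi t b) ^+ 2 <= d%:R * qform phase_covariance t / size_variance.
Proof.
rewrite ler_pdivlMr ?size_variance_gt0 // qform_phase_covariance /size_variance.
have h := comb_sup prim bV trans t b.
have -> : \sum_b (2 * pi * comb psi t b) ^+ 2 = (2 * pi) ^+ 2 * \sum_b comb psi t b ^+ 2.
  by rewrite mulr_sumr; apply: eq_bigr => b' _; rewrite exprMn.
have -> : (2 * pi * comb psi t b) ^+ 2 * (p * (1 - p) * #|B|%:R) =
  p * (1 - p) * (2 * pi) ^+ 2 * (#|B|%:R * comb psi t b ^+ 2) by ring.
have -> : forall S, d%:R * (p * (1 - p) * ((2 * pi) ^+ 2 * S)) =
  p * (1 - p) * (2 * pi) ^+ 2 * (d%:R * S) by move=> S; ring.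
by rewrite ler_wpM2l // mulr_ge0 ?sqr_ge0 // ltW.
Qed.

Lemma angle_le1 t T b : qform phase_covariance t <= T -> d%:R * T <= size_variance ->
  `|2 * pi * comb psi t b| <= 1.
Proof.
move=> tT dT; rewrite -(ler_pXn2r (_ : (0 < 2)%N)) ?nnegrE // expr1n real_normK ?num_real //.
apply: le_trans (angle_sup t b) _; rewrite ler_pdivrMr ?size_variance_gt0 // mul1r.
by apply: le_trans dT; rewrite ler_wpM2l.
Qed.

(** The phases at both points are at most one in absolute value, so the
integer values of the difference are below one. *)
Lemma near_unique t (z : 'rV[int]_d) T : d%:R * T <= size_variance ->
  qform phase_covariance t <= T -> qform phase_covariance (t - map_mx intr z) <= T -> z = 0.
Proof.
move=> dT h1 h2.
suff H : map_mx intr z = 0 :> 'rV[R]_d.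
  apply/rowP => a; have /rowP/(_ a) := H; rewrite !mxE => /eqP.
  by rewrite intr_eq0 => /eqP.
apply: (comb_inj0 prim) => b.
have := angle_le1 b h1 dT; have := angle_le1 b h2 dT.
rewrite combD combN comb_int.
set n := \sum_a _; set x := comb psi t b => a1 a2.
have pi2 := @pi_ge2 R.
suff n1 : `|n%:~R : R| < 1.
  move: n1; rewrite -intr_norm -[1]/(1%:~R) ltr_int => n1.
  by rewrite (int_norm_lt1 n1).
move: a1 a2; rewrite !normrM (ger0_norm (ler0n _ _)) (ger0_norm (pi_ge0 _)) => a1 a2.
have := ler_normB x (x - n%:~R); rewrite opprB addrC subrK.
set u := `|x| in a2 *; set v := `|x - _| in a1 *.
have u0 : 0 <= u by apply: normr_ge0.
have v0 : 0 <= v by apply: normr_ge0.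
move=> h; nra.
Qed.

(** The cubic error is at most the largest phase times the variance of the
phase. *)
Lemma char_fun_near t T : 1 <= T -> d%:R * T ^+ 2 <= size_variance ->
  qform phase_covariance t <= T ->
  normc (char_fun psi N t - (expR (- qform phase_covariance t / 2))%:C) <=
  2 * expR (- qform phase_covariance t / 2) *
    (Num.sqrt (d%:R * qform phase_covariance t / size_variance) * qform phase_covariance t).
Proof.
move=> T1 dT2 tT; have v0 := size_variance_gt0.
have dT : d%:R * T <= size_variance.
  by apply: le_trans dT2; rewrite ler_wpM2l // expr2 ler_peMr //; lra.
have x1 b := angle_le1 b tT dT.
have t20 : 0 <= qform phase_covariance t.
  exact: qform_phase_covariance_ge0.
set q2 := qform phase_covariance t in tT t20 *.
have sup b : (2 * pi * comb psi t b) ^+ 2 <= d%:R * q2 / size_variance := angle_sup t b.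
have x4 : p * (1 - p) * (\sum_b (2 * pi * comb psi t b) ^+ 4) <= 24.
  apply: (@le_trans _ _ (d%:R * q2 / size_variance * q2)).
    rewrite {2}/q2 qform_phase_covariance mulrCA ler_pM2l // mulr_sumr.
    apply: ler_sum => b _; rewrite (exprM _ 2 2) [X in X <= _]expr2.
    by rewrite ler_wpM2r ?sqr_ge0.
  rewrite mulrAC ler_pdivrMr // -mulrA -expr2.
  apply: (@le_trans _ _ (d%:R * T ^+ 2)); last by lra.
  by rewrite ler_wpM2l // ler_pXn2r ?nnegrE //; lra.
have := prod_bernoulli_cf_near p01' x1 x4.
rewrite -qform_phase_covariance -/q2 => h; apply: le_trans h _.
rewrite ler_wpM2l ?mulr_ge0 ?expR_ge0 //.
rewrite {2}/q2 qform_phase_covariance mulrCA ler_pM2l // mulr_sumr.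
apply: ler_sum => b _; rewrite exprSr mulrC real_normK ?num_real //.
rewrite ler_wpM2r ?sqr_ge0 //.
by rewrite -sqrtr_sqr ler_wsqrtr.
Qed.

(** Used to absorb the factor [Q ^ (3/2)] in a Gaussian. *)
Lemma cube_le_expR (s : R) : 0 <= s -> s * Num.sqrt s <= 2 * expR s.
Proof.
move=> s0; have := @expR_ge1Dxn R s 1 s0; rewrite (_ : 2`! = 2)%N // => h.
have e0 := sqrtr_ge0 s; have : Num.sqrt s ^+ 2 = s by rewrite sqr_sqrtr.
move: (Num.sqrt s) e0 => r r0 rs.
have : s * r <= s * ((1 + s) / 2).
  by rewrite ler_wpM2l // -rs; have := sqr_ge0 (r - 1); lra.
move: h; have := sqr_ge0 (s - 1); lra.
Qed.

(** Widening the Gaussian by the factor [1 - 1 / (2 d)] keeps its mass within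
a factor two and absorbs [Q ^ (3/2)] at the cost of [d ^ (3/2)] only.  A bound of
[Q] by the cutoff would instead lose a power of [ln M]. *)
Lemma char_fun_near_expR t T : (0 < d)%N -> 1 <= T -> d%:R * T ^+ 2 <= size_variance ->
  qform phase_covariance t <= T ->
  normc (char_fun psi N t - (expR (- qform phase_covariance t / 2))%:C) <=
  32 * d%:R ^+ 2 / Num.sqrt size_variance *
    expR (- qform ((1 - (2 * d%:R)^-1) *: phase_covariance) t / 2).
Proof.
move=> d0 T1 dT2 tT; apply: le_trans (char_fun_near T1 dT2 tT) _.
rewrite (qformZ _ phase_covariance).
have t20 : 0 <= qform phase_covariance t.
  exact: qform_phase_covariance_ge0.
have v0 := size_variance_gt0; set q2 := qform phase_covariance t in tT t20 *.
have d0' : 0 < d%:R :> R by rewrite ltr0n.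
pose s := q2 / (4 * d%:R).
have s0 : 0 <= s by rewrite divr_ge0 // mulr_ge0.
have q2s : q2 = 4 * d%:R * s by rewrite /s; field; rewrite gt_eqF.
have -> : expR (- ((1 - (2 * d%:R)^-1) * q2) / 2) = expR (- q2 / 2) * expR s.
  rewrite -expRD; congr expR; rewrite /s; field; rewrite gt_eqF //.
have -> : Num.sqrt (d%:R * q2 / size_variance) = 2 * d%:R * Num.sqrt s / Num.sqrt size_variance.
  have -> : d%:R * q2 / size_variance = (2 * d%:R) ^+ 2 * (s * size_variance^-1).
    by rewrite q2s; field; rewrite gt_eqF.
  rewrite sqrtrM ?sqr_ge0 // sqrtr_sqr ger0_norm ?mulr_ge0 // sqrtrM // sqrtrV ?ltW //.
  by rewrite mulrA.
have v1 : 0 < Num.sqrt size_variance by rewrite sqrtr_gt0.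
have := cube_le_expR s0; have := expR_gt0 (- q2 / 2).
move: (expR (- q2 / 2)) (expR s) => E F E0 h; rewrite q2s.
have -> : 2 * E * (2 * d%:R * Num.sqrt s / Num.sqrt size_variance * (4 * d%:R * s)) =
   16 * d%:R ^+ 2 / Num.sqrt size_variance * E * (s * Num.sqrt s) by field; rewrite gt_eqF.
have -> : 32 * d%:R ^+ 2 / Num.sqrt size_variance * (E * F) =
   16 * d%:R ^+ 2 / Num.sqrt size_variance * E * (2 * F) by field; rewrite gt_eqF.
by rewrite ler_wpM2l // mulr_ge0 ?divr_ge0 ?mulr_ge0 ?sqr_ge0 // ltW.
Qed.

End NearFar.

(** * The local limit theorem *)

Lemma ler_addgt0_mul (R : realFieldType) (A X Y : R) : 0 < Y ->
  (forall eta, 0 < eta -> A <= X + eta * Y) -> A <= X.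
Proof.
move=> Y0 H; apply/ler_addgt0Pr => e e0.
by have := H (e / Y); rewrite divfK ?gt_eqF // divr_gt0 // => /(_ isT).
Qed.

Section Lift.
Variables (R : realType) (d q : nat).
Hypothesis q0 : (0 < q)%N.

Definition ffun_row (j : {ffun 'I_d -> 'I_q}) : 'rV[int]_d := \row_a (j a)%:Z.

Lemma grid_sub_lattice (y z : 'rV[int]_d) :
  grid (q%:R^-1 : R) (y - q%:Z *: z) = grid q%:R^-1 y - map_mx intr z.
Proof.
apply/rowP => a; rewrite !mxE rmorphB rmorphM /= -pmulrn.
by field; rewrite pnatr_eq0 -lt0n.
Qed.

Lemma ffun_row_inj (j j' : {ffun 'I_d -> 'I_q}) (z z' : 'rV[int]_d) :
  ffun_row j - q%:Z *: z = ffun_row j' - q%:Z *: z' -> j = j'.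
Proof.
move=> /rowP e; apply/ffunP => a; apply: val_inj => /=.
have := e a; rewrite !mxE => {}e.
have red (m : 'I_q) (u : int) : ((m%:Z - q%:Z * u) %% q%:Z)%Z = m%:Z.
  rewrite -mulrN addrC mulrC modzMDl modz_small //.
  by rewrite lez_nat leq0n ltz_nat ltn_ord.
have := congr1 (fun x : int => (x %% q%:Z)%Z) e; rewrite !red.
by case.
Qed.

Lemma ffun_row_surj (y : 'rV[int]_d) :
  exists j z, ffun_row j - q%:Z *: z = y.
Proof.
have qz : q%:Z != 0 by rewrite gt_eqF.
have lt a : (absz (y ord0 a %% q%:Z)%Z < q)%N.
  have := modz_ge0 (y ord0 a) qz; have := ltz_mod (y ord0 a) qz; lia.
exists [ffun a => Ordinal (lt a)], (\row_a - (y ord0 a %/ q%:Z)%Z).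
apply/rowP => a; rewrite !mxE ffunE /= gez0_abs ?modz_ge0 //.
by rewrite mulrN opprK addrC mulrC -divz_eq.
Qed.

End Lift.

Section LocalLimit.
Variables (R : realType) (B : finType) (V : {vspace ratfun B}) (d : nat).
Variable psi : 'I_d -> {ffun B -> int}.
Hypothesis prim : primitive psi.
Hypothesis bV : basis_of V (int_basis psi).
Hypothesis trans : forall b1 b2 : B, exists s : {perm B}, is_symmetry V s /\ s b1 = b2.
Hypothesis const : forall a : rat, [ffun=> a] \in V.
Variables (N : nat) (g : {ffun B -> int}).
Hypothesis gP : forall f : ratfun B, f \in V ->
    \sum_(b : B) (g b)%:~R * (f b : rat)
      = N%:~R / #|B|%:R * \sum_(b : B) (f b : rat).
Hypothesis N0 : (0 < N)%N.
Hypothesis NB : (N < #|B|)%N.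
Hypothesis d0 : (0 < d)%N.
Variables (phi : 'I_d -> {ffun B -> int}) (c2 c3 k : nat) (T : R).
Hypothesis bphi : basis_of V (int_basis phi).
Hypothesis phic : forall a b, (absz (phi a b) <= c2)%N.
Hypothesis c3b : bounded_integer_basis (@l1_norm B) c3 (orthv V).
Hypothesis c20 : (0 < c2)%N.
Hypothesis c30 : (0 < c3)%N.
Hypothesis mk : ((2 * d * c2 * c3) ^ d < 2 ^ k)%N.

Let p : R := N%:R / #|B|%:R.
Let M : R := size_variance R B N.
Let Q : 'M[R]_d := phase_covariance R psi N.
Let Q1 : 'M[R]_d := (1 - (2 * d%:R)^-1) *: Q.
Let Q2 : 'M[R]_d := 2^-1 *: Q.

Hypothesis T1 : 1 <= T.
Hypothesis dTM : d%:R * T ^+ 2 <= M.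
Hypothesis farM : T * c3%:R ^+ 2 * k%:R ^+ 4 <= 4 * M.

Let p01 : 0 < p < 1.
Proof.
have B0 : 0 < #|B|%:R :> R by rewrite ltr0n (leq_trans _ NB).
apply/andP; split; first by apply: divr_gt0 => //; rewrite ltr0n.
by rewrite /p ltr_pdivrMr // mul1r ltr_nat.
Qed.

Let B0 : (0 < #|B|)%N. Proof. exact: leq_trans NB. Qed.

Let M0 : 0 < M. Proof. exact: size_variance_gt0. Qed.

Let Qp : posdef Q. Proof. exact: posdef_phase_covariance. Qed.

Let d0' : 0 < d%:R :> R. Proof. by rewrite ltr0n. Qed.

Let a1 : 2^-1 <= 1 - (2 * d%:R)^-1 :> R.
Proof.
have : (2 * d%:R)^-1 <= 2^-1 :> R.
  by rewrite lef_pV2 ?posrE ?mulr_gt0 // ler_pMr // ler1n.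
lra.
Qed.

Let Q1p : posdef Q1. Proof. by apply: posdefZ => //; apply: lt_le_trans a1. Qed.
Let Q2p : posdef Q2. Proof. by apply: posdefZ. Qed.

Let mass1 : gauss_mass Q1 <= 2 * gauss_mass Q.
Proof.
apply: gauss_massZ => //; first by apply: lt_le_trans a1.
have bern (x : R) n : 0 <= x -> x <= 1 -> 1 - n%:R * x <= (1 - x) ^+ n.
  move=> x0 x1; elim: n => [|n IH]; first by rewrite mul0r subr0 expr0.
  rewrite exprS -natr1; apply: (@le_trans _ _ ((1 - x) * (1 - n%:R * x))); last first.
    by rewrite ler_wpM2l // subr_ge0.
  have : 0 <= n%:R * x * x by rewrite !mulr_ge0.
  lra.
have x1 : (2 * d%:R)^-1 <= 1 :> R by have := a1; lra.
have x0 : 0 <= (2 * d%:R)^-1 :> R by rewrite invr_ge0 mulr_ge0.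
have := bern _ d x0 x1.
have -> : d%:R * (2 * d%:R)^-1 = 2^-1 :> R by field; rewrite gt_eqF.
move=> h; nra.
Qed.

Let mass2 : gauss_mass Q2 <= 2 ^+ d * gauss_mass Q.
Proof.
apply: gauss_massZ => //; rewrite ?exprn_ge0 // exprVn expr2 -mulrA divff ?mulr1.
  by rewrite exprn_ege1 // ler1n.
by rewrite expf_neq0.
Qed.

(** The probability that the random set is a design of size [N]. *)
Definition normalized_count : R :=
  (design_count V N)%:R * (p ^+ N * (1 - p) ^+ (#|B| - N)).

(** Torsion points near the lattice correspond to the points of the grid with
[Q] at most [T], bijectively because the nearby lattice point is unique.  On
them [char_fun] is compared with the Gaussian; the Gaussian sum over the omitted
grid points is bounded by a tail of a wider Gaussian, and the other torsion
points contribute at most [expR (- T / 18)]. *)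
Lemma local_limit_grid eta : 0 < eta ->
  `|normalized_count - gauss_mass Q| <=
    (expR (- (T / 4)) * 2 ^+ d + 64 * d%:R ^+ 2 / Num.sqrt M) * gauss_mass Q
      + expR (- (T / 18)) + eta * (2 + 32 * d%:R ^+ 2 / Num.sqrt M).
Proof.
move=> eta0.
have [h0 h00 H0] := gauss_sum_approx Qp eta0.
have [h1 h10 H1] := gauss_sum_approx Q1p eta0.
have [h2 h20 H2] := gauss_sum_approx Q2p eta0.
(* [q] exceeds all deviations, for exactness of the Fourier inversion, and makes
   the mesh small enough for the three Gaussian sums. *)
pose D0 := (\sum_(S : {set B}) \sum_(a < d) absz (deviation psi g S a))%N.
pose q := (maxn D0 (maxn (Num.truncn (h0^-1)) (maxn (Num.truncn h1^-1) (Num.truncn h2^-1)))).+1.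
have q0 : (0 < q)%N by [].
have hq0 : (Num.truncn h0^-1 < q)%N by rewrite ltnS !leq_max leqnn orbT.
have hq1 : (Num.truncn h1^-1 < q)%N by rewrite ltnS !leq_max leqnn !orbT.
have hq2 : (Num.truncn h2^-1 < q)%N by rewrite ltnS !leq_max leqnn !orbT.
have devq S a : (absz (deviation psi g S a) < q)%N.
  rewrite ltnS; apply: leq_trans (leq_maxl _ _).
  by rewrite /D0 (bigD1 S) //= (bigD1 a) //= -addnA leq_addr.
clearbody q; pose h : R := q%:R^-1.
have q0' : 0 < q%:R :> R by rewrite ltr0n.
have hpos : 0 < h by rewrite invr_gt0.
have hle (x : R) : 0 < x -> (Num.truncn x^-1 < q)%N -> h <= x.
  move=> x0 xq; rewrite /h -[x]invrK lef_pV2 ?posrE ?invr_gt0 //.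
  apply: ltW; apply: lt_le_trans (Num.Theory.truncnS_gt _) _.
  by rewrite ler_nat.
have [ub0 [FL uFL lbL]] := H0 h hpos (hle _ h00 hq0).
have [ub1 _] := H1 h hpos (hle _ h10 hq1).
have [ub2 _] := H2 h hpos (hle _ h20 hq2).
pose J := {ffun 'I_d -> 'I_q}.
pose tj (j : J) : 'rV[R]_d := grid h (ffun_row j).
pose near (j : J) := `[< exists z : 'rV[int]_d, qform Q (tj j - map_mx intr z) <= T >].
have /boolp.choice[z zP] (j : J) : exists z : 'rV[int]_d, near j ->
    qform Q (tj j - map_mx intr z) <= T.
  by have [/asboolP[z zT]|_] := boolP (near j); [exists z|exists 0].
pose lift j := ffun_row j - q%:Z *: z j.
have liftE j : grid h (lift j) = tj j - map_mx intr (z j) by apply: grid_sub_lattice.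
pose F := [seq lift j | j <- enum J & near j].
have uF : uniq F.
  rewrite map_inj_in_uniq; first by apply: filter_uniq; apply: enum_uniq.
  by move=> j j' _ _; apply: ffun_row_inj.
have dT : d%:R * T <= M.
  by apply: le_trans dTM; rewrite ler_wpM2l // expr2 ler_peMr //; apply: le_trans T1.
have coverF y : qform Q (grid h y) <= T -> y \in F.
  move=> yT; have [j [zc yE]] := ffun_row_surj q0 y.
  have gE : grid h y = tj j - map_mx intr zc by rewrite -yE; apply: grid_sub_lattice.
  have nj : near j by apply/asboolP; exists zc; rewrite -gE.
  have zz : zc - z j = 0.
    apply: (@near_unique R B V d psi prim bV trans N p01 B0 (tj j - map_mx intr (z j)) _ T dT).
      exact: zP.
    rewrite (_ : _ - _ = grid h y) // gE map_mxB opprB addrA subrK //.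
  apply/mapP; exists j; first by rewrite mem_filter nj mem_enum.
  by rewrite /lift -yE; move/eqP: zz; rewrite subr_eq0 => /eqP->.
have sumF (G : 'rV[int]_d -> R) : \sum_(y <- F) G y = \sum_(j | near j) G (lift j).
  by rewrite big_map big_filter big_enum_cond.
have hq : h ^+ d * q%:R ^+ d = 1 by rewrite -exprMn mulVf ?expr1n // gt_eqF.
have cmp : `|normalized_count - gauss_sum Q h F| <=
    32 * d%:R ^+ 2 / Num.sqrt M * gauss_sum Q1 h F + expR (- (T / 18)).
  have fc := fourier_count R bV gP const N0 NB devq.
  have ncE : (normalized_count - gauss_sum Q h F)%:C = (h ^+ d)%:C *
    (\sum_(j | near j) (char_fun psi N (tj j) - (expR (- qform Q (grid h (lift j)) / 2))%:C)
     + \sum_(j | ~~ near j) char_fun psi N (tj j)).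
    rewrite (bigID near) /= in fc.
    rewrite sumrB addrAC fc -rmorph_sum /= -rmorphB -rmorphM /=.
    congr (_%:C); rewrite mulrBr [X in _ = X - _]mulrA hq mul1r /gauss_sum sumF.
    by [].
  rewrite -normc_real ncE normcM normc_real ger0_norm ?exprn_ge0 ?(ltW hpos) //.
  apply: (@le_trans _ _ (h ^+ d * (\sum_(j | near j) (32 * d%:R ^+ 2 / Num.sqrt M *
     expR (- qform Q1 (grid h (lift j)) / 2)) + \sum_(j | ~~ near j) expR (- (T / 18))))).
    rewrite ler_wpM2l ?exprn_ge0 ?(ltW hpos) //.
    apply: le_trans (le_normcD _ _) _; apply: lerD.
      apply: le_trans (normc_sum _ _ _) _.
      apply: ler_sum => j nj.
      rewrite -(char_fun_periodic bV gP (tj j) (z j)) -liftE.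
      apply: (char_fun_near_expR prim bV trans p01 B0 d0 T1 dTM).
      by rewrite liftE; apply: zP.
    apply: le_trans (normc_sum _ _ _) _.
    apply: ler_sum => j nj.
    have m0 : (0 < 2 * d * c2 * c3)%N by rewrite !muln_gt0 d0 c20.
    have [[zz zT]|//] := char_fun_far prim bV trans p01 (tj j) bphi phic c3b c30 m0 mk farM.
    by case/negP: nj; apply/asboolP; exists zz.
  rewrite mulrDr -mulr_sumr mulrCA.
  rewrite -(sumF (fun y => expR (- qform Q1 (grid h y) / 2))) -/(gauss_sum Q1 h F) lerD2l.
  rewrite sumr_const -[_ *+ #|_|]mulr_natl mulrA ler_piMl ?expR_ge0 //.
  apply: (@le_trans _ _ (h ^+ d * q%:R ^+ d)); last by rewrite hq.
  rewrite ler_wpM2l ?exprn_ge0 ?(ltW hpos) // -[q%:R ^+ d]natrX ler_nat.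
  by apply: leq_trans (max_card _) _; rewrite card_ffun !card_ord.
have lowF : gauss_mass Q - eta <= gauss_sum Q h F + expR (- (T / 4)) * gauss_sum Q2 h FL.
  apply: le_trans lbL _; rewrite /gauss_sum mulrCA -mulrDr ler_wpM2l ?exprn_ge0 ?(ltW hpos) //.
  rewrite (bigID (fun y => qform Q (grid h y) <= T)) /=; apply: lerD.
    rewrite -big_filter; apply: ler_sum_sub => //.
    - exact: filter_uniq.
    - by move=> y; rewrite mem_filter => /andP[/coverF yF _].
  rewrite mulr_sumr [leRHS](bigID (fun y => qform Q (grid h y) <= T)) /=.
  apply: ler_wpDl; first by apply: sumr_ge0 => y _; rewrite mulr_ge0 ?expR_ge0.
  apply: ler_sum => y; rewrite -ltNge => yT.
  by rewrite -expRD ler_expR /Q2 (qformZ _ Q); move: yT; set u := qform Q _; lra.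
have u0 := ub0 _ uF; have u1 := ub1 _ uF; have u2 := ub2 _ uFL.
have s0 : 0 < Num.sqrt M by rewrite sqrtr_gt0.
set c := 32 * d%:R ^+ 2 / Num.sqrt M in cmp *.
have c0 : 0 <= c by rewrite /c divr_ge0 ?mulr_ge0 ?exprn_ge0 ?ltW.
have cE : 64 * d%:R ^+ 2 / Num.sqrt M = c * 2 by rewrite /c; field; rewrite gt_eqF.
rewrite cE.
have cu1 : c * gauss_sum Q1 h F <= c * (2 * gauss_mass Q + eta).
  by rewrite ler_wpM2l //; apply: le_trans u1 _; rewrite lerD2r.
set E4 := expR (- (T / 4)) in lowF *.
have E40 : 0 <= E4 by apply: expR_ge0.
have E41 : E4 <= 1 by rewrite /E4 -[leRHS]expR0 ler_expR oppr_le0 divr_ge0 // (le_trans ler01 T1).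
have eu2 : E4 * gauss_sum Q2 h FL <= E4 * (2 ^+ d * gauss_mass Q) + eta.
  apply: (@le_trans _ _ (E4 * (2 ^+ d * gauss_mass Q + eta))).
    by rewrite ler_wpM2l //; apply: le_trans u2 _; rewrite lerD2r.
  by rewrite mulrDr lerD2l ler_piMl // ltW.
have G0 : 0 <= gauss_mass Q by apply: sqrtr_ge0.
have EG : 0 <= E4 * (2 ^+ d * gauss_mass Q) by rewrite !mulr_ge0 ?exprn_ge0.
move: cmp; rewrite !ler_norml => /andP[l r].
apply/andP; split; lra.
Qed.

Lemma local_limit :
  `|normalized_count - gauss_mass Q| <=
    (expR (- (T / 4)) * 2 ^+ d + 64 * d%:R ^+ 2 / Num.sqrt M) * gauss_mass Q
      + expR (- (T / 18)).
Proof.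
apply: ler_addgt0_mul local_limit_grid.
by rewrite ltr_wpDr // divr_ge0 ?sqrtr_ge0 // mulr_ge0 // sqr_ge0.
Qed.

End LocalLimit.

Local Close Scope complex_scope.

(** * Choice of the parameters *)

Section Numerics.
Variable R : realType.

Lemma ln2_ge_half : 2^-1 <= ln 2 :> R.
Proof.
have := @le_ln1Dx R (- 2^-1); rewrite (_ : 1 + - 2^-1 = 2^-1 :> R); last by field.
by rewrite lnV ?posrE // => /(_ ltac:(lra)); lra.
Qed.

(** Applied with [S] a multiple of the other factors of an inequality
[a * ln x <= x]: the logarithm of [x] is thereby replaced with that of [S]. *)
Lemma ln_le_ratio (x S : R) : 0 < x -> 0 < S -> ln x <= x / S + ln S.
Proof.
move=> x0 S0; have xS : 0 < x / S by rewrite divr_gt0.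
have := ltW (ln_sublinear xS); rewrite ln_div ?posrE //; lra.
Qed.

Lemma ln_pow n (x : R) : 0 < x -> ln (x ^+ n) = n%:R * ln x.
Proof. by move=> x0; rewrite lnXn // mulr_natl. Qed.

(** Large enough for [expR (- cutoff / 18) = (8 c2 M) ^- d] to be negligible
against the Gaussian main term. *)
Definition cutoff (d c2 : nat) (M : R) : R := 18 * d%:R * ln (8 * c2%:R * M).

(** The logarithms of all parameters are bounded by multiples of [A]; the
term [ln M] in the cutoff is absorbed by [M] itself through [ln_le_ratio]. *)
Lemma parameters_ok (d c2 c3 : nat) (M : R) :
  (0 < d)%N -> (0 < c2)%N -> (0 < c3)%N ->
  let A := ln (2 * d%:R * c2%:R * c3%:R) in
  10 ^+ 7 * c3%:R ^+ 2 * d%:R ^+ 5 * A ^+ 5 <= M ->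
  [/\ 1 <= M, 1 <= cutoff d c2 M, d%:R * cutoff d c2 M ^+ 2 <= M &
    cutoff d c2 M * c3%:R ^+ 2 * (4 * d%:R * A) ^+ 4 <= 4 * M].
Proof.
rewrite -!(ltr_nat R) => d0 c20 c30 A.
have d1 : 1 <= d%:R :> R by rewrite (ler_nat _ 1) -(ltr_nat R).
have c21 : 1 <= c2%:R :> R by rewrite (ler_nat _ 1) -(ltr_nat R).
have c31 : 1 <= c3%:R :> R by rewrite (ler_nat _ 1) -(ltr_nat R).
rewrite /cutoff; move: (d%:R : R) (c2%:R : R) (c3%:R : R) d0 c20 c30 d1 c21 c31 @A.
move=> {}d {}c2 {}c3 d0 c20 c30 d1 c21 c31 A HM.
have AE : A = ln 2 + ln d + ln c2 + ln c3 by rewrite /A !lnM ?posrE ?mulr_gt0.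
have l2 := ln2_ge_half.
have ld := ln_ge0 d1; have lc2 := ln_ge0 c21; have lc3 := ln_ge0 c31.
clearbody A.
have A2 : 2^-1 <= A by lra.
have A0 : 0 < A by lra.
have lA := ltW (ln_sublinear A0).
pose Y := c3 ^+ 2 * d ^+ 5 * A ^+ 4.
have Y0 : 0 < Y by rewrite !mulr_gt0 ?exprn_gt0.
have lY : ln Y <= 11 * A.
  have p1 : 0 < c3 ^+ 2 by rewrite exprn_gt0.
  have p2 : 0 < d ^+ 5 by rewrite exprn_gt0.
  have p3 : 0 < A ^+ 4 by rewrite exprn_gt0.
  have p12 : 0 < c3 ^+ 2 * d ^+ 5 by rewrite mulr_gt0.
  rewrite /Y (lnM p12 p3) (lnM p1 p2) !ln_pow //; lra.
have HM' : 10 ^+ 7 * (Y * A) <= M.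
  by apply: le_trans HM; rewrite le_eqVlt; apply/orP; left; apply/eqP; rewrite /Y; ring.
have d2 : d ^+ 2 <= d ^+ 5 by apply: ler_weXn2l.
have d4 : d ^+ 4 <= d ^+ 5 by apply: ler_weXn2l.
have d41 : 1 <= d ^+ 4 by apply: exprn_ege1.
have c32 : 1 <= c3 ^+ 2 by apply: exprn_ege1.
have YA : d ^+ 4 * A ^+ 2 / 8 <= Y * A.
  have -> : d ^+ 4 * A ^+ 2 / 8 = (1 * d ^+ 4) * (A ^+ 2 * 2^-1 ^+ 3) by field.
  have -> : Y * A = (c3 ^+ 2 * d ^+ 5) * (A ^+ 2 * A ^+ 3) by rewrite /Y; ring.
  have d40 : 0 <= d ^+ 4 by lra.
  have A20 : 0 < A ^+ 2 by rewrite exprn_gt0.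
  apply: ler_pM.
  - by rewrite mul1r.
  - by rewrite mulr_ge0 ?exprn_ge0 // ltW.
  - by apply: ler_pM.
  - by rewrite ler_pM2l // ler_pXn2r ?nnegrE //; lra.
have A24 : 4^-1 <= A ^+ 2 by rewrite (_ : 4^-1 = 2^-1 ^+ 2); [rewrite ler_pXn2r ?nnegrE //; lra|field].
have YA1 : 32^-1 <= Y * A.
  apply: le_trans YA; have : 4^-1 <= d ^+ 4 * A ^+ 2.
    by rewrite -[X in X <= _]mul1r ler_pM //; lra.
  lra.
pose K := 10 ^+ 7 : R; pose C1 := 18 * 4 ^+ 4 : R; pose C2 := 30 ^+ 2 : R.
have KE : K = 10 * 10 * 10 * 10 * 10 * 10 * 10 by rewrite /K; ring.
have C1E : C1 = 18 * 4 * 4 * 4 * 4 by rewrite /C1; ring.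
have C2E : C2 = 30 * 30 by rewrite /C2; ring.
have K32 : 32 <= K by rewrite KE; lra.
have C1K : C1 * 28 <= 3 * K by rewrite KE C1E; lra.
have C2K : C2 * C2 * 8 <= K by rewrite KE C2E; lra.
have C2l : 2 * (18 * 22) <= C2 by rewrite C2E; lra.
have C10 : 0 < C1 by rewrite C1E; lra.
have C20 : 0 < C2 by rewrite C2E; lra.
have lC1 : ln C1 <= 13 * ln 2.
  have l18 : ln 18 <= 5 * ln 2 :> R.
    rewrite -ln_pow // ler_ln ?posrE ?exprn_gt0 // (_ : 2 ^+ 5 = 32); [lra|ring].
  have l4 : ln (4 ^+ 4) = 8 * ln 2 :> R.
    by rewrite -ln_pow //; congr ln; ring.
  have p1 : 0 < 18 :> R by [].
  have p2 : 0 < 4 ^+ 4 :> R by rewrite exprn_gt0.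
  rewrite /C1 (lnM p1 p2) l4; lra.
rewrite -/K in HM'; have C1D : C1 = 18 * 4 ^+ 4 by [].
clearbody K C1 C2; clear KE C1E C2E HM.
have M1 : 1 <= M.
  by apply: le_trans HM'; nra.
have M0 : 0 < M by lra.
set L := ln (8 * c2 * M).
have ln8 : ln 8 = 3 * ln 2 :> R.
  by rewrite (_ : 8 = 2 ^+ 3); [rewrite ln_pow|ring].
have LE : L = 3 * ln 2 + ln c2 + ln M by rewrite /L !lnM ?posrE ?mulr_gt0 // ln8.
have lM : 0 <= ln M by apply: ln_ge0.
have L0 : 3 / 2 <= L by lra.
have c3b : C1 * Y * L <= 4 * M.
  (* With this [S] the term [M / S] costs one of the four available multiples of
     [M]. *)
  pose S := C1 * Y.
  have S0 : 0 < S by rewrite /S mulr_gt0.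
  have lS : ln S <= 24 * A by rewrite /S (lnM C10 Y0); lra.
  have h := ln_le_ratio M0 S0.
  have SM : S * (M / S) = M by rewrite mulrC divfK // gt_eqF.
  have SL : S * L <= S * (28 * A + M / S) by rewrite ler_pM2l //; lra.
  have SE : S * (28 * A) <= 3 * M.
    apply: (@le_trans _ _ (3 * (K * (Y * A)))); last by rewrite ler_pM2l.
    have -> : S * (28 * A) = C1 * 28 * (Y * A) by rewrite /S; ring.
    by rewrite [leRHS]mulrA ler_pM2r // mulr_gt0.
  by rewrite -/S; move: SL; rewrite mulrDr SM; lra.
have r0 : 0 < Num.sqrt M by rewrite sqrtr_gt0.
have rM : Num.sqrt M ^+ 2 = M by rewrite sqr_sqrtr // ltW.
move: (Num.sqrt M) r0 rM => r r0 rM.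
have dd0 : 0 < d ^+ 2 by apply: exprn_gt0.
have Lr : 18 * d ^+ 2 * L <= r.
  (* With this [S] the term [r / S] costs half of the available [r]. *)
  pose S := 72 * d ^+ 2.
  have S0 : 0 < S by rewrite mulr_gt0.
  have lS : ln S <= 9 * A.
    have l72 : ln 72 <= 7 * ln 2 :> R.
      rewrite -ln_pow // ler_ln ?posrE ?exprn_gt0 // (_ : 2 ^+ 7 = 128); [lra|ring].
    have p72 : 0 < 72 :> R by [].
    rewrite /S (lnM p72 dd0) ln_pow //; lra.
  have h := ln_le_ratio r0 S0.
  have lr : ln M = 2 * ln r by rewrite -rM ln_pow.
  have hL : L <= 4 * A + 2 * (r / S) + 18 * A by lra.
  have : 18 * d ^+ 2 * L <= 18 * d ^+ 2 * (4 * A + 2 * (r / S) + 18 * A).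
    by rewrite ler_pM2l // mulr_gt0.
  have -> : 18 * d ^+ 2 * (4 * A + 2 * (r / S) + 18 * A) = 18 * 22 * (d ^+ 2 * A) + r / 2.
    by rewrite /S; field; rewrite gt_eqF.
  have dA : 0 < d ^+ 2 * A by rewrite mulr_gt0.
  suff C2r : C2 * (d ^+ 2 * A) <= r.
    have : 2 * (18 * 22) * (d ^+ 2 * A) <= C2 * (d ^+ 2 * A) by rewrite ler_pM2r.
    lra.
  have dA0 : 0 <= C2 * (d ^+ 2 * A) by rewrite mulr_ge0 // ltW.
  rewrite -(ler_pXn2r (_ : (0 < 2)%N)) ?nnegrE ?(ltW r0) // rM.
  have -> : (C2 * (d ^+ 2 * A)) ^+ 2 = C2 * C2 * 8 * (d ^+ 4 * A ^+ 2 / 8) by field.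
  apply: le_trans HM'; apply: ler_pM => //; first by rewrite !mulr_ge0 // ltW.
  by rewrite divr_ge0 // mulr_ge0 // exprn_ge0 // ltW.
split=> //.
- have : 1 * L <= d * L by rewrite ler_pM2r //; lra.
  lra.
- have -> : d * (18 * d * L) ^+ 2 = (18 * L) ^+ 2 * d ^+ 3 by ring.
  have d34 : d ^+ 3 <= d ^+ 4 by apply: ler_weXn2l.
  apply: (@le_trans _ _ ((18 * L) ^+ 2 * d ^+ 4)); first by rewrite ler_wpM2l // sqr_ge0.
  have -> : (18 * L) ^+ 2 * d ^+ 4 = (18 * d ^+ 2 * L) ^+ 2 by ring.
  have L00 : 0 <= L by lra.
  have dL0 : 0 <= 18 * d ^+ 2 * L by rewrite mulr_ge0 // mulr_ge0 // ltW.
  by rewrite -rM ler_pXn2r ?nnegrE ?(ltW r0).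
- have -> : 18 * d * L * c3 ^+ 2 * (4 * d * A) ^+ 4 = (18 * 4 ^+ 4) * Y * L.
    by rewrite /Y; ring.
  by rewrite -C1D.
Qed.

(** The bound [c2] enters the requirements only through logarithms,
which the single factor [c2] dominates: [1 + 2 v <= 10 * expR (v / 5)] for
[v = ln c2]. *)
Lemma log_split (d c2 c3 : nat) : (0 < d)%N -> (0 < c2)%N -> (0 < c3)%N ->
  ln (2 * d%:R * c2%:R * c3%:R) ^+ 5 <=
    10 ^+ 5 * c2%:R * ln (2 * c3%:R * d%:R) ^+ 5 :> R.
Proof.
rewrite -!(ltr_nat R) => d0 c20 c30.
have d1 : 1 <= d%:R :> R by rewrite (ler_nat _ 1) -(ltr_nat R).
have c21 : 1 <= c2%:R :> R by rewrite (ler_nat _ 1) -(ltr_nat R).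
have c31 : 1 <= c3%:R :> R by rewrite (ler_nat _ 1) -(ltr_nat R).
move: (d%:R : R) (c2%:R : R) (c3%:R : R) d0 c20 c30 d1 c21 c31.
move=> {}d {}c2 {}c3 d0 c20 c30 d1 c21 c31.
rewrite !lnM ?posrE ?mulr_gt0 //.
have l2 := ln2_ge_half.
have ld := ln_ge0 d1; have lc2 := ln_ge0 c21; have lc3 := ln_ge0 c31.
set e := expR (ln c2 / 5).
have e5 : e ^+ 5 = c2.
  by rewrite -expRM_natl (_ : 5%:R * (ln c2 / 5) = ln c2) ?lnK ?posrE //; field.
have he : 1 + ln c2 / 5 <= e by apply: expR_ge1Dx.
have -> : 10 ^+ 5 * c2 * (ln 2 + ln c3 + ln d) ^+ 5 = (10 * e * (ln 2 + ln c3 + ln d)) ^+ 5.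
  by rewrite -{1}e5; ring.
rewrite ler_pXn2r ?nnegrE ?mulr_ge0 ?expR_ge0 //; try lra.
move: (ln c2) (ln d) (ln c3) (ln 2) e he l2 ld lc2 lc3 {e5} => a b c f e he l2 ld lc2 lc3.
nra.
Qed.

End Numerics.

(** * The main theorem *)

Lemma size_variance_bounds (R : realType) (B : finType) (N : nat) (m : R) :
  (0 < N)%N -> (N < #|B|)%N -> m = Num.min N%:R (#|B|%:R - N%:R) ->
  m <= 2 * size_variance R B N /\ size_variance R B N <= m.
Proof.
move=> N0 NB mE; rewrite /size_variance.
have x0 : 0 < N%:R :> R by rewrite ltr0n.
have y0 : 0 < #|B|%:R - N%:R :> R by rewrite subr_gt0 ltr_nat.
have B0 : 0 < #|B|%:R :> R by rewrite ltr0n (leq_trans _ NB).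
have BE : #|B|%:R = N%:R + (#|B|%:R - N%:R) :> R by ring.
have -> : N%:R / #|B|%:R * (1 - N%:R / #|B|%:R) * #|B|%:R =
   N%:R * (#|B|%:R - N%:R) / #|B|%:R :> R by field; rewrite gt_eqF.
rewrite mulrA ler_pdivlMr // ler_pdivrMr //.
move: mE; move: (N%:R : R) (#|B|%:R - N%:R : R) x0 y0 BE => x y x0 y0 ->.
case: (leP x y) => xy ->; split; nra.
Qed.

Lemma trunc_log_ln (R : realType) (m : nat) : (0 < m)%N ->
  ((trunc_log 2 m).+1%:R : R) <= 1 + 2 * ln m%:R.
Proof.
move=> m0; rewrite -natr1 addrC lerD2l.
have := @trunc_logP 2 m isT m0; rewrite -(ler_nat R) natrX => h.
have m0' : 0 < m%:R :> R by rewrite ltr0n.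
have : ln (2 ^+ trunc_log 2 m) <= ln m%:R :> R by rewrite ler_ln ?posrE ?exprn_gt0.
rewrite ln_pow // => h2.
have l2 := ln2_ge_half R.
have : (trunc_log 2 m)%:R * 2^-1 <= (trunc_log 2 m)%:R * ln 2 :> R by rewrite ler_wpM2l.
lra.
Qed.

Lemma powR_half_nat (R : realType) (x : R) (d : nat) : 0 <= x ->
  x `^ (d%:R / 2) = Num.sqrt (x ^+ d).
Proof.
by move=> x0; rewrite powRrM powR12_sqrt ?powR_ge0 // powR_mulrn.
Qed.

Lemma powR_three_halves_ge (R : realType) (x : R) : 2^-1 <= x -> 4^-1 <= x `^ (3 / 2).
Proof.
move=> x2; have x0 : 0 <= x by lra.
rewrite (powR_half_nat 3 x0) -[4^-1](ger0_norm _) // -sqrtr_sqr ler_wsqrtr //.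
have : (2^-1) ^+ 3 <= x ^+ 3 by rewrite ler_pXn2r ?nnegrE.
lra.
Qed.

Lemma expRM_natN (R : realType) (d : nat) (x : R) : 0 < x ->
  expR (- (d%:R * ln x)) = x^-1 ^+ d.
Proof. by move=> x0; rewrite expRN expRM_natl lnK ?posrE // exprVn. Qed.

(** Hadamard's bound on [detg] makes [G] at least
[(2 * pi * M * c2 ^ 2) ^- (d / 2)], against which the far contribution is small. *)
Lemma relative_error (R : realType) (d c2 : nat) (M w b detg nc : R) :
  (0 < d)%N -> (0 < c2)%N -> 1 <= M -> 0 < w -> 0 < detg -> M = w * b ->
  detg <= (b * c2%:R ^+ 2) ^+ d ->
  let G := Num.sqrt ((2 * pi) ^+ d / ((w * (2 * pi) ^+ 2) ^+ d * detg)) in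
  `|nc - G| <= (expR (- (cutoff d c2 M / 4)) * 2 ^+ d + 64 * d%:R ^+ 2 / Num.sqrt M) * G
     + expR (- (cutoff d c2 M / 18)) ->
  0 < G /\ `|nc / G - 1| <= 66 * d%:R ^+ 2 / Num.sqrt M.
Proof.
move=> d0 c20 M1 w0 g0 ME gle G.
have pi0 : 0 < 2 * pi :> R by rewrite mulr_gt0 ?pi_gt0.
have c2R : 1 <= c2%:R :> R by rewrite (ler_nat _ 1).
have dR : 1 <= d%:R :> R by rewrite (ler_nat _ 1).
set D := (w * (2 * pi) ^+ 2) ^+ d * detg in G *.
have D0 : 0 < D by rewrite mulr_gt0 // exprn_gt0 // mulr_gt0 // exprn_gt0.
have G0 : 0 < G by rewrite sqrtr_gt0 divr_gt0 // exprn_gt0.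
set x := 8 * c2%:R * M.
have M0 : 0 < M by lra.
have x8 : 8 * M <= x.
  by rewrite /x ler_pM2r // ler_peMr.
have x0 : 0 < x by lra.
have lx : 0 <= ln x by apply: ln_ge0; lra.
have e18 : expR (- (cutoff d c2 M / 18)) = x^-1 ^+ d.
  by rewrite -expRM_natN //; congr expR; rewrite /cutoff -/x; field.
have e4 : expR (- (cutoff d c2 M / 4)) <= x^-1 ^+ d.
  rewrite -expRM_natN // ler_expR lerN2 /cutoff -/x.
  have : 0 <= d%:R * ln x by rewrite mulr_ge0.
  lra.
have s0 : 0 < Num.sqrt M by rewrite sqrtr_gt0.
have sM : Num.sqrt M ^+ 2 = M by rewrite sqr_sqrtr // ltW.
have s1 : 1 <= Num.sqrt M by rewrite -sqrtr1 ler_wsqrtr.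
have [d' dE] : exists d', d = d'.+1 by exists d.-1; rewrite prednK.
have pow1 (y : R) : 0 <= y -> y <= 1 -> y ^+ d <= y.
  by move=> y0 y1; rewrite dE exprS ler_piMr // exprn_ile1.
have b1 : expR (- (cutoff d c2 M / 4)) * 2 ^+ d <= (Num.sqrt M)^-1.
  apply: (@le_trans _ _ ((x^-1 * 2) ^+ d)).
    by rewrite exprMn ler_wpM2r // exprn_ge0.
  have y0 : 0 <= x^-1 * 2 by rewrite mulr_ge0 // invr_ge0 ltW.
  have yM : x^-1 * 2 <= M^-1.
    by rewrite mulrC ler_pdivrMr // -ler_pdivrMl ?invr_gt0 // invrK; lra.
  have M11 : M^-1 <= 1 by rewrite invf_le1.
  apply: le_trans (pow1 _ y0 _) _; first lra.
  apply: le_trans yM _; rewrite lef_pV2 ?posrE //.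
  by rewrite -{2}sM expr2 ler_peMl // ltW.
have b2 : x^-1 ^+ d <= G / Num.sqrt M.
  rewrite ler_pdivlMr //.
  have xs0 : 0 <= x^-1 ^+ d * Num.sqrt M by rewrite mulr_ge0 ?exprn_ge0 ?invr_ge0 ?(ltW x0) ?(ltW s0).
  rewrite -(ger0_norm xs0) -sqrtr_sqr /G ler_wsqrtr // exprMn sM ler_pdivlMr //.
  apply: (@le_trans _ _ (x^-1 ^+ d ^+ 2 * M *
     ((w * (2 * pi) ^+ 2) ^+ d * (b * c2%:R ^+ 2) ^+ d))).
    rewrite ler_wpM2l //; first by rewrite mulr_ge0 ?sqr_ge0 // ltW.
    by rewrite /D ler_wpM2l // exprn_ge0 // mulr_ge0 ?exprn_ge0 // ltW.
  rewrite -exprMn -exprM mulnC exprM mulrAC -exprMn.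
  have -> : x^-1 ^+ 2 * (w * (2 * pi) ^+ 2 * (b * c2%:R ^+ 2)) =
     (2 * pi) * ((2 * pi) / (64 * M)).
    have bE : b = M / w by rewrite ME mulrC mulKf // gt_eqF.
    rewrite bE /x; field.
    by rewrite !gt_eqF //; lra.
  rewrite exprMn -mulrA ler_piMr ?exprn_ge0 ?(ltW pi0) //.
  set y := 2 * pi / (64 * M).
  have y0 : 0 <= y by rewrite divr_ge0 ?(ltW pi0) // mulr_ge0 // ltW.
  have pi4 : pi < 4 :> R by have := @pihalf_lt2 R; lra.
  have yM : y * M <= 1.
    have -> : y * M = 2 * pi / 64 by rewrite /y; field; rewrite gt_eqF.
    lra.
  have y1 : y <= 1 by apply: le_trans yM; rewrite ler_peMr.
  by apply: le_trans yM; rewrite ler_wpM2r ?pow1 // ltW.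
move=> H; split=> //.
have -> : nc / G - 1 = (nc - G) / G by field; rewrite gt_eqF.
rewrite normrM normfV (gtr0_norm G0) ler_pdivrMr //; apply: le_trans H _.
rewrite e18; apply: (@le_trans _ _ (((Num.sqrt M)^-1 + 64 * d%:R ^+ 2 / Num.sqrt M) * G
   + G / Num.sqrt M)).
  by apply: lerD => //; rewrite ler_wpM2r ?(ltW G0) // lerD2r.
have dd : 1 <= d%:R ^+ 2 :> R by rewrite exprn_ege1.
have -> : ((Num.sqrt M)^-1 + 64 * d%:R ^+ 2 / Num.sqrt M) * G + G / Num.sqrt M =
  (64 * d%:R ^+ 2 + 2) * (G / Num.sqrt M) by field; rewrite gt_eqF.
have -> : 66 * d%:R ^+ 2 / Num.sqrt M * G = (66 * d%:R ^+ 2) * (G / Num.sqrt M) by field; rewrite gt_eqF.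
by rewrite ler_wpM2r ?divr_ge0 ?(ltW G0) ?(ltW s0) //; lra.
Qed.

(** The variance [M] is comparable to [m], and the remaining powers of [d] and
of the logarithm are bounded below by constants. *)
Lemma error_rate (R : realType) (d c2 : nat) (M m C : R) :
  (0 < d)%N -> (0 < c2)%N -> 1 <= M -> 0 < m -> m <= 2 * M -> 4 * (10 * 100) <= C ->
  66 * d%:R ^+ 2 / Num.sqrt M <=
    C * d%:R ^+ 3 * ln (2 * c2%:R * d%:R) `^ (3 / 2) / Num.sqrt m.
Proof.
move=> d0 c20 M1 m0 mM hC.
have cR2 : 1 <= c2%:R :> R by rewrite (ler_nat _ 1).
have dR : 1 <= d%:R :> R by rewrite (ler_nat _ 1).
have l2 := ln2_ge_half R.
have s0 : 0 < Num.sqrt m by rewrite sqrtr_gt0.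
have sM0 : 0 < Num.sqrt M by rewrite sqrtr_gt0; apply: lt_le_trans M1.
have sm : Num.sqrt m <= 2 * Num.sqrt M.
  have -> : 2 * Num.sqrt M = Num.sqrt (4 * M).
    rewrite -{1}(ger0_norm (ler0n R 2)) -sqrtr_sqr -sqrtrM ?sqr_ge0 //.
    by congr (Num.sqrt (_ * M)); ring.
  by rewrite ler_wsqrtr //; lra.
have l4 : 4^-1 <= ln (2 * c2%:R * d%:R) `^ (3 / 2) :> R.
  apply: powR_three_halves_ge; apply: le_trans l2 _.
  rewrite ler_ln ?posrE ?mulr_gt0 //; try lra.
  by have : 1 * 1 <= c2%:R * d%:R :> R; [rewrite ler_pM|lra].
rewrite ler_pdivlMr // mulrAC ler_pdivrMr //.
set P := _ `^ _ in l4 *.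
apply: (@le_trans _ _ (66 * d%:R ^+ 2 * (2 * Num.sqrt M))).
  by rewrite ler_wpM2l // mulr_ge0 // sqr_ge0.
rewrite mulrA ler_pM2r //.
have d23 : d%:R ^+ 2 <= d%:R ^+ 3 :> R by apply: ler_weXn2l.
have d30 : 0 <= d%:R ^+ 3 :> R by apply: exprn_ge0.
apply: (@le_trans _ _ (4 * (10 * 100) * d%:R ^+ 3 * 4^-1)); first lra.
by apply: ler_pM => //; rewrite ler_wpM2r.
Qed.

Lemma card_eq0_of_dim0 (B : finType) (V : {vspace ratfun B}) :
  (forall a : rat, [ffun=> a] \in V) -> \dim V = 0%N -> #|B| = 0%N.
Proof.
move=> const /eqP; rewrite dimv_eq0 => /eqP V0.
have : ([ffun=> 1] : ratfun B) \in 0%VS by rewrite -V0; apply: const.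
rewrite memv0 => /eqP/ffunP h; apply: eq_card0 => b; have := h b.
by rewrite !ffunE => /eqP; rewrite oner_eq0.
Qed.

Theorem theorem2p5 (R : realType) :
  exists C : R, 0 < C /\
  forall (B : finType) (V : {vspace ratfun B}) (c1 c2 c3 : nat),
    (1 <= c1)%N -> (1 <= c2)%N -> (1 <= c3)%N ->
    is_divisibility_constant V c1 ->
    bounded_integer_basis (@linf_norm B) c2 V ->
    bounded_integer_basis (@l1_norm B) c3 (orthv V) ->
    (forall b1 b2 : B, exists s : {perm B}, is_symmetry V s /\ s b1 = b2) ->
    (forall a : rat, [ffun=> a] \in V) ->
    forall N : nat, (c1 %| N)%N ->
      C * c2%:R * c3%:R ^+ 2 * (\dim V)%:R ^+ 6
          * ln (2 * c3%:R * (\dim V)%:R) ^+ 6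
        <= Num.min N%:R (#|B|%:R - N%:R) ->
      let p : R := N%:R / #|B|%:R in
      exists delta : R,
        (design_count V N)%:R
          = rho R V
              / ((2 * pi * p * (1 - p)) `^ ((\dim V)%:R / 2)
                 * p ^+ N * (1 - p) ^+ (#|B| - N))
              * (1 + delta)
        /\ `|delta| <= C * (\dim V)%:R ^+ 3
                         * ln (2 * c2%:R * (\dim V)%:R) `^ (3 / 2)
                       / Num.sqrt (Num.min N%:R (#|B|%:R - N%:R)).
Proof.
pose K5 : R := 10 ^+ 5; pose K7 : R := 10 ^+ 7.
have K5_ge : 10 <= K5 by rewrite /K5 -[leLHS]expr1 ler_weXn2l // ler1n.
have K7_ge : 100 <= K7.
  by rewrite /K7 (_ : 100 = 10 ^+ 2); [rewrite ler_weXn2l // ler1n|ring].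
exists (4 * K5 * K7); split; first by rewrite !mulr_gt0 //; lra.
move=> B V c1 c2 c3 _ c20 c30 divc bV2 bV3 trans const N c1N hN p.
have [psi [prim bpsi]] := exists_primitive_basis V.
have [d00|d0] := posnP (\dim V).
  (* Constants vanish only over the empty set; both sides are then equal to one. *)
  have B0 := card_eq0_of_dim0 const d00.
  have N0 : N = 0%N.
    move: hN; rewrite d00 B0 expr0n /= mulr0 mul0r le_min sub0r oppr_ge0.
    by rewrite (ler_nat _ _ 0) leqn0 => /andP[_ /eqP].
  have dc1 : design_count V 0 = 1%N.
    have BT (T : {set B}) : T = finset.set0.
      by apply/finset.setP => b; move: (card0_eq B0 b); rewrite !inE.
    rewrite /design_count (_ : [set T | _]%SET = [set finset.set0]%SET) ?cards1 //.
    apply/finset.setP => T; rewrite !inE (BT T) cards0 !eqxx /=; apply/asboolP => f _.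
    by rewrite big_set0 mulr0 big1 ?mulr0 // => b _; move: (card0_eq B0 b); rewrite inE.
  exists 0; rewrite normr0 d00 expr0n /= mulr0 !mul0r lexx; split=> //.
  rewrite /p N0 B0 mul0r powRr0 subn0 !expr0 !mulr1 addr0 mulr1 divr1.
  rewrite (rho_primitive R prim bpsi).
  have -> : \det (int_gram R psi) = 1.
    by move: (int_gram R psi); rewrite d00 => A; rewrite det_mx00.
  by rewrite sqrtr1 invr1 dc1.
set d := \dim V in psi prim bpsi d0 hN *.
have cR2 : 1 <= c2%:R :> R by rewrite (ler_nat _ 1).
have cR3 : 1 <= c3%:R :> R by rewrite (ler_nat _ 1).
have dR : 1 <= d%:R :> R by rewrite (ler_nat _ 1).
have l2 := ln2_ge_half R.
set m := Num.min _ _ in hN *.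
set Lg := ln (2 * c3%:R * d%:R) in hN *.
have Lg2 : 2^-1 <= Lg.
  apply: le_trans l2 _; rewrite /Lg ler_ln ?posrE ?mulr_gt0 //; try lra.
  by have : 1 * 1 <= c3%:R * d%:R :> R; [rewrite ler_pM|lra].
have Lg0 : 0 < Lg by lra.
have m0 : 0 < m.
  apply: lt_le_trans hN; rewrite !mulr_gt0 ?exprn_gt0 //; lra.
have N0 : (0 < N)%N by move: m0; rewrite lt_min ltr0n => /andP[].
have NB : (N < #|B|)%N by move: m0; rewrite lt_min subr_gt0 ltr_nat => /andP[].
have B0 : (0 < #|B|)%N by apply: leq_trans NB.
set M := size_variance R B N.
have [mM Mm] := @size_variance_bounds R B N m N0 NB erefl.
rewrite -/M in mM Mm.
set A := ln (2 * d%:R * c2%:R * c3%:R : R).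
have hA : K7 * c3%:R ^+ 2 * d%:R ^+ 5 * A ^+ 5 <= M.
  have hs := log_split R d0 c20 c30; rewrite -/A -/Lg -/K5 in hs.
  have Z0 : 0 <= K7 * c3%:R ^+ 2 * d%:R ^+ 5 by rewrite !mulr_ge0 ?exprn_ge0 //; lra.
  apply: (@le_trans _ _ (K7 * c3%:R ^+ 2 * d%:R ^+ 5 * (K5 * c2%:R * Lg ^+ 5))).
    by rewrite ler_wpM2l.
  have W0 : 0 <= K7 * K5 * c2%:R * c3%:R ^+ 2 * d%:R ^+ 5 * Lg ^+ 5.
    by rewrite !mulr_ge0 ?exprn_ge0 //; lra.
  have : K7 * K5 * c2%:R * c3%:R ^+ 2 * d%:R ^+ 5 * Lg ^+ 5 * 2^-1 <=
     K7 * K5 * c2%:R * c3%:R ^+ 2 * d%:R ^+ 5 * Lg ^+ 5 * (d%:R * Lg).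
    by rewrite ler_wpM2l //; rewrite -[leLHS]mul1r ler_pM //; lra.
  have -> : K7 * K5 * c2%:R * c3%:R ^+ 2 * d%:R ^+ 5 * Lg ^+ 5 * (d%:R * Lg) =
     (4 * K5 * K7 * c2%:R * c3%:R ^+ 2 * d%:R ^+ 6 * Lg ^+ 6) / 4 by field.
  have -> : K7 * c3%:R ^+ 2 * d%:R ^+ 5 * (K5 * c2%:R * Lg ^+ 5) =
     K7 * K5 * c2%:R * c3%:R ^+ 2 * d%:R ^+ 5 * Lg ^+ 5 by ring.
  move: hN mM; lra.
have [M1 T1 dTM farM'] := parameters_ok d0 c20 c30 hA.
clearbody K5 K7; clear hA hN.
set T := cutoff d c2 M in T1 dTM farM'.
pose m' := (2 * d * c2 * c3)%N.
have m'0 : (0 < m')%N by rewrite /m' !muln_gt0 d0 c20 c30.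
(* The number of cells is [m' ^ d], so [k] is the first multiple of [d] for which
   the pigeonhole argument is guaranteed to apply. *)
pose l := (trunc_log 2 m').+1; pose k := (l * d)%N.
have mk : (m' ^ d < 2 ^ k)%N by rewrite /k expnM ltn_exp2r // trunc_log_ltn.
have kA : k%:R <= 4 * d%:R * A.
  have := trunc_log_ln R m'0; rewrite -/l /m' !natrM -/A => lA.
  have A2 : 2^-1 <= A.
    apply: le_trans l2 _; rewrite /A ler_ln ?posrE ?mulr_gt0 //; try lra.
    have : 1 * 1 * 1 <= d%:R * c2%:R * c3%:R :> R by rewrite !ler_pM.
    lra.
  have : l%:R * d%:R <= 4 * A * d%:R by rewrite ler_pM2r; lra.
  lra.
have farM : T * c3%:R ^+ 2 * k%:R ^+ 4 <= 4 * M.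
  apply: le_trans farM'; rewrite ler_wpM2l //.
    by rewrite mulr_ge0 ?exprn_ge0 //; lra.
  by rewrite ler_pXn2r ?nnegrE //; apply: le_trans kA.
have [phi [phic bphi]] := exists_int_basis bV2.
have [g gP] : divisible_by V N%:Z by apply/(divc.2 N%:Z).
have LL := @local_limit R B V d psi prim bpsi trans const N g gP N0 NB d0 phi c2 c3 k T
  bphi phic bV3 c20 c30 mk T1 dTM farM.
have p01 : 0 < p < 1.
  have B0' : 0 < #|B|%:R :> R by rewrite ltr0n.
  apply/andP; split; first by rewrite divr_gt0 // ltr0n.
  by rewrite /p ltr_pdivrMr // mul1r ltr_nat.
have /andP[p0 p1] := p01.
have q0 : 0 < 1 - p by rewrite subr_gt0.
have w0 : 0 < p * (1 - p) by rewrite mulr_gt0.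
have g0 := posdef_det_gt0 (posdef_int_gram R prim).
have massE : gauss_mass (phase_covariance R psi N) =
   Num.sqrt ((2 * pi) ^+ d / ((p * (1 - p) * (2 * pi) ^+ 2) ^+ d * \det (int_gram R psi))).
  by rewrite /gauss_mass /phase_covariance detZ.
rewrite massE in LL.
have [G0 dl] := relative_error d0 c20 M1 w0 g0 erefl (det_int_gram_le R prim bpsi bphi phic) LL.
set G := Num.sqrt _ in G0 dl LL.
set nc := normalized_count R V N in dl.
have pi0 : 0 < 2 * pi :> R by rewrite mulr_gt0 ?pi_gt0.
have GE : G = rho R V / (2 * pi * p * (1 - p)) `^ (d%:R / 2).
  rewrite (rho_primitive R prim bpsi) powR_half_nat; last first.
    by rewrite !mulr_ge0 // ?pi_ge0 // ?(ltW p0) ?(ltW q0).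
  rewrite -sqrtrV ?(ltW g0) // -sqrtrV ?exprn_ge0 ?mulr_ge0 ?pi_ge0 ?(ltW p0) ?(ltW q0) //.
  rewrite -sqrtrM ?invr_ge0 ?(ltW g0) //; congr Num.sqrt.
  have -> : (p * (1 - p) * (2 * pi) ^+ 2) ^+ d = (2 * pi) ^+ d * (2 * pi * p * (1 - p)) ^+ d.
    by rewrite -exprMn; congr (_ ^+ _); ring.
  rewrite !invfM mulrA mulrA divff ?gt_eqF ?exprn_gt0 // mul1r mulrC.
  by [].
exists (nc / G - 1); split.
  have -> : 1 + (nc / G - 1) = nc / G by rewrite addrC subrK.
  have X0 : p ^+ N * (1 - p) ^+ (#|B| - N) != 0.
    by rewrite mulf_neq0 // expf_neq0 // gt_eqF.
  set P := _ `^ _ in GE *.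
  rewrite (_ : rho R V / _ = G / (p ^+ N * (1 - p) ^+ (#|B| - N))); last first.
    by rewrite GE -[P * _ * _]mulrA invfM mulrA.
  rewrite /nc /normalized_count -/p; move: X0; set X := p ^+ N * _ => X0.
  by field; rewrite X0 gt_eqF.
apply: (le_trans dl); apply: error_rate => //.
by rewrite -mulrA ler_pM2l // ler_pM.
Qed.
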